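(* Fix $T>0$ and assume $\epsilon_N\to0$ (in particular $\sup_N\epsilon_N<\infty$). Then the sequence $\{u_N\}$ of SV approximations is an approximate solution sequence for the incompressible Euler equations on $[0,T]$, i.e.: (1) $\{u_N\}$ is uniformly bounded in $L^\infty([0,T];L^2(\mathbb{T}^2;\mathbb{R}^2))$, and there is $L>1$ such that $\{u_N\}$ is uniformly bounded in $\mathrm{Lip}((0,T);H^{-L}(\mathbb{T}^2;\mathbb{R}^2))$, i.e. $\|u_N(\cdot,t_2)-u_N(\cdot,t_1)\|_{H^{-L}}\le C|t_2-t_1|$ with $C$ independent of $N$; (2) for every $\Phi\in C^\infty([0,T)\times\mathbb{T}^2;\mathbb{R}^2)$ with $\operatorname{div}\Phi=0$, \[ \lim_{N\to\infty}\int_0^T\!\!\int_{\mathbb{T}^2}\partial_t\Phi\cdot u_N+\nabla\Phi:(u_N\otimes u_N)\,dx\,dt+\int_{\mathbb{T}^2}\Phi(x,0)\cdot u_N(x,0)\,dx=0; \] (3) $\operatorname{div}u_N=0$ in $\mathcal{D}'([0,T]\times\mathbb{T}^2)$.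
   Context: Let $\mathbb{T}^2=\mathbb{R}^2/(2\pi\mathbb{Z})^2$. For $k=(k_1,k_2)\in\mathbb{Z}^2$ let $|k|$ denote the Euclidean norm and $|k|_\infty=\max(|k_1|,|k_2|)$. Fourier coefficients are $\hat f_k=(2\pi)^{-2}\int_{\mathbb{T}^2}f(x)e^{-ik\cdot x}\,dx$. $P_Nf:=\sum_{|k|_\infty\le N}\hat f_k e^{ik\cdot x}$. Convolution is $(K*f)(x)=\int_{\mathbb{T}^2}K(x-y)f(y)\,dy$, so $\widehat{(K*f)}_k=\widetilde K_k\hat f_k$ with $\widetilde K_k:=\int_{\mathbb{T}^2}K(x)e^{-ik\cdot x}dx$. For $v=(v^1,v^2)$, $\mathrm{curl}\,v=\partial_1v^2-\partial_2v^1$. Initial data: $u_0\in L^2(\mathbb{T}^2;\mathbb{R}^2)$ with $\operatorname{div}u_0=0$ in distributions and $\int u_0\,dx=0$; $\omega_0:=\mathrm{curl}\,u_0\in H^{-1}(\mathbb{T}^2)$. SV scheme: for integers $N\ge2$ fix parameters $\epsilon_N>0$, $m_N\ge0$, $1\le a_N\le N$, and: numbers $\hat R_k\in[0,1]$ with $\hat R_k=1$ for $|k|\le m_N$, $\hat R_k=0$ for $|k|>2m_N$; $R_{m_N}$ is the trigonometric polynomial with $\widetilde{(R_{m_N})}_k=\hat R_k$, and $Q_N$ is the Fourier multiplier with symbol $\hat Q_k:=1-\hat R_k$; it is assumed $\|R_{m_N}\|_{L^1}\le C\log(N)^2$ with $C$ independent of $N$; $K_{a_N}$ is a trigonometric polynomial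 with $\widetilde{(K_{a_N})}_k=0$ unless $|k|_\infty\le a_N$, $|\widetilde{(K_{a_N})}_k|\le1$, and $\|K_{a_N}\|_{L^1}\le C\log(N)^2$. The SV approximation is the trigonometric polynomial field $u_N(x,t)=\sum_{0<|k|_\infty\le N}\hat u_k(t)e^{ik\cdot x}$, $k\cdot\hat u_k=0$, solving $\partial_tu_N+P_N(u_N\cdot\nabla u_N)+\nabla p_N=\epsilon_N\Delta(Q_Nu_N)$, $\operatorname{div}u_N=0$, $u_N(\cdot,0)=K_{a_N}*u_0$; in Fourier variables, for $0<|k|_\infty\le N$: $\frac{d}{dt}\hat u_k+\big(I-\frac{k\otimes k}{|k|^2}\big)\sum_{|\ell|_\infty,|k-\ell|_\infty\le N}i(\ell\cdot\hat u_{k-\ell})\hat u_\ell=-\epsilon_N|k|^2\hat Q_k\hat u_k$, $\hat u_k(0)=\widetilde{(K_{a_N})}_k(\widehat{u_0})_k$.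
   Formalization: The test fields Φ in (2) are required to vanish for times near T (the claim fails for Φ not vanishing at T), and the kernels R_{m_N}, K_{a_N} are assumed real-valued (R̂_{-k}=R̂_k, K̃_{-k}=conj K̃_k), without which u_N need not be R²-valued. *)

(* Defs.v *)
From Stdlib Require Import Reals ZArith List.
From Coquelicot Require Import Coquelicot.
Open Scope R_scope.

Definition Zk := (Z * Z)%type.
Definition vecC := (C * C)%type.

Definition zrange (M : nat) : list Z :=
  map (fun i => (Z.of_nat i - Z.of_nat M)%Z) (seq 0 (2 * M + 1)).
Definition boxlist (M : nat) : list Zk := list_prod (zrange M) (zrange M).

Definition vzero : vecC := (RtoC 0, RtoC 0).
Definition vadd (a b : vecC) : vecC := (Cplus (fst a) (fst b), Cplus (snd a) (snd b)).
Definition vsub (a b : vecC) : vecC := (Cminus (fst a) (fst b), Cminus (snd a) (snd b)).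
Definition vscal (c : C) (a : vecC) : vecC := (Cmult c (fst a), Cmult c (snd a)).
Definition vconj (a : vecC) : vecC := (Cconj (fst a), Cconj (snd a)).
Definition vnorm2 (v : vecC) : R := (Cmod (fst v)) ^ 2 + (Cmod (snd v)) ^ 2.

Definition boxsumR (M : nat) (f : Zk -> R) : R :=
  fold_right (fun k acc => f k + acc) 0 (boxlist M).
Definition boxsumC (M : nat) (f : Zk -> C) : C :=
  fold_right (fun k acc => Cplus (f k) acc) (RtoC 0) (boxlist M).
Definition boxsumV (M : nat) (f : Zk -> vecC) : vecC :=
  fold_right (fun k acc => vadd (f k) acc) vzero (boxlist M).

Definition supnorm (k : Zk) : Z := Z.max (Z.abs (fst k)) (Z.abs (snd k)).
Definition inbox (M : nat) (k : Zk) : bool := (supnorm k <=? Z.of_nat M)%Z.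
Definition inbox0 (M : nat) (k : Zk) : bool :=
  inbox M k && negb (Z.eqb (supnorm k) 0).
Definition knorm2 (k : Zk) : R := IZR (fst k * fst k + snd k * snd k).
Definition knorm (k : Zk) : R := sqrt (knorm2 k).
Definition Zkneg (k : Zk) : Zk := (- fst k, - snd k)%Z.
Definition Zksub (k l : Zk) : Zk := (fst k - fst l, snd k - snd l)%Z.

Definition cis (th : R) : C := (cos th, sin th).
Definition kdotx (k : Zk) (x1 x2 : R) : R := IZR (fst k) * x1 + IZR (snd k) * x2.
Definition kvec (k : Zk) : vecC := (RtoC (IZR (fst k)), RtoC (IZR (snd k))).
Definition kdotv (k : Zk) (v : vecC) : C :=
  Cplus (Cmult (RtoC (IZR (fst k))) (fst v)) (Cmult (RtoC (IZR (snd k))) (snd v)).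
Definition leray (k : Zk) (v : vecC) : vecC :=
  vsub v (vscal (Cdiv (kdotv k v) (RtoC (knorm2 k))) (kvec k)).

Definition coefN (N : nat) (c : Zk -> vecC) (k : Zk) : vecC :=
  if inbox0 N k then c k else vzero.

Definition nonlin (N : nat) (c : Zk -> vecC) (k : Zk) : vecC :=
  boxsumV N (fun l =>
    if inbox N (Zksub k l)
    then vscal (Cmult Ci (kdotv l (coefN N c (Zksub k l)))) (coefN N c l)
    else vzero).

Definition sv_rhs (N : nat) (eps : R) (Qhat : Zk -> R) (c : Zk -> vecC) (k : Zk) : vecC :=
  vadd (vscal (RtoC (-1)) (leray k (nonlin N c k)))
       (vscal (RtoC (- (eps * knorm2 k * Qhat k))) (c k)).

Definition is_SV_solution (T eps : R) (N : nat) (Rhat : Zk -> R) (Khat : Zk -> C)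
    (u0hat : Zk -> vecC) (uh : R -> Zk -> vecC) : Prop :=
  forall k, inbox0 N k = true ->
    (forall t, 0 <= t <= T -> kdotv k (uh t k) = RtoC 0) /\
    uh 0 k = vscal (Khat k) (u0hat k) /\
    (forall t, 0 <= t <= T ->
       filterlim (fun s => uh s k) (within (fun s => 0 <= s <= T) (locally t))
                 (locally (uh t k))) /\
    (forall t, 0 < t < T ->
       is_derive (fun s => uh s k) t
                 (sv_rhs N eps (fun j => 1 - Rhat j) (uh t) k)).

Definition uphys (N : nat) (c : Zk -> vecC) (x1 x2 : R) : vecC :=
  boxsumV N (fun k => if inbox0 N k then vscal (cis (kdotx k x1 x2)) (c k) else vzero).

(** * Integrals and norms on T^2 = [0,2pi]^2 (integrands are continuous) *)
Definition int2R (f : R -> R -> R) : R :=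
  RInt (fun x1 => RInt (fun x2 => f x1 x2) 0 (2 * PI)) 0 (2 * PI).
Definition int2C (f : R -> R -> C) : C :=
  RInt (V := C_R_CompleteNormedModule)
    (fun x1 => RInt (V := C_R_CompleteNormedModule) (fun x2 => f x1 x2) 0 (2 * PI)) 0 (2 * PI).

Definition L2norm (f : R -> R -> vecC) : R := sqrt (int2R (fun x1 x2 => vnorm2 (f x1 x2))).
Definition L1normC (f : R -> R -> C) : R := int2R (fun x1 x2 => Cmod (f x1 x2)).

Definition HnegNorm (L : R) (N : nat) (c : Zk -> vecC) : R :=
  sqrt (boxsumR N (fun k =>
    if inbox0 N k then Rpower (1 + knorm2 k) (- L) * vnorm2 (c k) else 0)).

(* trigonometric polynomial with tilde-coefficients ch (supported in |k|_inf <= M):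
   f(x) = (2pi)^{-2} sum_k ch_k e^{ik.x}, so that int f e^{-ik.x} dx = ch_k *)
Definition trigpoly (M : nat) (ch : Zk -> C) (x1 x2 : R) : C :=
  boxsumC M (fun k => Cmult (RtoC (/ (2 * PI) ^ 2)) (Cmult (ch k) (cis (kdotx k x1 x2)))).

Definition fn3 := R -> R -> R -> R.
Definition pd (i : nat) (f : fn3) : fn3 := fun t x y =>
  match i with
  | O => Derive (fun s => f s x y) t
  | S O => Derive (fun s => f t s y) x
  | _ => Derive (fun s => f t x s) y
  end.
Definition ex_pd (i : nat) (f : fn3) (t x y : R) : Prop :=
  match i with
  | O => ex_derive (fun s => f s x y) t
  | S O => ex_derive (fun s => f t s y) x
  | _ => ex_derive (fun s => f t x s) y
  end.
Definition iter_pd (ds : list nat) (f : fn3) : fn3 := fold_right pd f ds.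
Definition smooth3 (f : fn3) : Prop :=
  forall ds : list nat,
    (forall t x y, continuous (fun p : R * R * R =>
                      iter_pd ds f (fst (fst p)) (snd (fst p)) (snd p)) (t, x, y)) /\
    (forall i t x y, ex_pd i (iter_pd ds f) t x y).
Definition periodic_x (f : fn3) : Prop :=
  forall t x y, f t (x + 2 * PI) y = f t x y /\ f t x (y + 2 * PI) = f t x y.

Definition is_test_field (T : R) (Phi1 Phi2 : fn3) : Prop :=
  smooth3 Phi1 /\ smooth3 Phi2 /\ periodic_x Phi1 /\ periodic_x Phi2 /\
  (forall t x y, 0 <= t < T -> pd 1 Phi1 t x y + pd 2 Phi2 t x y = 0) /\
  (exists T', T' < T /\ forall t x y, T' <= t -> Phi1 t x y = 0 /\ Phi2 t x y = 0).

Definition weak_euler (T : R) (Phi1 Phi2 : fn3) (u : R -> R -> R -> vecC) : C :=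
  Cplus
    (RInt (V := C_R_CompleteNormedModule) (fun t => int2C (fun x1 x2 =>
       let a := fst (u t x1 x2) in let b := snd (u t x1 x2) in
       Cplus (Cplus (Cmult (RtoC (pd 0 Phi1 t x1 x2)) a) (Cmult (RtoC (pd 0 Phi2 t x1 x2)) b))
       (Cplus (Cplus (Cmult (RtoC (pd 1 Phi1 t x1 x2)) (Cmult a a))
                     (Cmult (RtoC (pd 1 Phi2 t x1 x2)) (Cmult a b)))
              (Cplus (Cmult (RtoC (pd 2 Phi1 t x1 x2)) (Cmult b a))
                     (Cmult (RtoC (pd 2 Phi2 t x1 x2)) (Cmult b b)))))) 0 T)
    (int2C (fun x1 x2 =>
       Cplus (Cmult (RtoC (Phi1 0 x1 x2)) (fst (u 0 x1 x2)))
             (Cmult (RtoC (Phi2 0 x1 x2)) (snd (u 0 x1 x2))))).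

Definition weak_div (T : R) (psi : fn3) (u : R -> R -> R -> vecC) : C :=
  RInt (V := C_R_CompleteNormedModule) (fun t => int2C (fun x1 x2 =>
    Cplus (Cmult (RtoC (pd 1 psi t x1 x2)) (fst (u t x1 x2)))
          (Cmult (RtoC (pd 2 psi t x1 x2)) (snd (u t x1 x2))))) 0 T.

(* Main.v *)
Require Import Defs.
From Stdlib Require Import Reals ZArith List Lra Lia Psatz Permutation Classical ClassicalEpsilon.
From Coquelicot Require Import Coquelicot.
Open Scope R_scope.

(** Write V for the Fourier coefficients of u_N and c_k(t) for the integral of Phi(t,.) e^{ik.x}.
    Uniqueness for the Galerkin system gives V_{-k} = conj V_k, so pairing the equation with V_{-k}
    and symmetrizing (k,l) -> (-l,-k) cancels the nonlinearity: the energy does not increase, which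
    with Parseval bounds u_N in L^2.  Since div u_N = 0, the nonlinear coefficient at k is at most
    |k| times the energy, so dV_k/dt = O(|k|^2), whence the Lipschitz bound in H^{-4}.
    For the weak form, c_k is orthogonal to k and the Galerkin equation reproduces every interaction
    (m,l) with m+l inside the box; the residual consists of the interactions with m+l outside the
    box, negligible because c_k = O(|k|^{-7}) uniformly in time, and of the dissipation, O(eps_N). *)

(** * Finite sums *)

(** Reality has to be proved because [is_SV_solution] constrains complex coefficients only: without
    V_{-k} = conj V_k, the quantity obtained by pairing with V_{-k} is a quadratic form without
    sign, not the energy. The data and multipliers are symmetric, so the reflected coefficients
    solve the same finite system; its Lipschitz constant depends on N, which is harmless since only
    coincidence is concluded. Uniformity in N rests on one identity: div u_N = 0 gives l.V_{k-l} =
    k.V_{k-l}, so the derivative falls on the output frequency k and no power of N is lost. The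
    pressure never appears, because the Leray projection is paired only with vectors orthogonal to
    k. The exponents are power counts. A box contains O(N^4) pairs (m,l) and the gradient costs one
    power, so decay of order 7 leaves N^{-2}. The squared time increments grow like |k|^4, so the
    weight of H^{-4} leaves (1+|k|^2)^{-2}, summable over Z^2. No compactness enters the limit: the
    L^2 bound and the smoothness of Phi suffice. *)

Definition csum {A : Type} (l : list A) (f : A -> C) : C :=
  fold_right (fun k acc => Cplus (f k) acc) (RtoC 0) l.
Definition rsum {A : Type} (l : list A) (f : A -> R) : R :=
  fold_right (fun k acc => f k + acc) 0 l.

Lemma csum_ext {A} (l : list A) f g :
  (forall k, In k l -> f k = g k) -> csum l f = csum l g.
Proof.
  induction l as [|x l IH]; simpl; intros H; auto.
  rewrite H by auto. rewrite IH; auto.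
Qed.

Lemma csum_plus {A} (l : list A) f g :
  csum l (fun k => Cplus (f k) (g k)) = Cplus (csum l f) (csum l g).
Proof. induction l as [|x l IH]; simpl; [|rewrite IH]; ring. Qed.

Lemma csum_scal {A} (l : list A) c f :
  csum l (fun k => Cmult c (f k)) = Cmult c (csum l f).
Proof. induction l as [|x l IH]; simpl; [|rewrite IH]; ring. Qed.

Lemma csum_minus {A} (l : list A) f g :
  csum l (fun k => Cminus (f k) (g k)) = Cminus (csum l f) (csum l g).
Proof. induction l as [|x l IH]; simpl; [|rewrite IH]; ring. Qed.

Lemma csum_zero {A} (l : list A) f :
  (forall k, In k l -> f k = RtoC 0) -> csum l f = RtoC 0.
Proof.
  induction l as [|x l IH]; simpl; intros H; auto.
  rewrite H, IH by auto. ring.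
Qed.

Lemma csum_swap {A B} (l : list A) (l' : list B) f :
  csum l (fun x => csum l' (fun y => f x y)) = csum l' (fun y => csum l (fun x => f x y)).
Proof.
  induction l as [|x l IH]; simpl.
  - rewrite csum_zero; auto.
  - rewrite IH, <- csum_plus. reflexivity.
Qed.

Lemma csum_perm {A} (l l' : list A) f : Permutation l l' -> csum l f = csum l' f.
Proof.
  induction 1; simpl; auto.
  - rewrite IHPermutation; auto.
  - ring.
  - congruence.
Qed.

Lemma csum_map {A B} (l : list A) (h : A -> B) f :
  csum (map h l) f = csum l (fun x => f (h x)).
Proof. induction l as [|x l IH]; simpl; [|rewrite IH]; auto. Qed.

Lemma csum_filter {A} (l : list A) p f :
  csum (filter p l) f = csum l (fun x => if p x then f x else RtoC 0).
Proof.
  induction l as [|x l IH]; simpl; auto.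
  destruct (p x); simpl; rewrite IH; auto. ring.
Qed.

Lemma csum_conj {A} (l : list A) f : Cconj (csum l f) = csum l (fun x => Cconj (f x)).
Proof.
  induction l as [|x l IH]; simpl.
  - apply injective_projections; simpl; ring.
  - rewrite Cplus_conj, IH. auto.
Qed.

Lemma csum_delta {A} (l : list A) (p : A -> bool) (x : A) f :
  NoDup l -> In x l -> (forall y, p y = true <-> y = x) ->
  csum l (fun y => if p y then f y else RtoC 0) = f x.
Proof.
  intros Hn Hi Hp. induction Hn as [|z l Hz Hn IH]; simpl. destruct Hi.
  destruct Hi as [->|Hi].
  - rewrite (proj2 (Hp x) eq_refl). rewrite csum_zero. ring.
    intros k Hk. destruct (p k) eqn:E; auto. apply Hp in E. subst; tauto.
  - rewrite IH by auto. destruct (p z) eqn:E. apply Hp in E; subst; tauto. ring.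
Qed.

Lemma csum_bij {A B} (l : list A) (l' : list B) (h : A -> B) f :
  NoDup l -> NoDup l' -> (forall x y, In x l -> In y l -> h x = h y -> x = y) ->
  (forall y, In y l' <-> exists x, In x l /\ h x = y) ->
  csum l' f = csum l (fun x => f (h x)).
Proof.
  intros Hl Hl' Hinj Him. rewrite <- (csum_map l h f). apply csum_perm.
  apply NoDup_Permutation; auto.
  - clear Him. induction Hl; simpl; constructor.
    + rewrite in_map_iff. intros (y & E & Hy). apply Hinj in E; simpl; auto. subst; auto.
    + apply IHHl. intros; apply Hinj; simpl; auto.
  - intros y. rewrite Him, in_map_iff. split; intros (x & ? & ?); exists x; auto.
Qed.

Lemma rsum_ext {A} (l : list A) f g :
  (forall k, In k l -> f k = g k) -> rsum l f = rsum l g.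
Proof.
  induction l as [|x l IH]; simpl; intros H; auto.
  rewrite H by auto. rewrite IH; auto.
Qed.

Lemma rsum_le {A} (l : list A) f g :
  (forall k, In k l -> f k <= g k) -> rsum l f <= rsum l g.
Proof.
  induction l as [|x l IH]; simpl; intros H. lra.
  apply Rplus_le_compat; auto.
Qed.

Lemma rsum_scal {A} (l : list A) c f : rsum l (fun k => c * f k) = c * rsum l f.
Proof. induction l as [|x l IH]; simpl; [|rewrite IH]; ring. Qed.

Lemma rsum_plus {A} (l : list A) f g :
  rsum l (fun k => f k + g k) = rsum l f + rsum l g.
Proof. induction l as [|x l IH]; simpl; [|rewrite IH]; ring. Qed.

Lemma rsum_nonneg {A} (l : list A) f :
  (forall k, In k l -> 0 <= f k) -> 0 <= rsum l f.
Proof.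
  intros H. replace 0 with (rsum l (fun _ => 0)). apply rsum_le; auto.
  induction l; simpl; auto. rewrite IHl. lra. intros; apply H; simpl; auto.
Qed.

Lemma rsum_const {A} (l : list A) c : rsum l (fun _ => c) = INR (length l) * c.
Proof.
  induction l as [|x l IH]. simpl; ring.
  cbn [rsum fold_right length]. fold (rsum l (fun _ => c)). rewrite S_INR, IH. ring.
Qed.

Lemma rsum_in_le {A} (l : list A) f x :
  (forall k, In k l -> 0 <= f k) -> In x l -> f x <= rsum l f.
Proof.
  induction l as [|y l IH]; simpl; intros H Hi. tauto.
  destruct Hi as [->|Hi].
  - assert (0 <= rsum l f) by (apply rsum_nonneg; auto). lra.
  - assert (f x <= rsum l f) by auto. assert (0 <= f y) by auto. lra.
Qed.

Lemma rsum_map {A B} (l : list A) (h : A -> B) f :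
  rsum (map h l) f = rsum l (fun x => f (h x)).
Proof. induction l as [|x l IH]; simpl; [|rewrite IH]; auto. Qed.

Lemma rsum_app {A} (l l' : list A) f : rsum (l ++ l') f = rsum l f + rsum l' f.
Proof. induction l as [|x l IH]; simpl; [|rewrite IH]; ring. Qed.

Lemma rsum_prod {A B} (l : list A) (l' : list B) f g :
  rsum (list_prod l l') (fun p => f (fst p) * g (snd p)) = rsum l f * rsum l' g.
Proof.
  induction l as [|x l IH]; simpl. ring.
  rewrite rsum_app, IH, rsum_map. simpl. rewrite rsum_scal. ring.
Qed.

Lemma rsum_incl {A} (l l' : list A) f :
  NoDup l -> incl l l' -> (forall k, 0 <= f k) -> rsum l f <= rsum l' f.
Proof.
  intros Hn. revert l'. induction Hn as [|x l Hx Hn IH]; simpl; intros l' Hi Hf.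
  - apply rsum_nonneg; auto.
  - destruct (in_split x l') as (l1 & l2 & ->). apply Hi; simpl; auto.
    rewrite rsum_app. simpl.
    assert (H : rsum l f <= rsum (l1 ++ l2) f).
    { apply IH; auto. intros y Hy. assert (H := Hi y (or_intror Hy)).
      apply in_app_iff in H. apply in_app_iff. destruct H as [|[->|]]; auto. tauto. }
    rewrite rsum_app in H. lra.
Qed.

Lemma RtoC_rsum {A} (l : list A) f : RtoC (rsum l f) = csum l (fun k => RtoC (f k)).
Proof. induction l as [|x l IH]; simpl; auto. rewrite RtoC_plus, IH. auto. Qed.

Lemma Re_csum {A} (l : list A) f : fst (csum l f) = rsum l (fun k => fst (f k)).
Proof. induction l as [|x l IH]; simpl; auto. rewrite IH. auto. Qed.

Lemma Cmod_csum {A} (l : list A) f : Cmod (csum l f) <= rsum l (fun k => Cmod (f k)).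
Proof.
  induction l as [|x l IH]; simpl. rewrite Cmod_0; lra.
  eapply Rle_trans. apply Cmod_triangle. lra.
Qed.

(** Cauchy-Schwarz against the constant 1. In the induction the cross term [2 * f x * s] is split by
    Young's inequality with weight n, the length of the tail; an empty tail is treated apart because
    of the division by n. *)
Lemma rsum_CS {A} (l : list A) f :
  (rsum l f)^2 <= INR (length l) * rsum l (fun k => (f k)^2).
Proof.
  induction l as [|x l IH]. simpl; lra.
  cbn [rsum fold_right length]. fold (rsum l f). fold (rsum l (fun k => f k ^2)).
  rewrite S_INR. set (n := INR (length l)) in *. set (s := rsum l f) in *.
  set (q := rsum l (fun k => f k ^ 2)) in *.
  assert (0 <= n) by apply pos_INR.
  destruct (Req_dec n 0) as [E|E].
  - rewrite E in *. assert (s = 0) by nra. assert (0 <= q).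
    { apply rsum_nonneg. intros. apply pow2_ge_0. } rewrite H0. nra.
  - assert (0 < n) by lra.
    assert (2 * f x * s <= n * f x ^ 2 + s^2 / n).
    { assert (0 <= (n * f x - s)^2 / n).
      { apply Rdiv_le_0_compat; auto. apply pow2_ge_0. }
      replace (s^2/n) with ((n * f x - s)^2 / n - n * f x ^2 + 2 * f x * s) by (field; lra).
      lra. }
    assert (s^2 / n <= q).
    { apply Rmult_le_reg_l with n; auto. replace (n * (s^2/n)) with (s^2) by (field; lra). lra. }
    nra.
Qed.

(** * Frequency boxes *)

Lemma in_zrange M z : In z (zrange M) <-> (Z.abs z <= Z.of_nat M)%Z.
Proof.
  unfold zrange. rewrite in_map_iff. split.
  - intros (i & <- & Hi). apply in_seq in Hi. lia.
  - intros H. exists (Z.to_nat (z + Z.of_nat M)). split. lia. apply in_seq. lia.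
Qed.

Lemma NoDup_zrange M : NoDup (zrange M).
Proof.
  unfold zrange. apply FinFun.Injective_map_NoDup. intros x y; lia. apply seq_NoDup.
Qed.

Lemma in_boxlist M k : In k (boxlist M) <-> inbox M k = true.
Proof.
  destruct k as [k1 k2]. unfold boxlist, inbox, supnorm. change Zk with (Z * Z)%type.
  rewrite in_prod_iff, !in_zrange.
  rewrite Z.leb_le. simpl. lia.
Qed.

Lemma NoDup_list_prod {A B} (l : list A) (l' : list B) :
  NoDup l -> NoDup l' -> NoDup (list_prod l l').
Proof.
  intros Hl Hl'. induction Hl as [|x l Hx Hl IH]; simpl. constructor.
  apply NoDup_app; auto.
  - apply FinFun.Injective_map_NoDup; auto. intros a b; congruence.
  - intros [a b] H H'. apply in_map_iff in H as (y & E & _). injection E; intros; subst.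
    apply in_prod_iff in H'. tauto.
Qed.

Lemma NoDup_boxlist M : NoDup (boxlist M).
Proof. apply NoDup_list_prod; apply NoDup_zrange. Qed.

Lemma length_boxlist M : length (boxlist M) = ((2*M+1)*(2*M+1))%nat.
Proof.
  unfold boxlist, zrange. change Zk with (Z * Z)%type.
  rewrite length_prod, !length_map, length_seq. auto. Qed.

Lemma inbox_neg M k : inbox M (Zkneg k) = inbox M k.
Proof. unfold inbox, supnorm, Zkneg; simpl. rewrite !Z.abs_opp. auto. Qed.

Lemma inbox0_neg M k : inbox0 M (Zkneg k) = inbox0 M k.
Proof. unfold inbox0. rewrite inbox_neg. unfold supnorm, Zkneg; simpl. rewrite !Z.abs_opp. auto. Qed.

Lemma Zkneg_neg k : Zkneg (Zkneg k) = k.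
Proof. destruct k; unfold Zkneg; simpl; f_equal; lia. Qed.

Lemma csum_box_neg M f : csum (boxlist M) f = csum (boxlist M) (fun k => f (Zkneg k)).
Proof.
  apply csum_bij; try apply NoDup_boxlist.
  - intros x y _ _ E. rewrite <- (Zkneg_neg x), E. apply Zkneg_neg.
  - intros y. split.
    + intros H. exists (Zkneg y). rewrite Zkneg_neg, !in_boxlist, inbox_neg in *. auto.
    + intros (x & H & <-). rewrite in_boxlist, inbox_neg in *. auto.
Qed.

Definition Zkadd (k l : Zk) : Zk := (fst k + fst l, snd k + snd l)%Z.

Lemma Zkadd_sub k l : Zkadd (Zksub k l) l = k.
Proof. destruct k, l; unfold Zkadd, Zksub; simpl; f_equal; lia. Qed.
Lemma Zksub_add k l : Zksub (Zkadd k l) l = k.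
Proof. destruct k, l; unfold Zkadd, Zksub; simpl; f_equal; lia. Qed.

(** The substitution m = k - l, under which the range of summation and the cut-off exchange
    roles. *)
Lemma csum_box_shift M l (f : Zk -> C) :
  csum (boxlist M) (fun m => if inbox M (Zkadd m l) then f m else RtoC 0)
  = csum (boxlist M) (fun k => if inbox M (Zksub k l) then f (Zksub k l) else RtoC 0).
Proof.
  rewrite <- (csum_filter _ (fun m => inbox M (Zkadd m l))).
  rewrite <- (csum_filter _ (fun k => inbox M (Zksub k l)) (fun k => f (Zksub k l))).
  apply (csum_bij (filter (fun k => inbox M (Zksub k l)) (boxlist M)) _ (fun k => Zksub k l)).
  - apply NoDup_filter, NoDup_boxlist.
  - apply NoDup_filter, NoDup_boxlist.
  - intros x y _ _ E. rewrite <- (Zkadd_sub x l), E. apply Zkadd_sub.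
  - intros y. rewrite filter_In, in_boxlist. split.
    + intros []. exists (Zkadd y l). rewrite filter_In, in_boxlist, Zksub_add. auto.
    + intros (x & H & <-). rewrite filter_In, in_boxlist in H. rewrite Zkadd_sub. tauto.
Qed.

(** * A summable weight on the frequency lattice *)

Lemma rsum_zrange_bound M : rsum (zrange M) (fun z => / (1 + IZR z ^ 2)) <= 12.
Proof.
  (* telescoping: the increments of 6z/(1+|z|) dominate 1/(1+z^2) *)
  set (g := fun z : Z => 6 * IZR z / (1 + Rabs (IZR z))).
  assert (Hd : forall x, 0 < 1 + Rabs x) by (intros x; assert (H := Rabs_pos x); lra).
  assert (Hg : forall z, -6 <= g z <= 6).
  { intros z. unfold g. assert (H := Hd (IZR z)). split.
    - apply Rle_div_r; auto. unfold Rabs; destruct Rcase_abs; lra.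
    - apply Rle_div_l; auto. unfold Rabs; destruct Rcase_abs; lra. }
  assert (Hi : forall z, / (1 + IZR z ^ 2) <= g (z + 1)%Z - g z).
  { intros z. unfold g. rewrite plus_IZR.
    (* For integers z < 0 also z + 1 <= 0, so both absolute values resolve with the same sign in
       each case. *)
    destruct (Z_lt_le_dec z 0) as [Hz|Hz].
    - assert (IZR z <= -1) by (apply IZR_le; lia). set (w := IZR z) in *.
      rewrite !Rabs_left1 by lra.
      replace (6 * (w+1) / (1 + - (w+1)) - 6 * w / (1 + -w)) with (6 / (w * (w-1)))
        by (field; repeat split; nra).
      apply Rle_div_r. nra. rewrite Rmult_comm. apply Rle_div_l; nra.
    - assert (0 <= IZR z) by (apply IZR_le; lia). set (w := IZR z) in *.
      rewrite !Rabs_right by lra.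
      replace (6 * (w+1) / (1 + (w+1)) - 6 * w / (1 + w)) with (6 / ((w+2) * (w+1)))
        by (field; repeat split; nra).
      apply Rle_div_r. nra. rewrite Rmult_comm. apply Rle_div_l; nra. }
  unfold zrange. rewrite rsum_map.
  assert (Hs : forall n, rsum (seq 0 n) (fun i => / (1 + IZR (Z.of_nat i - Z.of_nat M) ^ 2))
     <= g (Z.of_nat n - Z.of_nat M)%Z - g (- Z.of_nat M)%Z).
  { induction n as [|n IH].
    - cbn [rsum seq fold_right]. replace (Z.of_nat 0 - Z.of_nat M)%Z with (- Z.of_nat M)%Z by lia. lra.
    - rewrite seq_S, rsum_app. cbn [rsum fold_right]. fold (rsum (seq 0 n)).
      assert (H := Hi (Z.of_nat n - Z.of_nat M)%Z).
      replace (Z.of_nat (S n) - Z.of_nat M)%Z with (Z.of_nat n - Z.of_nat M + 1)%Z by lia.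
      change (0 + n)%nat with n. lra. }
  (* The telescoped sum is a difference of two values of [g], which lie in [-6, 6]; hence 12. *)
  eapply Rle_trans. apply Hs.
  assert (H1 := Hg (- Z.of_nat M)%Z).
  assert (H2 := Hg (Z.of_nat (2*M+1) - Z.of_nat M)%Z). lra.
Qed.

(** A product, so that its sum over a box factors into two one-dimensional sums; it dominates
    (1+|k|^2)^{-2} and, up to a factor 4, |k|^{-4} for nonzero k. *)
Definition kweight (k : Zk) : R := / (1 + IZR (fst k) ^ 2) * / (1 + IZR (snd k) ^ 2).

Lemma rsum_kweight M : rsum (boxlist M) kweight <= 144.
Proof.
  unfold boxlist, kweight.
  rewrite (rsum_prod _ _ (fun z => / (1 + IZR z ^ 2)) (fun z => / (1 + IZR z ^ 2))).
  assert (H := rsum_zrange_bound M).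
  assert (0 <= rsum (zrange M) (fun z => / (1 + IZR z ^ 2))).
  { apply rsum_nonneg. intros k _. left. apply Rinv_0_lt_compat. nra. }
  nra.
Qed.

(** * Integrals depending on parameters *)

(** Tube lemma, by compactness of [a, b]. The parameter lives in an arbitrary uniform space because
    it is used both with one real parameter and, for inner integrals, with a pair. *)
Lemma continuous_tube {U : UniformSpace} (f : U -> R -> R) (a b : R) (u0 : U) :
  (forall y, a <= y <= b -> continuous (fun p : U * R => f (fst p) (snd p)) (u0, y)) ->
  forall eps : posreal,
  locally u0 (fun u => forall y, a <= y <= b -> Rabs (f u y - f u0 y) < eps).
Proof.
  intros Hc eps.
  assert (Hd : forall y, exists d : posreal, a <= y <= b ->
    forall u z, ball u0 d u -> Rabs (z - y) < d -> Rabs (f u z - f u0 y) < eps / 2).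
  { intros y. destruct (classic (a <= y <= b)) as [Hy|Hy].
    - destruct (Hc y Hy (ball (f u0 y) (pos_div_2 eps))) as [d Hd].
      { exists (pos_div_2 eps). auto. }
      exists d. intros _ u z Hu Hz. apply (Hd (u, z)). split; auto.
    - exists (mkposreal 1 Rlt_0_1). tauto. }
  set (delta := fun y => proj1_sig (constructive_indefinite_description _ (Hd y))).
  assert (Hdelta : forall y, a <= y <= b -> forall u z, ball u0 (delta y) u ->
     Rabs (z - y) < delta y -> Rabs (f u z - f u0 y) < eps / 2).
  { intros y. unfold delta. destruct (constructive_indefinite_description _ (Hd y)). auto. }
  destruct (compactness_value_1d a b delta) as [d Hcov].
  exists d. intros u Hu z Hz. apply NNPP. intros Hn.
  apply (Hcov z Hz). intros (t & Ht & Hzt & Hdt). apply Hn.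
  assert (H1 := Hdelta t Ht u z (ball_le u0 _ _ Hdt u Hu) Hzt).
  assert (H2 := Hdelta t Ht u0 z (ball_center u0 _) Hzt).
  apply Rabs_def2 in H1. apply Rabs_def2 in H2. apply Rabs_def1; lra.
Qed.

Lemma continuous_slice {U : UniformSpace} (f : U -> R -> R) u y :
  continuous (fun p : U * R => f (fst p) (snd p)) (u, y) -> continuous (f u) y.
Proof.
  intros H. apply (continuous_comp_2 (fun _ : R => u) (fun z : R => z) f).
  apply continuous_const. apply continuous_id. exact H.
Qed.

Lemma ex_RInt_slice {U : UniformSpace} (f : U -> R -> R) a b u :
  (forall u y, continuous (fun p : U * R => f (fst p) (snd p)) (u, y)) -> ex_RInt (f u) a b.
Proof. intros H. apply (ex_RInt_continuous (V:=R_CompleteNormedModule)). intros. apply continuous_slice. auto. Qed.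

Lemma continuous_RInt_param {U : UniformSpace} (f : U -> R -> R) (a b : R) (u0 : U) :
  a <= b ->
  (forall u y, continuous (fun p : U * R => f (fst p) (snd p)) (u, y)) ->
  continuous (fun u => RInt (f u) a b) u0.
Proof.
  intros Hab Hc P [eps HP].
  (* The [+ 1] keeps the tolerance meaningful when a = b. *)
  assert (He : 0 < eps / (2 * (b - a + 1))).
  { apply Rdiv_lt_0_compat. apply cond_pos. lra. }
  destruct (continuous_tube f a b u0 (fun y _ => Hc u0 y) (mkposreal _ He)) as [d Hd].
  exists d. intros u Hu. apply HP. change (Rabs (RInt (f u) a b - RInt (f u0) a b) < eps).
  rewrite <- (RInt_minus (V:=R_CompleteNormedModule)); try (apply ex_RInt_slice; auto).
  eapply Rle_lt_trans.
  - apply abs_RInt_le_const; auto.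
    + apply (ex_RInt_minus (V:=R_NormedModule)); apply ex_RInt_slice; auto.
    + intros y Hy. left. apply (Hd u Hu y Hy).
  - simpl. assert (0 < eps) by apply cond_pos.
    replace ((b - a) * (eps / (2 * (b - a + 1)))) with (eps / 2 * ((b - a)/(b-a+1))) by (field; lra).
    assert ((b - a)/(b-a+1) <= 1) by (apply Rle_div_l; lra).
    assert (0 <= (b - a)/(b-a+1)) by (apply Rdiv_le_0_compat; lra). nra.
Qed.

Lemma is_derive_RInt_param_eq (f df : R -> R -> R) (a b u : R) :
  (forall u y, is_derive (fun v => f v y) u (df u y)) ->
  (forall u y, continuous (fun p : R * R => f (fst p) (snd p)) (u, y)) ->
  (forall u y, continuous (fun p : R * R => df (fst p) (snd p)) (u, y)) ->
  is_derive (fun v => RInt (f v) a b) u (RInt (df u) a b).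
Proof.
  intros Hd Hf Hdf.
  rewrite (RInt_ext (df u) (fun t => Derive (fun v => f v t) u)).
  2:{ intros y _. symmetry. apply is_derive_unique. auto. }
  apply (is_derive_RInt_param f).
  - apply filter_forall. intros v y _. exists (df v y). auto.
  - intros y _. apply (continuity_2d_pt_ext df).
    + intros. symmetry. apply is_derive_unique. auto.
    + apply continuity_2d_pt_filterlim. apply (Hdf u y).
  - apply filter_forall. intros v. apply ex_RInt_slice. auto.
Qed.

Definition cont2 (f : R -> R -> R) :=
  forall x y, continuous (fun p : R * R => f (fst p) (snd p)) (x, y).
Definition cont3 (f : fn3) :=
  forall t x y, continuous (fun p : R * R * R => f (fst (fst p)) (snd (fst p)) (snd p)) (t, x, y).

Lemma two_PI_ge0 : 0 <= 2 * PI.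
Proof. assert (H := PI_RGT_0). lra. Qed.

Lemma cont3_slice f t : cont3 f -> cont2 (f t).
Proof.
  intros H x y.
  apply (continuous_comp (fun p : R * R => (t, fst p, snd p))
    (fun p : R * R * R => f (fst (fst p)) (snd (fst p)) (snd p))).
  - apply (continuous_comp_2 (fun p : R * R => (t, fst p)) snd (fun a b => (a, b))).
    + apply (continuous_comp_2 (fun p : R * R => t) fst (fun a b => (a, b))).
      apply continuous_const. apply continuous_fst.
      apply continuous_ext with (fun p => p). intros []; auto. apply continuous_id.
    + apply continuous_snd.
    + apply continuous_ext with (fun p => p). intros []; auto. apply continuous_id.
  - apply H.
Qed.

Lemma cont2_const f : cont2 f -> cont3 (fun _ => f).
Proof.
  intros H t x y.
  apply (continuous_comp_2 (fun p : R * R * R => snd (fst p)) snd f).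
  - apply (continuous_comp fst snd). apply continuous_fst. apply continuous_snd.
  - apply continuous_snd.
  - apply H.
Qed.

Lemma cont2_plus f g : cont2 f -> cont2 g -> cont2 (fun x y => f x y + g x y).
Proof. intros Hf Hg x y. apply (continuous_plus (K:=R_AbsRing) (V:=R_NormedModule)); auto. Qed.
Lemma cont2_mult f g : cont2 f -> cont2 g -> cont2 (fun x y => f x y * g x y).
Proof. intros Hf Hg x y. apply (continuous_mult (K:=R_AbsRing)); auto. Qed.
Lemma cont2_cst c : cont2 (fun _ _ => c).
Proof. intros x y. apply continuous_const. Qed.
Lemma cont3_mult f g : cont3 f -> cont3 g -> cont3 (fun t x y => f t x y * g t x y).
Proof. intros Hf Hg t x y. apply (continuous_mult (K:=R_AbsRing)); auto. Qed.
Lemma cont3_abs f : cont3 f -> cont3 (fun t x y => Rabs (f t x y)).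
Proof.
  intros H t x y. apply (continuous_comp (fun p : R * R * R => f (fst (fst p)) (snd (fst p)) (snd p)) Rabs).
  apply H. apply continuous_Rabs.
Qed.

Lemma cont2_kdotx k : cont2 (kdotx k).
Proof.
  intros x y. unfold kdotx.
  apply (continuous_plus (K:=R_AbsRing) (V:=R_NormedModule));
    apply (continuous_mult (K:=R_AbsRing));
    try apply continuous_const; [apply continuous_fst|apply continuous_snd].
Qed.
Lemma cont2_cos k : cont2 (fun x y => cos (kdotx k x y)).
Proof.
  intros x y. apply (continuous_comp (fun p : R * R => kdotx k (fst p) (snd p)) cos).
  apply cont2_kdotx. apply continuous_cos.
Qed.
Lemma cont2_sin k : cont2 (fun x y => sin (kdotx k x y)).
Proof.
  intros x y. apply (continuous_comp (fun p : R * R => kdotx k (fst p) (snd p)) sin).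
  apply cont2_kdotx. apply continuous_sin.
Qed.

Lemma ex_RInt_inner f x : cont2 f -> ex_RInt (f x) 0 (2 * PI).
Proof. intros H. apply ex_RInt_slice. exact H. Qed.

Lemma ex_RInt_outer f : cont2 f -> ex_RInt (fun x => RInt (f x) 0 (2 * PI)) 0 (2 * PI).
Proof.
  intros H. apply (ex_RInt_continuous (V:=R_CompleteNormedModule)). intros x _.
  apply continuous_RInt_param. apply two_PI_ge0. exact H.
Qed.

Lemma int2R_ext f g : (forall x y, f x y = g x y) -> int2R f = int2R g.
Proof. intros H. apply RInt_ext. intros x _. apply RInt_ext. intros y _. apply H. Qed.

Lemma int2R_plus f g : cont2 f -> cont2 g ->
  int2R (fun x y => f x y + g x y) = int2R f + int2R g.
Proof.
  intros Hf Hg. unfold int2R.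
  rewrite <- (RInt_plus (V:=R_CompleteNormedModule)); try (apply (ex_RInt_outer f) || apply (ex_RInt_outer g)); auto.
  apply RInt_ext. intros x _.
  apply (RInt_plus (V:=R_CompleteNormedModule)); apply ex_RInt_inner; auto.
Qed.

Lemma int2R_scal c f : cont2 f -> int2R (fun x y => c * f x y) = c * int2R f.
Proof.
  intros Hf. unfold int2R.
  rewrite <- (RInt_scal (V:=R_CompleteNormedModule)); try apply (ex_RInt_outer f); auto.
  apply RInt_ext. intros x _.
  apply (RInt_scal (V:=R_CompleteNormedModule)); apply ex_RInt_inner; auto.
Qed.

Lemma int2R_le f g : cont2 f -> cont2 g -> (forall x y, f x y <= g x y) -> int2R f <= int2R g.
Proof.
  intros Hf Hg H. assert (P := two_PI_ge0).
  apply RInt_le; auto; try (apply (ex_RInt_outer f) || apply (ex_RInt_outer g)); auto.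
  intros x _. apply RInt_le; auto; apply ex_RInt_inner; auto.
Qed.

Lemma cont2_abs f : cont2 f -> cont2 (fun x y => Rabs (f x y)).
Proof.
  intros H x y. apply (continuous_comp (fun p : R * R => f (fst p) (snd p)) Rabs).
  apply H. apply continuous_Rabs.
Qed.

Lemma int2R_abs f : cont2 f -> Rabs (int2R f) <= int2R (fun x y => Rabs (f x y)).
Proof.
  intros H. assert (Ha := cont2_abs f H). apply Rabs_le. split.
  - replace (- int2R (fun x y => Rabs (f x y))) with (int2R (fun x y => (-1) * Rabs (f x y))).
    + apply int2R_le; auto. apply cont2_mult; auto. apply cont2_cst.
      intros. assert (P := Rle_abs (- f x y)). rewrite Rabs_Ropp in P. lra.
    + rewrite int2R_scal; auto. ring.
  - apply int2R_le; auto. intros. apply Rle_abs.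
Qed.

Lemma continuous_int2R f t : cont3 f -> continuous (fun s => int2R (f s)) t.
Proof.
  intros H. apply (continuous_RInt_param (fun s x => RInt (f s x) 0 (2*PI))).
  apply two_PI_ge0. intros s x.
  apply (continuous_RInt_param (fun (p : R * R) y => f (fst p) (snd p) y)).
  apply two_PI_ge0. intros [s' x'] y. apply H.
Qed.

Lemma cont3_RInt f : cont3 f -> forall s x, continuous (fun p : R * R => RInt (f (fst p) (snd p)) 0 (2*PI)) (s, x).
Proof.
  intros H s x. apply (continuous_RInt_param (fun (p : R * R) y => f (fst p) (snd p) y)).
  apply two_PI_ge0. intros [s' x'] y. apply H.
Qed.

Lemma cont3_slice_mid f x : cont3 f ->
  forall t y, continuous (fun p : R * R => f (fst p) x (snd p)) (t, y).
Proof.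
  intros H t y.
  apply (continuous_comp_2 (fun p : R * R => (fst p, x)) snd (fun (a : R * R) b => f (fst a) (snd a) b)).
  - apply (continuous_comp_2 fst (fun p : R * R => x) (fun a b => (a, b))).
    apply continuous_fst. apply continuous_const.
    apply continuous_ext with (fun p => p). intros []; auto. apply continuous_id.
  - apply continuous_snd.
  - apply H.
Qed.

Lemma is_derive_int2R f df t : cont3 f -> cont3 df ->
  (forall t x y, is_derive (fun s => f s x y) t (df t x y)) ->
  is_derive (fun s => int2R (f s)) t (int2R (df t)).
Proof.
  intros Hf Hdf Hd.
  apply (is_derive_RInt_param_eq (fun s x => RInt (f s x) 0 (2*PI)) (fun s x => RInt (df s x) 0 (2*PI))).
  - intros s x. apply (is_derive_RInt_param_eq (fun s y => f s x y) (fun s y => df s x y)).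
    + intros; apply Hd.
    + intros; apply cont3_slice_mid; auto.
    + intros; apply cont3_slice_mid; auto.
  - apply cont3_RInt; auto.
  - apply cont3_RInt; auto.
Qed.

(** The x-integral is the outer one, so the fundamental theorem is applied to the y-integral of f as
    a function of x, differentiated under the integral sign. For the y-derivative it applies
    directly inside. *)
Lemma int2R_dx_periodic f df : cont2 f -> cont2 df ->
  (forall x y, is_derive (fun s => f s y) x (df x y)) ->
  (forall y, f (2*PI) y = f 0 y) -> int2R df = 0.
Proof.
  intros Hf Hdf Hd Hp. unfold int2R. apply is_RInt_unique.
  replace 0 with (minus (RInt (f (2*PI)) 0 (2*PI)) (RInt (f 0) 0 (2*PI))) at 2.
  - apply (is_RInt_derive (fun x => RInt (f x) 0 (2*PI))).
    + intros x _. apply is_derive_RInt_param_eq; auto.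
    + intros x _. apply continuous_RInt_param; auto. apply two_PI_ge0.
  - rewrite (RInt_ext (f (2*PI)) (f 0)). unfold minus, plus, opp; simpl; ring.
    intros y _; auto.
Qed.

Lemma int2R_dy_periodic f df : cont2 df ->
  (forall x y, is_derive (fun s => f x s) y (df x y)) ->
  (forall x, f x (2*PI) = f x 0) -> int2R df = 0.
Proof.
  intros Hdf Hd Hp. unfold int2R.
  rewrite (RInt_ext _ (fun _ => 0)). rewrite RInt_const. unfold scal; simpl; unfold mult; simpl; ring.
  intros x _. apply is_RInt_unique.
  replace 0 with (minus (f x (2*PI)) (f x 0)) at 2.
  - apply (is_RInt_derive (f x)). intros; apply Hd.
    intros y _. apply continuous_slice. apply Hdf.
  - rewrite Hp. unfold minus, plus, opp; simpl; ring.
Qed.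

(** * Fourier coefficients of test functions *)

(** Sign + and no factor (2 pi)^{-2}: this is the pairing of f with one mode of u_N, so integrals of
    f against u_N become plain sums of products. Two real integrals keep real analysis
    applicable. *)
Definition hc (f : R -> R -> R) (k : Zk) : C :=
  (int2R (fun x y => f x y * cos (kdotx k x y)), int2R (fun x y => f x y * sin (kdotx k x y))).

Lemma cis_period_Z x z : cos (x + IZR z * (2 * PI)) = cos x /\ sin (x + IZR z * (2 * PI)) = sin x.
Proof.
  assert (H : forall n x, cos (x + INR n * (2 * PI)) = cos x /\ sin (x + INR n * (2 * PI)) = sin x).
  { intros n y. replace (y + INR n * (2 * PI)) with (y + 2 * INR n * PI) by ring.
    split. apply cos_period. apply sin_period. }
  destruct (Z_le_gt_dec 0 z) as [Hz|Hz].
  - replace (IZR z) with (INR (Z.to_nat z)). apply H. rewrite INR_IZR_INZ, Z2Nat.id; auto.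
  - destruct (H (Z.to_nat (-z)) (x + IZR z * (2 * PI))) as [H1 H2].
    rewrite INR_IZR_INZ, Z2Nat.id in H1, H2 by lia. rewrite opp_IZR in H1, H2.
    replace (x + IZR z * (2 * PI) + - IZR z * (2 * PI)) with x in H1, H2 by ring. auto.
Qed.

Lemma kdotx_period_1 k y :
  cos (kdotx k (2 * PI) y) = cos (kdotx k 0 y) /\ sin (kdotx k (2 * PI) y) = sin (kdotx k 0 y).
Proof.
  unfold kdotx.
  replace (IZR (fst k) * (2 * PI) + IZR (snd k) * y)
    with ((IZR (fst k) * 0 + IZR (snd k) * y) + IZR (fst k) * (2 * PI)) by ring.
  apply cis_period_Z.
Qed.
Lemma kdotx_period_2 k x :
  cos (kdotx k x (2 * PI)) = cos (kdotx k x 0) /\ sin (kdotx k x (2 * PI)) = sin (kdotx k x 0).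
Proof.
  unfold kdotx.
  replace (IZR (fst k) * x + IZR (snd k) * (2 * PI))
    with ((IZR (fst k) * x + IZR (snd k) * 0) + IZR (snd k) * (2 * PI)) by ring.
  apply cis_period_Z.
Qed.

Lemma cont2_mcos f k : cont2 f -> cont2 (fun x y => f x y * cos (kdotx k x y)).
Proof. intros H. apply cont2_mult; auto. apply cont2_cos. Qed.
Lemma cont2_msin f k : cont2 f -> cont2 (fun x y => f x y * sin (kdotx k x y)).
Proof. intros H. apply cont2_mult; auto. apply cont2_sin. Qed.

Lemma hc_ext f g k : (forall x y, f x y = g x y) -> hc f k = hc g k.
Proof. intros H. unfold hc. f_equal; apply int2R_ext; intros; rewrite H; auto. Qed.

Lemma hc_plus f g k : cont2 f -> cont2 g ->
  hc (fun x y => f x y + g x y) k = Cplus (hc f k) (hc g k).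
Proof.
  intros Hf Hg. unfold hc, Cplus; simpl.
  f_equal.
  - rewrite <- int2R_plus; [|apply cont2_mcos; auto|apply cont2_mcos; auto].
    apply int2R_ext; intros; ring.
  - rewrite <- int2R_plus; [|apply cont2_msin; auto|apply cont2_msin; auto].
    apply int2R_ext; intros; ring.
Qed.

Lemma int2R_lin f g c : cont2 f -> cont2 g ->
  int2R (fun x y => f x y + c * g x y) = int2R f + c * int2R g.
Proof.
  intros Hf Hg. rewrite (int2R_plus f (fun x y => c * g x y)); auto.
  rewrite int2R_scal; auto. apply cont2_mult; auto. apply cont2_cst.
Qed.

Lemma cont2_lin f g c : cont2 f -> cont2 g -> cont2 (fun x y => f x y + c * g x y).
Proof. intros. apply cont2_plus; auto. apply cont2_mult; auto. apply cont2_cst. Qed.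

(** Integration by parts: the x-derivatives of f cos(k.x) and f sin(k.x) integrate to zero, which
    gives the real and imaginary parts of the multiplication by -i k_1. *)
Lemma hc_dx f df k : cont2 f -> cont2 df ->
  (forall x y, is_derive (fun s => f s y) x (df x y)) ->
  (forall y, f (2*PI) y = f 0 y) ->
  hc df k = Cmult (Cmult (Copp Ci) (RtoC (IZR (fst k)))) (hc f k).
Proof.
  intros Hf Hdf Hd Hp.
  assert (H1 : int2R (fun x y => df x y * cos (kdotx k x y) + (- IZR (fst k)) * (f x y * sin (kdotx k x y))) = 0).
  { apply (int2R_dx_periodic (fun x y => f x y * cos (kdotx k x y))).
    - apply cont2_mcos; auto.
    - apply cont2_lin; [apply cont2_mcos|apply cont2_msin]; auto.
    - intros x y.
      evar_last.
      + apply (is_derive_mult (K:=R_AbsRing) (fun s => f s y) (fun s => cos (kdotx k s y)));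
        [apply Hd|unfold kdotx; auto_derive; auto; reflexivity|apply Rmult_comm].
      + unfold kdotx, plus, mult; simpl. ring.
    - intros y. rewrite Hp. f_equal. apply kdotx_period_1. }
  assert (H2 : int2R (fun x y => df x y * sin (kdotx k x y) + (IZR (fst k)) * (f x y * cos (kdotx k x y))) = 0).
  { apply (int2R_dx_periodic (fun x y => f x y * sin (kdotx k x y))).
    - apply cont2_msin; auto.
    - apply cont2_lin; [apply cont2_msin|apply cont2_mcos]; auto.
    - intros x y.
      evar_last.
      + apply (is_derive_mult (K:=R_AbsRing) (fun s => f s y) (fun s => sin (kdotx k s y)));
        [apply Hd|unfold kdotx; auto_derive; auto; reflexivity|apply Rmult_comm].
      + unfold kdotx, plus, mult; simpl. ring.
    - intros y. rewrite Hp. f_equal. apply kdotx_period_1. }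
  rewrite int2R_lin in H1; [|apply cont2_mcos; auto|apply cont2_msin; auto].
  rewrite int2R_lin in H2; [|apply cont2_msin; auto|apply cont2_mcos; auto].
  unfold hc, Cmult, Copp, Ci, RtoC; simpl. f_equal; lra.
Qed.

Lemma hc_dy f df k : cont2 f -> cont2 df ->
  (forall x y, is_derive (fun s => f x s) y (df x y)) ->
  (forall x, f x (2*PI) = f x 0) ->
  hc df k = Cmult (Cmult (Copp Ci) (RtoC (IZR (snd k)))) (hc f k).
Proof.
  intros Hf Hdf Hd Hp.
  assert (H1 : int2R (fun x y => df x y * cos (kdotx k x y) + (- IZR (snd k)) * (f x y * sin (kdotx k x y))) = 0).
  { apply (int2R_dy_periodic (fun x y => f x y * cos (kdotx k x y))).
    - apply cont2_lin; [apply cont2_mcos|apply cont2_msin]; auto.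
    - intros x y.
      evar_last.
      + apply (is_derive_mult (K:=R_AbsRing) (fun s => f x s) (fun s => cos (kdotx k x s)));
        [apply Hd|unfold kdotx; auto_derive; auto; reflexivity|apply Rmult_comm].
      + unfold kdotx, plus, mult; simpl. ring.
    - intros x. rewrite Hp. f_equal. apply kdotx_period_2. }
  assert (H2 : int2R (fun x y => df x y * sin (kdotx k x y) + (IZR (snd k)) * (f x y * cos (kdotx k x y))) = 0).
  { apply (int2R_dy_periodic (fun x y => f x y * sin (kdotx k x y))).
    - apply cont2_lin; [apply cont2_msin|apply cont2_mcos]; auto.
    - intros x y.
      evar_last.
      + apply (is_derive_mult (K:=R_AbsRing) (fun s => f x s) (fun s => sin (kdotx k x s)));
        [apply Hd|unfold kdotx; auto_derive; auto; reflexivity|apply Rmult_comm].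
      + unfold kdotx, plus, mult; simpl. ring.
    - intros x. rewrite Hp. f_equal. apply kdotx_period_2. }
  rewrite int2R_lin in H1; [|apply cont2_mcos; auto|apply cont2_msin; auto].
  rewrite int2R_lin in H2; [|apply cont2_msin; auto|apply cont2_mcos; auto].
  unfold hc, Cmult, Copp, Ci, RtoC; simpl. f_equal; lra.
Qed.

Lemma Cmod_le_abs (z : C) : Cmod z <= Rabs (fst z) + Rabs (snd z).
Proof.
  unfold Cmod. assert (H1 := Rabs_pos (fst z)). assert (H2 := Rabs_pos (snd z)).
  rewrite <- (sqrt_Rsqr (Rabs (fst z) + Rabs (snd z))) by lra.
  apply sqrt_le_1_alt. unfold Rsqr. rewrite <- (pow2_abs (fst z)), <- (pow2_abs (snd z)). nra.
Qed.

(** The factor 2 pays for bounding the modulus by |Re| + |Im|. *)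
Lemma hc_bound f k : cont2 f -> Cmod (hc f k) <= 2 * int2R (fun x y => Rabs (f x y)).
Proof.
  intros Hf.
  assert (H : forall g, cont2 g -> (forall x y, Rabs (g x y) <= 1) ->
    Rabs (int2R (fun x y => f x y * g x y)) <= int2R (fun x y => Rabs (f x y))).
  { intros g Hg H1. eapply Rle_trans. apply int2R_abs. apply cont2_mult; auto.
    apply int2R_le. apply (cont2_abs (fun x y => f x y * g x y)). apply cont2_mult; auto. apply cont2_abs; auto.
    intros x y. rewrite Rabs_mult. specialize (H1 x y). assert (P := Rabs_pos (f x y)). nra. }
  eapply Rle_trans. apply Cmod_le_abs. unfold hc. cbn [fst snd].
  assert (Hc := H _ (cont2_cos k) (fun x y => Rabs_le _ _ (COS_bound (kdotx k x y)))).
  assert (Hs := H _ (cont2_sin k) (fun x y => Rabs_le _ _ (SIN_bound (kdotx k x y)))). lra.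
Qed.

Lemma cont3_mcos f k : cont3 f -> cont3 (fun t x y => f t x y * cos (kdotx k x y)).
Proof. intros H. apply (cont3_mult f (fun _ x y => cos (kdotx k x y))); auto. apply (cont2_const (fun x y => cos (kdotx k x y))). apply cont2_cos. Qed.
Lemma cont3_msin f k : cont3 f -> cont3 (fun t x y => f t x y * sin (kdotx k x y)).
Proof. intros H. apply (cont3_mult f (fun _ x y => sin (kdotx k x y))); auto. apply (cont2_const (fun x y => sin (kdotx k x y))). apply cont2_sin. Qed.

(** * Smooth periodic test functions *)

Definition smoothper (f : fn3) := smooth3 f /\ periodic_x f.

Lemma smooth3_cont f : smooth3 f -> cont3 f.
Proof. intros H t x y. apply (proj1 (H nil)). Qed.
Lemma smooth3_pd f i : smooth3 f -> smooth3 (pd i f).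
Proof.
  intros H ds. specialize (H (ds ++ i :: nil)%list). unfold iter_pd in *.
  rewrite fold_right_app in H. exact H.
Qed.
Lemma smooth3_ex f i t x y : smooth3 f -> ex_pd i f t x y.
Proof. intros H. apply (proj2 (H nil)). Qed.

Lemma Derive_shift (f : R -> R) a x : Derive f (x + a) = Derive (fun s => f (s + a)) x.
Proof.
  unfold Derive. f_equal. apply Lim_ext. intros h.
  replace (x + a + h) with (x + h + a) by ring. auto.
Qed.

Lemma periodic_pd f i : periodic_x f -> periodic_x (pd i f).
Proof.
  intros H t x y. destruct i as [|[|i]]; simpl; split; rewrite ?Derive_shift;
  apply Derive_ext; intros s; apply H.
Qed.

Lemma smoothper_pd f i : smoothper f -> smoothper (pd i f).
Proof. intros []. split. apply smooth3_pd; auto. apply periodic_pd; auto. Qed.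

Lemma smoothper_cont2 f t : smoothper f -> cont2 (f t).
Proof. intros []. apply cont3_slice, smooth3_cont; auto. Qed.

Lemma hc_pd1 f t k : smoothper f ->
  hc (pd 1 f t) k = Cmult (Cmult (Copp Ci) (RtoC (IZR (fst k)))) (hc (f t) k).
Proof.
  intros H. apply hc_dx.
  - apply smoothper_cont2; auto.
  - apply smoothper_cont2, smoothper_pd; auto.
  - intros x y. apply Derive_correct. apply (smooth3_ex f 1 t x y). apply H.
  - intros y. destruct H as [_ H]. rewrite <- (proj1 (H t 0 y)). f_equal. ring.
Qed.

Lemma hc_pd2 f t k : smoothper f ->
  hc (pd 2 f t) k = Cmult (Cmult (Copp Ci) (RtoC (IZR (snd k)))) (hc (f t) k).
Proof.
  intros H. apply hc_dy.
  - apply smoothper_cont2; auto.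
  - apply smoothper_cont2, smoothper_pd; auto.
  - intros x y. apply Derive_correct. apply (smooth3_ex f 2 t x y). apply H.
  - intros x. destruct H as [_ H]. rewrite <- (proj2 (H t x 0)). f_equal. ring.
Qed.

Lemma hc_pd0 f t k : smoothper f ->
  is_derive (fun s => fst (hc (f s) k)) t (fst (hc (pd 0 f t) k)) /\
  is_derive (fun s => snd (hc (f s) k)) t (snd (hc (pd 0 f t) k)).
Proof.
  intros H. assert (Hc := smooth3_cont _ (proj1 H)).
  assert (Hc' := smooth3_cont _ (proj1 (smoothper_pd f 0 H))).
  split; unfold hc; cbn [fst snd].
  - apply (is_derive_int2R (fun t x y => f t x y * cos (kdotx k x y))
      (fun t x y => pd 0 f t x y * cos (kdotx k x y))); try apply cont3_mcos; auto.
    intros s x y. evar_last.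
    + apply (is_derive_mult (K:=R_AbsRing) (fun s => f s x y) (fun s => cos (kdotx k x y)));
      [apply Derive_correct, (smooth3_ex f 0); apply H | apply is_derive_const | apply Rmult_comm].
    + unfold plus, mult, zero; simpl. ring.
  - apply (is_derive_int2R (fun t x y => f t x y * sin (kdotx k x y))
      (fun t x y => pd 0 f t x y * sin (kdotx k x y))); try apply cont3_msin; auto.
    intros s x y. evar_last.
    + apply (is_derive_mult (K:=R_AbsRing) (fun s => f s x y) (fun s => sin (kdotx k x y)));
      [apply Derive_correct, (smooth3_ex f 0); apply H | apply is_derive_const | apply Rmult_comm].
    + unfold plus, mult, zero; simpl. ring.
Qed.

(** The L^1 norm of f(t,.) is continuous in t, so it attains a maximum on [a, b]; that maximum does
    not see k. *)
Lemma hc_uniform_bound f a b : a <= b -> smoothper f ->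
  exists B, forall t k, a <= t <= b -> Cmod (hc (f t) k) <= B.
Proof.
  intros Hab H. assert (Hc := smooth3_cont _ (proj1 H)).
  destruct (continuity_ab_maj (fun t => int2R (fun x y => Rabs (f t x y))) a b Hab) as (Mx & HM & _).
  { intros c _. apply continuity_pt_filterlim. apply (continuous_int2R (fun t x y => Rabs (f t x y))).
    apply cont3_abs; auto. }
  exists (2 * int2R (fun x y => Rabs (f Mx x y))). intros t k Ht.
  eapply Rle_trans. apply hc_bound. apply smoothper_cont2; auto.
  apply Rmult_le_compat_l. lra. apply HM; auto.
Qed.

Lemma Cmod_mulIk (z : C) (r : R) : Cmod (Cmult (Cmult (Copp Ci) (RtoC r)) z) = Rabs r * Cmod z.
Proof.
  rewrite !Cmod_mult, Cmod_opp, Cmod_R.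
  replace (Cmod Ci) with 1. ring.
  unfold Cmod, Ci; simpl. replace (0 * (0 * 1) + 1 * (1 * 1)) with 1 by ring.
  symmetry. apply sqrt_1.
Qed.

(** Each derivative in direction i is worth one factor [c k]. The direction and its symbol are
    parameters so that a single induction serves both coordinates. *)
Lemma hc_decay_dir (i : nat) (c : Zk -> R) f p a b :
  (forall g t k, smoothper g ->
     hc (pd i g t) k = Cmult (Cmult (Copp Ci) (RtoC (c k))) (hc (g t) k)) ->
  a <= b -> smoothper f ->
  exists B, forall t k, a <= t <= b -> Rabs (c k) ^ p * Cmod (hc (f t) k) <= B.
Proof.
  intros Hi Hab. revert f. induction p as [|p IH]; intros f Hf.
  - destruct (hc_uniform_bound f a b Hab Hf) as [B HB]. exists B. intros. simpl. rewrite Rmult_1_l. auto.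
  - destruct (IH (pd i f) (smoothper_pd f i Hf)) as [B HB]. exists B. intros t k Ht.
    specialize (HB t k Ht). rewrite Hi, Cmod_mulIk in HB by auto. simpl. lra.
Qed.

(** The sup norm as a real number: it matches the square truncation box and equals the modulus of
    one coordinate, so decay can be read off one direction. *)
Definition kn (k : Zk) : R := IZR (supnorm k).

Lemma kn_max k : kn k = Rmax (Rabs (IZR (fst k))) (Rabs (IZR (snd k))).
Proof.
  unfold kn, supnorm. rewrite <- !abs_IZR.
  destruct (Z.max_spec (Z.abs (fst k)) (Z.abs (snd k))) as [[H ->]|[H ->]].
  rewrite Rmax_right; auto. apply IZR_le; lia.
  rewrite Rmax_left; auto. apply IZR_le; lia.
Qed.

(** Whichever coordinate realizes the sup norm, the decay in that direction applies. *)
Lemma hc_decay f p a b : a <= b -> smoothper f ->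
  exists B, 0 <= B /\ forall t k, a <= t <= b -> kn k ^ p * Cmod (hc (f t) k) <= B.
Proof.
  intros Hab Hf.
  destruct (hc_decay_dir 1 (fun k => IZR (fst k)) f p a b) as [B1 H1]; auto. intros; apply hc_pd1; auto.
  destruct (hc_decay_dir 2 (fun k => IZR (snd k)) f p a b) as [B2 H2]; auto. intros; apply hc_pd2; auto.
  exists (Rmax 0 (Rmax B1 B2)). split. apply Rmax_l. intros t k Ht. specialize (H1 t k Ht). specialize (H2 t k Ht).
  simpl in H1, H2.
  eapply Rle_trans; [|apply Rmax_r].
  rewrite kn_max. unfold Rmax at 1. destruct Rle_dec.
  eapply Rle_trans; [apply H2|apply Rmax_r].
  eapply Rle_trans; [apply H1|apply Rmax_l].
Qed.

(** * Double integrals of complex functions *)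

Notation CRint := (RInt (V := C_R_CompleteNormedModule)).
Notation CR := C_R_CompleteNormedModule.

(** [RInt] is total, so an equation on [int2C] alone would not pass to sums; this predicate carries
    integrability along with the value. *)
Definition has_int2 (g : R -> R -> C) (v : C) : Prop :=
  (forall x, ex_RInt (V := CR) (g x) 0 (2 * PI)) /\
  is_RInt (V := CR) (fun x => CRint (g x) 0 (2 * PI)) 0 (2 * PI) v.

Lemma has_int2_unique g v : has_int2 g v -> int2C g = v.
Proof. intros [_ H]. unfold int2C. apply (is_RInt_unique (V:=CR)). exact H. Qed.

Lemma has_int2_ext g g' v : (forall x y, g x y = g' x y) -> has_int2 g v -> has_int2 g' v.
Proof.
  intros E [H1 H2]. split.
  - intros x. apply ex_RInt_ext with (g x); auto.
  - apply is_RInt_ext with (fun x => CRint (g x) 0 (2 * PI)); auto.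
    intros x _. apply (RInt_ext (V:=CR)). intros y _. apply E.
Qed.

Lemma is_RInt_pair (f : R -> C) a b (l : C) :
  is_RInt (fun t => fst (f t)) a b (fst l) -> is_RInt (fun t => snd (f t)) a b (snd l) ->
  is_RInt (V := CR) f a b l.
Proof.
  intros H1 H2. destruct l as [l1 l2].
  apply (is_RInt_fct_extend_pair (U:=R_NormedModule) (V:=R_NormedModule) f a b l1 l2); auto.
Qed.
Lemma is_RInt_fstC (f : R -> C) a b (l : C) : is_RInt (V := CR) f a b l ->
  is_RInt (fun t => fst (f t)) a b (fst l).
Proof. apply (is_RInt_fct_extend_fst (U:=R_NormedModule) (V:=R_NormedModule)). Qed.
Lemma is_RInt_sndC (f : R -> C) a b (l : C) : is_RInt (V := CR) f a b l ->
  is_RInt (fun t => snd (f t)) a b (snd l).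
Proof. apply (is_RInt_fct_extend_snd (U:=R_NormedModule) (V:=R_NormedModule)). Qed.

Lemma has_int2_real f g : cont2 f -> cont2 g ->
  has_int2 (fun x y => (f x y, g x y)) (int2R f, int2R g).
Proof.
  intros Hf Hg.
  assert (H : forall x, is_RInt (V := CR) (fun y => (f x y, g x y)) 0 (2*PI)
     (RInt (f x) 0 (2*PI), RInt (g x) 0 (2*PI))).
  { intros x. apply is_RInt_pair; simpl; apply (RInt_correct (V:=R_CompleteNormedModule)); [apply (ex_RInt_inner f)|apply (ex_RInt_inner g)]; auto. }
  split.
  - intros x. eexists. apply H.
  - apply is_RInt_ext with (fun x => (RInt (f x) 0 (2*PI), RInt (g x) 0 (2*PI))).
    + intros x _. symmetry. exact (is_RInt_unique (V:=CR) _ _ _ _ (H x)).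
    + apply is_RInt_pair; simpl; apply (RInt_correct (V:=R_CompleteNormedModule)); [apply (ex_RInt_outer f)|apply (ex_RInt_outer g)]; auto.
Qed.

Lemma has_int2_hc f k : cont2 f ->
  has_int2 (fun x y => Cmult (RtoC (f x y)) (cis (kdotx k x y))) (hc f k).
Proof.
  intros Hf. apply has_int2_ext with (fun x y => (f x y * cos (kdotx k x y), f x y * sin (kdotx k x y))).
  - intros. unfold Cmult, RtoC, cis; simpl. f_equal; ring.
  - apply has_int2_real. apply cont2_mcos; auto. apply cont2_msin; auto.
Qed.

Lemma has_int2_plus g h v w : has_int2 g v -> has_int2 h w ->
  has_int2 (fun x y => Cplus (g x y) (h x y)) (Cplus v w).
Proof.
  intros [G1 G2] [H1 H2]. split.
  - intros x. apply (ex_RInt_plus (V:=CR) (g x) (h x)); auto.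
  - apply is_RInt_ext with (fun x => plus (CRint (g x) 0 (2*PI)) (CRint (h x) 0 (2*PI))).
    + intros x _. symmetry. apply (RInt_plus (V:=CR)); auto.
    + apply (is_RInt_plus (V:=CR)); auto.
Qed.

Lemma is_RInt_Cscal (f : R -> C) a b c (l : C) : is_RInt (V := CR) f a b l ->
  is_RInt (V := CR) (fun t => Cmult c (f t)) a b (Cmult c l).
Proof.
  intros H. assert (H1 := is_RInt_fstC _ _ _ _ H). assert (H2 := is_RInt_sndC _ _ _ _ H).
  apply is_RInt_pair; simpl.
  - apply (is_RInt_minus (V:=R_NormedModule)); apply (is_RInt_scal (V:=R_NormedModule)); auto.
  - apply (is_RInt_plus (V:=R_NormedModule)); apply (is_RInt_scal (V:=R_NormedModule)); auto.
Qed.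

Lemma has_int2_scal g v c : has_int2 g v -> has_int2 (fun x y => Cmult c (g x y)) (Cmult c v).
Proof.
  intros [G1 G2]. split.
  - intros x. destruct (G1 x) as [l Hl]. eexists. apply is_RInt_Cscal, Hl.
  - apply is_RInt_ext with (fun x => Cmult c (CRint (g x) 0 (2*PI))).
    + intros x _. symmetry. apply (is_RInt_unique (V:=CR)), is_RInt_Cscal. apply (RInt_correct (V:=CR)); auto.
    + apply is_RInt_Cscal; auto.
Qed.

Lemma has_int2_zero : has_int2 (fun _ _ => RtoC 0) (RtoC 0).
Proof.
  assert (H : has_int2 (fun x y => (0, 0)) (int2R (fun _ _ => 0), int2R (fun _ _ => 0))).
  { apply has_int2_real; apply cont2_cst. }
  replace (int2R (fun _ _ => 0)) with 0 in H. exact H.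
  replace 0 with (0 * int2R (fun _ _ => 0)) at 1 by ring.
  rewrite <- int2R_scal by apply cont2_cst. apply int2R_ext. intros; ring.
Qed.

Lemma has_int2_csum {A} (l : list A) (g : A -> R -> R -> C) v :
  (forall k, In k l -> has_int2 (g k) (v k)) ->
  has_int2 (fun x y => csum l (fun k => g k x y)) (csum l v).
Proof.
  induction l as [|k l IH]; simpl; intros H. apply has_int2_zero.
  apply has_int2_plus; auto.
Qed.

(** Brings Parseval, obtained for complex integrals, back to the real integral inside [L2norm]. *)
Lemma has_int2_re f v : has_int2 (fun x y => RtoC (f x y)) v -> int2R f = fst v.
Proof.
  intros [H1 H2]. unfold int2R. apply is_RInt_unique. apply is_RInt_fstC in H2.
  eapply is_RInt_ext; [|apply H2]. intros x _. simpl.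
  symmetry. apply is_RInt_unique. destruct (H1 x) as [l Hl].
  assert (E : CRint (fun y => RtoC (f x y)) 0 (2*PI) = l) by exact (is_RInt_unique (V:=CR) _ _ _ _ Hl).
  apply is_RInt_fstC in Hl. change (is_RInt (f x) 0 (2*PI) (fst (CRint (fun y => RtoC (f x y)) 0 (2*PI)))).
  rewrite E. exact Hl.
Qed.

(** * Trigonometric sums *)

Definition trig (M : nat) (a : Zk -> C) (x y : R) : C :=
  csum (boxlist M) (fun k => Cmult (a k) (cis (kdotx k x y))).

Lemma cis_plus a b : Cmult (cis a) (cis b) = cis (a + b).
Proof. unfold cis, Cmult; simpl. rewrite cos_plus, sin_plus. f_equal; ring. Qed.
Lemma cis_conj a : Cconj (cis a) = cis (- a).
Proof. unfold cis, Cconj; simpl. rewrite cos_neg, sin_neg. auto. Qed.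

Lemma has_int2_trig M f a : cont2 f ->
  has_int2 (fun x y => Cmult (RtoC (f x y)) (trig M a x y))
    (csum (boxlist M) (fun k => Cmult (hc f k) (a k))).
Proof.
  intros Hf.
  apply has_int2_ext with (fun x y => csum (boxlist M)
    (fun k => Cmult (a k) (Cmult (RtoC (f x y)) (cis (kdotx k x y))))).
  - intros x y. unfold trig. rewrite <- csum_scal. apply csum_ext. intros; ring.
  - apply has_int2_csum. intros k _. rewrite Cmult_comm. apply has_int2_scal, has_int2_hc; auto.
Qed.

(** The product carries no conjugation, as in u tensor u, so the modes m and l meet at the sum
    frequency. *)
Lemma has_int2_trig2 M f a b : cont2 f ->
  has_int2 (fun x y => Cmult (RtoC (f x y)) (Cmult (trig M a x y) (trig M b x y)))
    (csum (boxlist M) (fun m => csum (boxlist M) (fun l =>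
        Cmult (hc f (Zkadd m l)) (Cmult (a m) (b l))))).
Proof.
  intros Hf.
  apply has_int2_ext with (fun x y => csum (boxlist M) (fun m => csum (boxlist M)
    (fun l => Cmult (Cmult (a m) (b l)) (Cmult (RtoC (f x y)) (cis (kdotx (Zkadd m l) x y)))))).
  - intros x y. unfold trig.
    rewrite (Cmult_comm (csum _ _) (csum _ _)), Cmult_assoc, <- csum_scal.
    apply csum_ext. intros m _.
    rewrite (Cmult_comm _ (Cmult (a m) _)), Cmult_assoc, <- csum_scal.
    apply csum_ext. intros l _.
    replace (kdotx (Zkadd m l) x y) with (kdotx m x y + kdotx l x y).
    rewrite <- cis_plus. ring.
    unfold kdotx, Zkadd; simpl. rewrite !plus_IZR. ring.
  - apply has_int2_csum. intros m _. apply has_int2_csum. intros l _.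
    rewrite (Cmult_comm (hc _ _)). apply has_int2_scal, has_int2_hc; auto.
Qed.

Lemma hc_zero k : hc (fun _ _ => 0) k = RtoC 0.
Proof.
  unfold hc.
  rewrite (int2R_ext _ (fun _ _ => 0 * 1)), (int2R_ext (fun x y => 0 * sin _) (fun _ _ => 0 * 1)) by (intros; ring).
  rewrite int2R_scal by apply cont2_cst. rewrite Rmult_0_l. auto.
Qed.

(** Orthogonality without explicit primitives: the derivative of 1 is 0, so integration by parts
    annihilates the coefficient as soon as some component of k is nonzero. *)
Lemma hc_one k : hc (fun _ _ => 1) k = if Z.eqb (supnorm k) 0 then RtoC (4 * PI ^ 2) else RtoC 0.
Proof.
  assert (Hz : forall z : C, forall r, r <> 0 -> Cmult (Cmult (Copp Ci) (RtoC r)) z = RtoC 0 -> z = RtoC 0).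
  { intros z r Hr H. apply Cmod_eq_0. assert (E := Cmod_mulIk z r). rewrite H, Cmod_0 in E.
    assert (Rabs r <> 0) by (apply Rabs_no_R0; auto). nra. }
  destruct k as [k1 k2]. destruct (Z.eqb_spec (supnorm (k1,k2)) 0) as [E|E].
  - assert (k1 = 0%Z) by (unfold supnorm in E; simpl in E; lia).
    assert (k2 = 0%Z) by (unfold supnorm in E; simpl in E; lia). subst.
    unfold hc, RtoC. f_equal.
    + rewrite (int2R_ext _ (fun _ _ => 1)).
      * unfold int2R. rewrite RInt_const, RInt_const. unfold scal; simpl; unfold mult; simpl; ring.
      * intros. unfold kdotx; simpl. replace (0 * x + 0 * y) with 0 by ring. rewrite cos_0; ring.
    + rewrite (int2R_ext _ (fun _ _ => 0)).
      * unfold int2R. rewrite RInt_const, RInt_const. unfold scal; simpl; unfold mult; simpl; ring.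
      * intros. unfold kdotx; simpl. replace (0 * x + 0 * y) with 0 by ring. rewrite sin_0; ring.
  - destruct (Z.eq_dec k1 0) as [E1|E1].
    + assert (k2 <> 0%Z) by (unfold supnorm in E; simpl in E; lia).
      apply Hz with (IZR k2). apply not_0_IZR; auto.
      rewrite <- (hc_zero (k1,k2)). symmetry.
      apply (hc_dy (fun _ _ => 1) (fun _ _ => 0) (k1,k2)); auto; try apply cont2_cst.
      intros; apply (is_derive_const (K:=R_AbsRing) (V:=R_NormedModule) 1).
    + apply Hz with (IZR k1). apply not_0_IZR; auto.
      rewrite <- (hc_zero (k1,k2)). symmetry.
      apply (hc_dx (fun _ _ => 1) (fun _ _ => 0) (k1,k2)); auto; try apply cont2_cst.
      intros; apply (is_derive_const (K:=R_AbsRing) (V:=R_NormedModule) 1).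
Qed.

(** The conjugate of a trigonometric sum is the sum with reflected, conjugated coefficients; in the
    product integrated against 1 only the diagonal survives. *)
Lemma has_int2_parseval M a :
  has_int2 (fun x y => RtoC (Cmod (trig M a x y) ^ 2))
    (RtoC (4 * PI ^ 2 * rsum (boxlist M) (fun k => Cmod (a k) ^ 2))).
Proof.
  apply has_int2_ext with (fun x y => Cmult (RtoC 1)
     (Cmult (trig M a x y) (trig M (fun k => Cconj (a (Zkneg k))) x y))).
  - intros x y. rewrite Cmod2_conj, Cmult_1_l. f_equal.
    unfold trig. rewrite csum_conj, csum_box_neg. apply csum_ext. intros k _.
    rewrite Zkneg_neg, Cmult_conj, cis_conj. repeat f_equal.
    unfold kdotx, Zkneg; simpl. rewrite !opp_IZR. ring.
  - assert (H := has_int2_trig2 M (fun _ _ => 1) a (fun k => Cconj (a (Zkneg k))) (cont2_cst 1)).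
    replace (RtoC (4 * PI ^ 2 * rsum (boxlist M) (fun k => Cmod (a k) ^ 2))) with
     (csum (boxlist M) (fun m => csum (boxlist M) (fun l => Cmult (hc (fun _ _ => 1) (Zkadd m l))
        (Cmult (a m) (Cconj (a (Zkneg l))))))). exact H.
    rewrite RtoC_mult, RtoC_rsum, <- csum_scal. apply csum_ext. intros m Hm.
    rewrite csum_box_neg.
    rewrite (csum_ext _ _ (fun l => if Z.eqb (supnorm (Zksub m l)) 0 then
       Cmult (RtoC (4 * PI^2)) (Cmult (a m) (Cconj (a l))) else RtoC 0)).
    + rewrite (csum_delta _ _ m); auto.
      * rewrite Cmod2_conj. auto.
      * apply NoDup_boxlist.
      * intros [y1 y2]. destruct m as [m1 m2]. rewrite Z.eqb_eq. unfold supnorm, Zksub; simpl. split.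
        intros. f_equal; lia. intros E. injection E. lia.
    + intros l _. rewrite hc_one, Zkneg_neg.
      replace (Zkadd m (Zkneg l)) with (Zksub m l).
      destruct Z.eqb; auto. ring.
      unfold Zksub, Zkadd, Zkneg; simpl. f_equal; lia.
Qed.

(** * The Fourier-side quadratic form *)

Definition dotv (a b : vecC) : C := Cplus (Cmult (fst a) (fst b)) (Cmult (snd a) (snd b)).
(** The l^1 norm allows componentwise estimates free of square roots; [vn_sq] and [vnorm2_vn]
    compare it with the Euclidean one. *)
Definition vn (v : vecC) : R := Cmod (fst v) + Cmod (snd v).

Lemma vn_ge0 v : 0 <= vn v.
Proof. unfold vn. assert (H1 := Cmod_ge_0 (fst v)). assert (H2 := Cmod_ge_0 (snd v)). lra. Qed.
Lemma vnorm2_ge0 v : 0 <= vnorm2 v.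
Proof. unfold vnorm2. assert (H1 := pow2_ge_0 (Cmod (fst v))). assert (H2 := pow2_ge_0 (Cmod (snd v))). lra. Qed.
Lemma vn_sq v : vn v ^ 2 <= 2 * vnorm2 v.
Proof. unfold vn, vnorm2. assert (H := pow2_ge_0 (Cmod (fst v) - Cmod (snd v))). nra. Qed.
Lemma vnorm2_vn v : vnorm2 v <= vn v ^ 2.
Proof. unfold vn, vnorm2. assert (H1 := Cmod_ge_0 (fst v)). assert (H2 := Cmod_ge_0 (snd v)). nra. Qed.
Lemma vn_vadd a b : vn (vadd a b) <= vn a + vn b.
Proof.
  unfold vn, vadd; simpl. assert (H1 := Cmod_triangle (fst a) (fst b)).
  assert (H2 := Cmod_triangle (snd a) (snd b)). lra.
Qed.
Lemma vn_vscal c a : vn (vscal c a) = Cmod c * vn a.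
Proof. unfold vn, vscal; simpl. rewrite !Cmod_mult. ring. Qed.
Lemma vn_vzero : vn vzero = 0.
Proof. unfold vn, vzero; simpl. rewrite Cmod_0. ring. Qed.
Lemma vsub_vadd a b : vsub a b = vadd a (vscal (RtoC (-1)) b).
Proof. unfold vsub, vadd, vscal; simpl.
  replace (RtoC (-1)) with (Copp (RtoC 1)) by (rewrite <- RtoC_opp; reflexivity).
  f_equal; ring.
Qed.
Lemma vn_vsub a b : vn (vsub a b) <= vn a + vn b.
Proof.
  rewrite vsub_vadd. eapply Rle_trans. apply vn_vadd. rewrite vn_vscal.
  rewrite Cmod_R, (Rabs_left (-1)) by lra. lra.
Qed.
Lemma vn_dotv a b : Cmod (dotv a b) <= vn a * vn b.
Proof.
  unfold dotv, vn. eapply Rle_trans. apply Cmod_triangle. rewrite !Cmod_mult.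
  assert (H1 := Cmod_ge_0 (fst a)). assert (H2 := Cmod_ge_0 (snd a)).
  assert (H3 := Cmod_ge_0 (fst b)). assert (H4 := Cmod_ge_0 (snd b)). nra.
Qed.

Lemma kn_abs k : Rabs (IZR (fst k)) <= kn k /\ Rabs (IZR (snd k)) <= kn k.
Proof. rewrite kn_max. split. apply Rmax_l. apply Rmax_r. Qed.
Lemma kn_ge0 k : 0 <= kn k.
Proof. destruct (kn_abs k) as [H _]. assert (P := Rabs_pos (IZR (fst k))). lra. Qed.

Lemma kdotv_bound k v : Cmod (kdotv k v) <= kn k * vn v.
Proof.
  unfold kdotv, vn. eapply Rle_trans. apply Cmod_triangle. rewrite !Cmod_mult, !Cmod_R.
  destruct (kn_abs k) as [H1 H2].
  assert (H3 := Cmod_ge_0 (fst v)). assert (H4 := Cmod_ge_0 (snd v)). nra.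
Qed.

Lemma vn_kvec k : vn (kvec k) <= 2 * kn k.
Proof. unfold vn, kvec; simpl. rewrite !Cmod_R. destruct (kn_abs k). lra. Qed.

Lemma knorm2_kn k : kn k ^ 2 <= knorm2 k <= 2 * kn k ^ 2.
Proof.
  unfold knorm2. rewrite plus_IZR, !mult_IZR.
  destruct (kn_abs k) as [H1 H2]. assert (H3 := kn_max k).
  assert (P1 := Rabs_pos (IZR (fst k))). assert (P2 := Rabs_pos (IZR (snd k))).
  assert (E1 := pow2_abs (IZR (fst k))). assert (E2 := pow2_abs (IZR (snd k))).
  split; [|nra].
  unfold Rmax in H3; destruct Rle_dec in H3; rewrite H3; nra.
Qed.

Lemma inbox0_spec N k : inbox0 N k = true <-> inbox N k = true /\ k <> (0%Z, 0%Z).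
Proof.
  unfold inbox0. rewrite Bool.andb_true_iff, Bool.negb_true_iff, Z.eqb_neq.
  split; intros [H1 H2]; split; auto; contradict H2.
  - subst; reflexivity.
  - destruct k as [k1 k2]; unfold supnorm in H2; simpl in H2. f_equal; lia.
Qed.

Lemma kn_ge1 k : k <> (0%Z, 0%Z) -> 1 <= kn k.
Proof.
  intros H. unfold kn. apply IZR_le. destruct k as [k1 k2]; unfold supnorm; simpl.
  destruct (Z.eq_dec k1 0); destruct (Z.eq_dec k2 0); subst; try lia. tauto.
Qed.

Lemma kn_inbox N k : inbox N k = true <-> kn k <= INR N.
Proof.
  unfold inbox, kn. rewrite Z.leb_le, INR_IZR_INZ. split. apply IZR_le. apply le_IZR.
Qed.

(** The constant is 1 + 2: the removed component is at most kn * vn v * (2 kn) / |k|^2, and kn^2 <=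
    |k|^2. *)
Lemma vn_leray k v : k <> (0%Z, 0%Z) -> vn (leray k v) <= 3 * vn v.
Proof.
  intros Hk. unfold leray. eapply Rle_trans. apply vn_vsub. rewrite vn_vscal.
  assert (H1 := kn_ge1 k Hk). destruct (knorm2_kn k) as [H2 H3].
  assert (Hp : 0 < knorm2 k) by nra.
  rewrite Cmod_div by (intros E; apply (f_equal fst) in E; simpl in E; lra).
  rewrite Cmod_R, (Rabs_right (knorm2 k)) by lra.
  assert (H4 := kdotv_bound k v). assert (H5 := vn_kvec k). assert (H6 := vn_ge0 v).
  assert (H7 := vn_ge0 (kvec k)).
  assert (Cmod (kdotv k v) / knorm2 k * vn (kvec k) <= 2 * vn v); [|lra].
  apply Rle_trans with (Cmod (kdotv k v) / knorm2 k * (2 * kn k)).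
  - apply Rmult_le_compat_l; auto. apply Rdiv_le_0_compat; auto. apply Cmod_ge_0.
  - replace (Cmod (kdotv k v) / knorm2 k * (2 * kn k)) with (2 * (kn k * Cmod (kdotv k v)) / knorm2 k) by (field; lra).
    apply Rle_div_l; auto.
    assert (kn k * Cmod (kdotv k v) <= kn k * (kn k * vn v)) by (apply Rmult_le_compat_l; lra).
    assert (kn k ^ 2 * vn v <= knorm2 k * vn v) by (apply Rmult_le_compat_r; lra). nra.
Qed.

Lemma boxsumV_fst M f : fst (boxsumV M f) = csum (boxlist M) (fun k => fst (f k)).
Proof. unfold boxsumV. induction (boxlist M) as [|x l IH]; simpl; auto. rewrite IH; auto. Qed.
Lemma boxsumV_snd M f : snd (boxsumV M f) = csum (boxlist M) (fun k => snd (f k)).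
Proof. unfold boxsumV. induction (boxlist M) as [|x l IH]; simpl; auto. rewrite IH; auto. Qed.
Lemma boxsumV_csum M f : boxsumV M f =
  (csum (boxlist M) (fun k => fst (f k)), csum (boxlist M) (fun k => snd (f k))).
Proof. rewrite (surjective_pairing (boxsumV M f)), boxsumV_fst, boxsumV_snd. auto. Qed.
Lemma boxsumV_ext M f g : (forall k, In k (boxlist M) -> f k = g k) -> boxsumV M f = boxsumV M g.
Proof. intros H. rewrite !boxsumV_csum. f_equal; apply csum_ext; intros; rewrite H; auto. Qed.

Lemma vn_boxsumV M f : vn (boxsumV M f) <= rsum (boxlist M) (fun k => vn (f k)).
Proof.
  unfold vn at 1. rewrite boxsumV_fst, boxsumV_snd. unfold vn. rewrite rsum_plus.
  apply Rplus_le_compat; apply Cmod_csum.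
Qed.

Lemma dotv_boxsumV M a f : dotv a (boxsumV M f) = csum (boxlist M) (fun k => dotv a (f k)).
Proof.
  unfold dotv. rewrite boxsumV_fst, boxsumV_snd, csum_plus, !csum_scal. auto.
Qed.
Lemma dotv_vscal a c b : dotv a (vscal c b) = Cmult c (dotv a b).
Proof. unfold dotv, vscal; simpl. ring. Qed.
Lemma dotv_vadd a b c : dotv a (vadd b c) = Cplus (dotv a b) (dotv a c).
Proof. unfold dotv, vadd; simpl. ring. Qed.
Lemma dotv_vsub a b c : dotv a (vsub b c) = Cminus (dotv a b) (dotv a c).
Proof. unfold dotv, vsub; simpl. ring. Qed.
Lemma dotv_comm a b : dotv a b = dotv b a.
Proof. unfold dotv; ring. Qed.
Lemma dotv_kvec a k : dotv a (kvec k) = kdotv k a.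
Proof. unfold dotv, kdotv, kvec; simpl; ring. Qed.
Lemma dotv_leray k a v : kdotv k a = RtoC 0 -> dotv a (leray k v) = dotv a v.
Proof. intros H. unfold leray. rewrite dotv_vsub, dotv_vscal, dotv_kvec, H. ring. Qed.

Lemma kdotv_sub k l v : kdotv (Zksub k l) v = Cminus (kdotv k v) (kdotv l v).
Proof. unfold kdotv, Zksub; simpl. rewrite !minus_IZR, !RtoC_minus. ring. Qed.
Lemma kdotv_neg k v : kdotv (Zkneg k) v = Copp (kdotv k v).
Proof. unfold kdotv, Zkneg; simpl. rewrite !opp_IZR, !RtoC_opp. ring. Qed.
Lemma kdotv_zero k : kdotv k vzero = RtoC 0.
Proof. unfold kdotv, vzero; simpl. ring. Qed.
Lemma kdotv_vsub k a b : kdotv k (vsub a b) = Cminus (kdotv k a) (kdotv k b).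
Proof. unfold kdotv, vsub; simpl. ring. Qed.

Definition supported (N : nat) (V : Zk -> vecC) := forall k, inbox N k = false -> V k = vzero.
Definition divfree (V : Zk -> vecC) := forall k, kdotv k (V k) = RtoC 0.

(** [nonlin] without the test on k - l: for supported V the coefficient there is zero anyway, and
    sums run over whole boxes. *)
Definition Bil (N : nat) (V W : Zk -> vecC) (k : Zk) : vecC :=
  boxsumV N (fun l => vscal (Cmult Ci (kdotv l (V (Zksub k l)))) (W l)).

Lemma vscal_0 v : vscal (RtoC 0) v = vzero.
Proof. unfold vscal, vzero. f_equal; ring. Qed.

Lemma coefN_supported N c : supported N (coefN N c).
Proof. intros k H. unfold coefN, inbox0. rewrite H. auto. Qed.

Lemma nonlin_Bil N c k : nonlin N c k = Bil N (coefN N c) (coefN N c) k.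
Proof.
  unfold nonlin, Bil. apply boxsumV_ext. intros l _.
  destruct (inbox N (Zksub k l)) eqn:E; auto.
  rewrite coefN_supported by auto. rewrite kdotv_zero.
  rewrite <- (vscal_0 (coefN N c l)). f_equal. ring.
Qed.

(** The exchange (k,l) -> (-l,-k) preserves k - l and the product V_{-k}.V_l, so the two copies of a
    term add up to -i (k-l).V_{k-l} times that product, which is zero. *)
Lemma Bil_energy N V : divfree V ->
  csum (boxlist N) (fun k => dotv (V (Zkneg k)) (Bil N V V k)) = RtoC 0.
Proof.
  intros Hd. set (G := fun k l => Cmult (Cmult Ci (kdotv l (V (Zksub k l)))) (dotv (V (Zkneg k)) (V l))).
  assert (E1 : csum (boxlist N) (fun k => dotv (V (Zkneg k)) (Bil N V V k))
    = csum (boxlist N) (fun k => csum (boxlist N) (fun l => G k l))).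
  { apply csum_ext. intros k _. unfold Bil. rewrite dotv_boxsumV. apply csum_ext.
    intros l _. apply dotv_vscal. }
  assert (E2 : csum (boxlist N) (fun k => csum (boxlist N) (fun l => G k l))
    = csum (boxlist N) (fun k => csum (boxlist N) (fun l => G (Zkneg l) (Zkneg k)))).
  { rewrite csum_swap, csum_box_neg. apply csum_ext. intros l _.
    rewrite csum_box_neg. auto. }
  assert (E3 : Cplus (csum (boxlist N) (fun k => csum (boxlist N) (fun l => G k l)))
     (csum (boxlist N) (fun k => csum (boxlist N) (fun l => G (Zkneg l) (Zkneg k)))) = RtoC 0).
  { rewrite <- csum_plus. apply csum_zero. intros k _. rewrite <- csum_plus.
    apply csum_zero. intros l _. unfold G.
    replace (Zksub (Zkneg l) (Zkneg k)) with (Zksub k l) by (unfold Zksub, Zkneg; simpl; f_equal; lia).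
    rewrite Zkneg_neg, kdotv_neg, (dotv_comm (V l)).
    assert (H := Hd (Zksub k l)). rewrite kdotv_sub in H.
    transitivity (Cmult (Copp (Cmult Ci (dotv (V (Zkneg k)) (V l))))
      (Cminus (kdotv k (V (Zksub k l))) (kdotv l (V (Zksub k l))))). ring.
    rewrite H. ring. }
  rewrite <- E2 in E3. rewrite E1. set (S := csum (boxlist N) (fun k => csum (boxlist N) (fun l => G k l))) in *.
  apply (f_equal (Cmult (RtoC (/2)))) in E3.
  replace (Cmult (RtoC (/2)) (Cplus S S)) with S in E3. rewrite E3. ring.
  transitivity (Cmult (RtoC (/2 + /2)) S). replace (/2 + /2) with 1 by field. ring.
  rewrite RtoC_plus. ring.
Qed.

(** With m = k - l, divergence freedom turns l.V_m into (m+l).V_m, so every Galerkin term is minus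
    the weak-form term of the pair (m,l). Pairs whose sum leaves the box have no partner. *)
Lemma Bil_weak N V (g : Zk -> vecC) : supported N V -> divfree V ->
  Cplus (csum (boxlist N) (fun m => csum (boxlist N) (fun l =>
     Cmult (Cmult (Copp Ci) (kdotv (Zkadd m l) (V m))) (dotv (g (Zkadd m l)) (V l)))))
    (csum (boxlist N) (fun k => dotv (g k) (Bil N V V k)))
  = csum (boxlist N) (fun l => csum (boxlist N) (fun m =>
      if inbox N (Zkadd m l) then RtoC 0 else
      Cmult (Cmult (Copp Ci) (kdotv (Zkadd m l) (V m))) (dotv (g (Zkadd m l)) (V l)))).
Proof.
  intros Hs Hd.
  set (T := fun m l => Cmult (Cmult (Copp Ci) (kdotv (Zkadd m l) (V m))) (dotv (g (Zkadd m l)) (V l))).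
  assert (E1 : csum (boxlist N) (fun k => dotv (g k) (Bil N V V k))
    = csum (boxlist N) (fun l => csum (boxlist N) (fun k => Copp (T (Zksub k l) l)))).
  { rewrite csum_swap. apply csum_ext. intros k _. unfold Bil. rewrite dotv_boxsumV.
    apply csum_ext. intros l _. rewrite dotv_vscal. unfold T. rewrite !Zkadd_sub.
    assert (H := Hd (Zksub k l)). rewrite kdotv_sub in H.
    replace (kdotv l (V (Zksub k l))) with (kdotv k (V (Zksub k l))). ring.
    rewrite <- (Cplus_0_r (kdotv l _)), <- H. ring. }
  rewrite E1, csum_swap, <- csum_plus. apply csum_ext. intros l _.
  assert (E2 : csum (boxlist N) (fun k => Copp (T (Zksub k l) l)) =
    csum (boxlist N) (fun m => if inbox N (Zkadd m l) then Copp (T m l) else RtoC 0)).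
  { rewrite (csum_box_shift N l (fun m => Copp (T m l))). apply csum_ext. intros k _.
    destruct (inbox N (Zksub k l)) eqn:E; auto. unfold T. rewrite Hs, kdotv_zero by auto. ring. }
  rewrite E2, <- csum_plus. apply csum_ext. intros m _. fold (T m l).
  destruct inbox; ring.
Qed.

(** The map l -> k - l is injective and f vanishes off the box, so shifting can only lose terms. *)
Lemma rsum_box_conv_le N (f : Zk -> R) k : (forall l, 0 <= f l) -> (forall l, inbox N l = false -> f l = 0) ->
  rsum (boxlist N) (fun l => f (Zksub k l)) <= rsum (boxlist N) f.
Proof.
  intros H0 Hs. rewrite <- (rsum_map _ (Zksub k) f).
  assert (E : forall l, rsum l f = rsum (filter (inbox N) l) f).
  { induction l as [|x l IH]; simpl; auto. destruct (inbox N x) eqn:E; simpl; rewrite IH; auto.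
    rewrite Hs; auto. ring. }
  rewrite E. apply rsum_incl; auto.
  - apply NoDup_filter, FinFun.Injective_map_NoDup. 2: apply NoDup_boxlist.
    intros [x1 x2] [y1 y2]. destruct k. unfold Zksub; simpl. intros H; injection H; intros; f_equal; lia.
  - intros x Hx. apply filter_In in Hx. apply in_boxlist. tauto.
Qed.

(** Replacing l by k in the derivative gives the factor [kn k] in place of N. The product of two
    moduli is then bounded by the sum of their squares, each of which sums to the energy. *)
Lemma Bil_bound N V k : supported N V -> divfree V ->
  vn (Bil N V V k) <= kn k * (2 * rsum (boxlist N) (fun l => vnorm2 (V l))).
Proof.
  intros Hs Hd. unfold Bil. eapply Rle_trans. apply vn_boxsumV.
  apply Rle_trans with (rsum (boxlist N) (fun l => kn k * (vnorm2 (V (Zksub k l)) + vnorm2 (V l)))).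
  - apply rsum_le. intros l _. rewrite vn_vscal, Cmod_mult.
    replace (kdotv l (V (Zksub k l))) with (kdotv k (V (Zksub k l))).
    2:{ assert (H := Hd (Zksub k l)). rewrite kdotv_sub in H.
        rewrite <- (Cplus_0_r (kdotv l _)), <- H. ring. }
    replace (Cmod Ci) with 1.
    2:{ unfold Cmod, Ci; simpl. replace (0 * (0 * 1) + 1 * (1 * 1)) with 1 by ring. symmetry. apply sqrt_1. }
    assert (H1 := kdotv_bound k (V (Zksub k l))). assert (H2 := kn_ge0 k).
    assert (H3 := vn_sq (V (Zksub k l))). assert (H4 := vn_sq (V l)).
    set (a := vn (V (Zksub k l))) in *. assert (H5 := vn_ge0 (V l)). set (b := vn (V l)) in *.
    assert (a * b <= vnorm2 (V (Zksub k l)) + vnorm2 (V l)).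
    { assert (H6 := pow2_ge_0 (a - b)). nra. }
    rewrite Rmult_1_l. apply Rle_trans with (kn k * a * b). apply Rmult_le_compat_r; auto.
    rewrite Rmult_assoc. apply Rmult_le_compat_l; auto.
  - rewrite rsum_scal, rsum_plus. apply Rmult_le_compat_l. apply kn_ge0.
    assert (H := rsum_box_conv_le N (fun l => vnorm2 (V l)) k). simpl in H.
    assert (rsum (boxlist N) (fun l => vnorm2 (V (Zksub k l))) <= rsum (boxlist N) (fun l => vnorm2 (V l))).
    { apply H. intros; apply vnorm2_ge0. intros l E. rewrite Hs by auto. unfold vnorm2, vzero; simpl. rewrite Cmod_0; ring. }
    lra.
Qed.

(** Used only for uniqueness at fixed N, so the derivative is bounded crudely by N. *)
Lemma Bil_lipschitz N V V' M k : supported N V -> supported N V' ->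
  (forall l, vn (V l) <= M) -> (forall l, vn (V' l) <= M) ->
  vn (vsub (Bil N V V k) (Bil N V' V' k)) <=
    INR N * (2 * M * rsum (boxlist N) (fun l => vn (vsub (V l) (V' l)))).
Proof.
  intros Hs Hs' HM HM'.
  (* B(V,V) - B(V',V') = B(V-V',V) + B(V',V-V'). *)
  replace (vsub (Bil N V V k) (Bil N V' V' k)) with (boxsumV N (fun l =>
    vadd (vscal (Cmult Ci (kdotv l (vsub (V (Zksub k l)) (V' (Zksub k l))))) (V l))
         (vscal (Cmult Ci (kdotv l (V' (Zksub k l)))) (vsub (V l) (V' l))))).
  2:{ unfold Bil. rewrite !boxsumV_csum. unfold vsub. cbn [fst snd].
      f_equal; rewrite <- csum_minus; apply csum_ext; intros l _;
        unfold vadd, vscal, kdotv; simpl; ring. }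
  assert (HM0 : 0 <= M) by (eapply Rle_trans; [apply vn_ge0|apply (HM (0%Z,0%Z))]).
  assert (Hi : Cmod Ci = 1).
  { unfold Cmod, Ci; simpl. replace (0 * (0 * 1) + 1 * (1 * 1)) with 1 by ring. apply sqrt_1. }
  eapply Rle_trans. apply vn_boxsumV.
  apply Rle_trans with (rsum (boxlist N) (fun l => INR N * M *
     (vn (vsub (V (Zksub k l)) (V' (Zksub k l))) + vn (vsub (V l) (V' l))))).
  - apply rsum_le. intros l Hl. apply in_boxlist, kn_inbox in Hl.
    eapply Rle_trans. apply vn_vadd. rewrite !vn_vscal, !Cmod_mult, Hi, !Rmult_1_l.
    assert (H1 := kdotv_bound l (vsub (V (Zksub k l)) (V' (Zksub k l)))).
    assert (H2 := kdotv_bound l (V' (Zksub k l))).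
    assert (H3 := HM l). assert (H4 := HM' (Zksub k l)).
    assert (H5 := kn_ge0 l). assert (P1 := vn_ge0 (V l)). assert (P2 := vn_ge0 (V' (Zksub k l))).
    assert (P3 := vn_ge0 (vsub (V (Zksub k l)) (V' (Zksub k l)))).
    assert (P4 := vn_ge0 (vsub (V l) (V' l))).
    rewrite Rmult_plus_distr_l. apply Rplus_le_compat.
    + apply Rle_trans with (kn l * vn (vsub (V (Zksub k l)) (V' (Zksub k l))) * vn (V l)).
      apply Rmult_le_compat_r; auto.
      replace (INR N * M * vn (vsub (V (Zksub k l)) (V' (Zksub k l)))) with (INR N * vn (vsub (V (Zksub k l)) (V' (Zksub k l))) * M) by ring.
      apply Rmult_le_compat; auto. apply Rmult_le_pos; auto. apply Rmult_le_compat_r; auto.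
    + apply Rmult_le_compat_r; auto. eapply Rle_trans. apply H2. apply Rmult_le_compat; auto.
  - rewrite rsum_scal, rsum_plus.
    assert (H := rsum_box_conv_le N (fun l => vn (vsub (V l) (V' l))) k). simpl in H.
    assert (H1 : rsum (boxlist N) (fun l => vn (vsub (V (Zksub k l)) (V' (Zksub k l)))) <= rsum (boxlist N) (fun l => vn (vsub (V l) (V' l)))).
    { apply H. intros; apply vn_ge0. intros l E. rewrite Hs, Hs' by auto.
      unfold vn, vsub, vzero; simpl. replace (Cminus (RtoC 0) (RtoC 0)) with (RtoC 0) by ring. rewrite Cmod_0; ring. }
    set (S := rsum _ (fun l => vn (vsub (V l) (V' l)))) in *.
    rewrite Rmult_assoc. apply Rmult_le_compat_l. apply pos_INR.
    replace (2 * M * S) with (M * (S + S)) by ring. apply Rmult_le_compat_l; auto. lra.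
Qed.

(** * Complex-valued functions of time *)

(** Componentwise, so that real calculus, in particular the mean value theorem, applies to each
    part. *)
Definition Cder (f : R -> C) (t : R) (d : C) : Prop :=
  is_derive (fun s => fst (f s)) t (fst d) /\ is_derive (fun s => snd (f s)) t (snd d).
Definition Ccont (f : R -> C) (t : R) : Prop :=
  continuous (fun s => fst (f s)) t /\ continuous (fun s => snd (f s)) t.

Lemma Cder_cont f t d : Cder f t d -> Ccont f t.
Proof.
  intros [H1 H2]. split; apply (ex_derive_continuous (K:=R_AbsRing) (V:=R_NormedModule)); eexists; eauto.
Qed.

Lemma Cder_const c t : Cder (fun _ => c) t (RtoC 0).
Proof. split; apply (is_derive_const (K:=R_AbsRing) (V:=R_NormedModule)). Qed.
Lemma Ccont_const c t : Ccont (fun _ => c) t.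
Proof. split; apply continuous_const. Qed.

Lemma Cder_plus f g t d e : Cder f t d -> Cder g t e -> Cder (fun s => Cplus (f s) (g s)) t (Cplus d e).
Proof. intros [F1 F2] [G1 G2]. split; simpl; apply (is_derive_plus (K:=R_AbsRing) (V:=R_NormedModule)); auto. Qed.
Lemma Ccont_plus f g t : Ccont f t -> Ccont g t -> Ccont (fun s => Cplus (f s) (g s)) t.
Proof. intros [F1 F2] [G1 G2]. split; simpl; apply (continuous_plus (K:=R_AbsRing) (V:=R_NormedModule)); auto. Qed.

Lemma is_derive_Rmult f g t d e : is_derive f t d -> is_derive g t e ->
  is_derive (fun s => f s * g s) t (d * g t + f t * e).
Proof. intros F G. apply (is_derive_mult (K:=R_AbsRing) f g); auto. apply Rmult_comm. Qed.

Lemma Cder_mult f g t d e : Cder f t d -> Cder g t e ->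
  Cder (fun s => Cmult (f s) (g s)) t (Cplus (Cmult d (g t)) (Cmult (f t) e)).
Proof.
  intros [F1 F2] [G1 G2]. split; simpl.
  - evar_last. apply (is_derive_minus (K:=R_AbsRing) (V:=R_NormedModule)); apply is_derive_Rmult; eauto.
    unfold minus, plus, opp; simpl; ring.
  - evar_last. apply (is_derive_plus (K:=R_AbsRing) (V:=R_NormedModule)); apply is_derive_Rmult; eauto.
    unfold plus; simpl; ring.
Qed.
Lemma Ccont_mult f g t : Ccont f t -> Ccont g t -> Ccont (fun s => Cmult (f s) (g s)) t.
Proof.
  intros [F1 F2] [G1 G2]. split; simpl.
  - apply (continuous_minus (K:=R_AbsRing) (V:=R_NormedModule)); apply (continuous_mult (K:=R_AbsRing)); auto.
  - apply (continuous_plus (K:=R_AbsRing) (V:=R_NormedModule)); apply (continuous_mult (K:=R_AbsRing)); auto.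
Qed.

Lemma Cder_conj f t d : Cder f t d -> Cder (fun s => Cconj (f s)) t (Cconj d).
Proof. intros [F1 F2]. split; simpl; auto. apply (is_derive_opp (K:=R_AbsRing) (V:=R_NormedModule)); auto. Qed.
Lemma Ccont_conj f t : Ccont f t -> Ccont (fun s => Cconj (f s)) t.
Proof. intros [F1 F2]. split; simpl; auto. apply (continuous_opp (K:=R_AbsRing) (V:=R_NormedModule)); auto. Qed.

Lemma Cder_csum {A} (l : list A) f t d : (forall k, In k l -> Cder (f k) t (d k)) ->
  Cder (fun s => csum l (fun k => f k s)) t (csum l d).
Proof.
  induction l as [|k l IH]; simpl; intros H. apply Cder_const. apply Cder_plus; auto.
Qed.
Lemma Ccont_csum {A} (l : list A) f t : (forall k, In k l -> Ccont (f k) t) ->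
  Ccont (fun s => csum l (fun k => f k s)) t.
Proof.
  induction l as [|k l IH]; simpl; intros H. apply Ccont_const. apply Ccont_plus; auto.
Qed.

Lemma Cder_eq f t d e : Cder f t d -> d = e -> Cder f t e.
Proof. intros H <-. exact H. Qed.

Definition vder (f : R -> vecC) t (d : vecC) :=
  Cder (fun s => fst (f s)) t (fst d) /\ Cder (fun s => snd (f s)) t (snd d).
Definition vcont (f : R -> vecC) t := Ccont (fun s => fst (f s)) t /\ Ccont (fun s => snd (f s)) t.

Lemma Cder_dotv f g t d e : vder f t d -> vder g t e ->
  Cder (fun s => dotv (f s) (g s)) t (Cplus (dotv d (g t)) (dotv (f t) e)).
Proof.
  intros [F1 F2] [G1 G2]. eapply Cder_eq.
  - unfold dotv. apply Cder_plus; apply Cder_mult; eauto.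
  - unfold dotv. ring.
Qed.
Lemma Ccont_dotv f g t : vcont f t -> vcont g t -> Ccont (fun s => dotv (f s) (g s)) t.
Proof. intros [F1 F2] [G1 G2]. unfold dotv. apply Ccont_plus; apply Ccont_mult; auto. Qed.
Lemma vder_conj f t d : vder f t d -> vder (fun s => vconj (f s)) t (vconj d).
Proof. intros [F1 F2]. split; simpl; apply Cder_conj; auto. Qed.
Lemma vcont_conj f t : vcont f t -> vcont (fun s => vconj (f s)) t.
Proof. intros [F1 F2]. split; simpl; apply Ccont_conj; auto. Qed.
Lemma vder_sub f g t d e : vder f t d -> vder g t e -> vder (fun s => vsub (f s) (g s)) t (vsub d e).
Proof.
  intros [[F1 F2] [F3 F4]] [[G1 G2] [G3 G4]].
  split; split; simpl; apply (is_derive_minus (K:=R_AbsRing) (V:=R_NormedModule)); auto.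
Qed.
Lemma vcont_sub f g t : vcont f t -> vcont g t -> vcont (fun s => vsub (f s) (g s)) t.
Proof.
  intros [[F1 F2] [F3 F4]] [[G1 G2] [G3 G4]].
  split; split; simpl; apply (continuous_minus (K:=R_AbsRing) (V:=R_NormedModule)); auto.
Qed.

(** * Mean value and Gronwall estimates *)

Lemma increment_le (f d : R -> R) a b K : a <= b -> (forall x, continuous f x) ->
  (forall x, a < x < b -> is_derive f x (d x) /\ d x <= K) -> f b - f a <= K * (b - a).
Proof.
  intros Hab Hc Hd.
  (* [MVT_gen] only locates c in the closed interval; the candidate derivative takes the harmless
     value K at the endpoints, where nothing is known. *)
  destruct (MVT_gen f a b (fun x => if Rlt_dec a x then if Rlt_dec x b then d x else K else K)) as (c & _ & E).
  - rewrite Rmin_left, Rmax_right by auto. intros x Hx.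
    destruct (Rlt_dec a x); [|lra]. destruct (Rlt_dec x b); [|lra]. apply Hd; auto.
  - intros x _. apply continuity_pt_filterlim. apply Hc.
  - rewrite E. apply Rmult_le_compat_r. lra.
    destruct (Rlt_dec a c); [|lra]. destruct (Rlt_dec c b); [|lra]. apply Hd; auto.
Qed.

Lemma increment_abs_le (f d : R -> R) a b K : a <= b -> (forall x, continuous f x) ->
  (forall x, a < x < b -> is_derive f x (d x) /\ Rabs (d x) <= K) -> Rabs (f b - f a) <= K * (b - a).
Proof.
  intros Hab Hc Hd. apply Rabs_le. split.
  - assert (H : - f b - - f a <= K * (b - a)).
    { apply (increment_le (fun x => - f x) (fun x => - d x)); auto.
      - intros. apply (continuous_opp (K:=R_AbsRing) (V:=R_NormedModule)); auto.
      - intros x Hx. destruct (Hd x Hx) as [H1 H2]. split.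
        apply (is_derive_opp (K:=R_AbsRing) (V:=R_NormedModule)); auto.
        rewrite <- Rabs_Ropp in H2. assert (H := Rle_abs (- d x)). lra. }
    lra.
  - apply (increment_le f d); auto. intros x Hx. destruct (Hd x Hx) as [H1 H2]. split; auto.
    assert (H := Rle_abs (d x)). lra.
Qed.

Lemma Rabs_fst_Cmod z : Rabs (fst z) <= Cmod z.
Proof. eapply Rle_trans. apply Rmax_l. apply Rmax_Cmod. Qed.
Lemma Rabs_snd_Cmod z : Rabs (snd z) <= Cmod z.
Proof. eapply Rle_trans. apply Rmax_r. apply Rmax_Cmod. Qed.

(** There is no mean value equality for complex values; treating the real and imaginary parts
    separately costs the factor 2. *)
Lemma Cincrement_le (f d : R -> C) a b K : a <= b -> (forall x, Ccont f x) ->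
  (forall x, a < x < b -> Cder f x (d x) /\ Cmod (d x) <= K) ->
  Cmod (Cminus (f b) (f a)) <= 2 * K * (b - a).
Proof.
  intros Hab Hc Hd. eapply Rle_trans. apply Cmod_le_abs. simpl.
  assert (H1 : Rabs (fst (f b) - fst (f a)) <= K * (b - a)).
  { apply (increment_abs_le (fun s => fst (f s)) (fun s => fst (d s))); auto.
    intros; apply Hc. intros x Hx. destruct (Hd x Hx) as [[H _] H']. split; auto.
    eapply Rle_trans. apply Rabs_fst_Cmod. auto. }
  assert (H2 : Rabs (snd (f b) - snd (f a)) <= K * (b - a)).
  { apply (increment_abs_le (fun s => snd (f s)) (fun s => snd (d s))); auto.
    intros; apply Hc. intros x Hx. destruct (Hd x Hx) as [[_ H] H']. split; auto.
    eapply Rle_trans. apply Rabs_snd_Cmod. auto. }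
  unfold Rminus in *. lra.
Qed.

(** f(t) exp(-K t) has nonpositive derivative, so it stays below its initial value 0. *)
Lemma gronwall_zero (f d : R -> R) T K : (forall x, continuous f x) ->
  (forall x, 0 < x < T -> is_derive f x (d x) /\ d x <= K * f x) ->
  (forall x, 0 <= f x) -> f 0 = 0 -> forall t, 0 <= t <= T -> f t = 0.
Proof.
  intros Hc Hd Hp H0 t Ht.
  assert (H : f t * exp (- K * t) - f 0 * exp (- K * 0) <= 0 * (t - 0)).
  { apply (increment_le (fun x => f x * exp (- K * x))
      (fun x => d x * exp (- K * x) + f x * (- K * exp (- K * x)))). lra.
    - intros x. apply (continuous_mult (K:=R_AbsRing)); auto.
      apply (ex_derive_continuous (K:=R_AbsRing) (V:=R_NormedModule)). auto_derive. auto.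
    - intros x Hx. destruct (Hd x) as [H1 H2]. lra. split.
      + apply (is_derive_Rmult f (fun x => exp (- K * x))); auto. auto_derive; auto. ring.
      + assert (P := exp_pos (- K * x)). nra. }
  rewrite H0 in H. assert (P := exp_pos (- K * t)). specialize (Hp t). nra.
Qed.

(** * The Galerkin flow *)

Definition svF (N : nat) (nu : Zk -> R) (V : Zk -> vecC) (k : Zk) : vecC :=
  vadd (vscal (RtoC (-1)) (leray k (Bil N V V k))) (vscal (RtoC (- nu k)) (V k)).

(** The interface on which all estimates rest: coefficients extended by zero off the box and
    continuous at every real time, the equation holding inside (0,T). [nu] is the whole damping
    symbol; reality is required at time 0 only and propagated by [flow_real]. *)
Record SVflow (T : R) (N : nat) (nu : Zk -> R) (V : R -> Zk -> vecC) : Prop := {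
  flow_supp : forall t k, inbox0 N k = false -> V t k = vzero;
  flow_div : forall t, divfree (V t);
  flow_cont : forall k t, vcont (fun s => V s k) t;
  flow_der : forall k t, 0 < t < T -> vder (fun s => V s k) t (coefN N (svF N nu (V t)) k);
  flow_real0 : forall k, V 0 (Zkneg k) = vconj (V 0 k);
  flow_nu_sym : forall k, nu (Zkneg k) = nu k;
  flow_nu_pos : forall k, 0 <= nu k }.

Lemma dotv_conj_self v : dotv (vconj v) v = RtoC (vnorm2 v).
Proof.
  unfold dotv, vconj, vnorm2; cbn [fst snd]. rewrite RtoC_plus, !Cmod2_conj. ring.
Qed.

Lemma vconj_conj v : vconj (vconj v) = v.
Proof. unfold vconj; simpl. rewrite !Cconj_conj. destruct v; auto. Qed.
Lemma vn_vconj v : vn (vconj v) = vn v.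
Proof. unfold vn, vconj; simpl. rewrite !Cmod_conj. auto. Qed.
Lemma vconj_vscal c v : vconj (vscal c v) = vscal (Cconj c) (vconj v).
Proof. unfold vconj, vscal; simpl. rewrite !Cmult_conj. auto. Qed.
Lemma vconj_vadd a b : vconj (vadd a b) = vadd (vconj a) (vconj b).
Proof. unfold vconj, vadd; simpl. rewrite !Cplus_conj. auto. Qed.
Lemma vconj_vsub a b : vconj (vsub a b) = vsub (vconj a) (vconj b).
Proof. unfold vconj, vsub; simpl. rewrite !Cminus_conj. auto. Qed.
Lemma Cconj_R r : Cconj (RtoC r) = RtoC r.
Proof. unfold Cconj, RtoC; simpl. f_equal; ring. Qed.
Lemma vconj_kvec k : vconj (kvec k) = kvec k.
Proof. unfold vconj, kvec; simpl. rewrite !Cconj_R. auto. Qed.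
Lemma Cconj_kdotv k v : Cconj (kdotv k v) = kdotv k (vconj v).
Proof. unfold kdotv, vconj; simpl. rewrite Cplus_conj, !Cmult_conj, !Cconj_R. auto. Qed.
Lemma vconj_vzero : vconj vzero = vzero.
Proof. unfold vconj, vzero; simpl. rewrite !Cconj_R. auto. Qed.

Lemma knorm2_neg k : knorm2 (Zkneg k) = knorm2 k.
Proof. unfold knorm2, Zkneg; simpl. f_equal. ring. Qed.

Lemma Cdiv_R_conj c r : Cconj (Cdiv c (RtoC r)) = Cdiv (Cconj c) (RtoC r).
Proof.
  unfold Cdiv. rewrite Cmult_conj. f_equal. unfold Cinv, Cconj, RtoC; simpl.
  f_equal; unfold Rdiv; ring.
Qed.

Lemma leray_conj_neg k v : vconj (leray (Zkneg k) v) = leray k (vconj v).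
Proof.
  unfold leray. rewrite vconj_vsub, vconj_vscal, vconj_kvec, Cdiv_R_conj, Cconj_kdotv.
  rewrite knorm2_neg, kdotv_neg. f_equal. unfold vscal, kvec, Zkneg; simpl.
  unfold Cdiv. rewrite !opp_IZR, !RtoC_opp. f_equal; ring.
Qed.

Definition Vrefl (V : Zk -> vecC) (k : Zk) : vecC := vconj (V (Zkneg k)).

(** Conjugation changes i into -i and reflection changes the sign of l in [kdotv]; the two signs
    cancel. *)
Lemma Bil_conj_neg N V k : vconj (Bil N V V (Zkneg k)) = Bil N (Vrefl V) (Vrefl V) k.
Proof.
  unfold Bil. rewrite !boxsumV_csum. unfold vconj at 1. cbn [fst snd].
  rewrite !csum_conj.
  assert (H : forall l, vconj (vscal (Cmult Ci (kdotv (Zkneg l) (V (Zksub (Zkneg k) (Zkneg l))))) (V (Zkneg l)))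
     = vscal (Cmult Ci (kdotv l (Vrefl V (Zksub k l)))) (Vrefl V l)).
  { intros l. rewrite vconj_vscal, Cmult_conj, Cconj_kdotv, kdotv_neg. unfold Vrefl at 2.
    replace (Zksub (Zkneg k) (Zkneg l)) with (Zkneg (Zksub k l)) by (unfold Zksub, Zkneg; simpl; f_equal; lia).
    fold (Vrefl V (Zksub k l)). f_equal.
    replace (Cconj Ci) with (Copp Ci). ring.
    unfold Ci, Cconj, Copp; simpl. f_equal; ring. }
  rewrite csum_box_neg, (csum_box_neg N (fun x => Cconj (snd _))).
  f_equal; apply csum_ext; intros l _; rewrite <- H; reflexivity.
Qed.

Lemma svF_conj_neg N nu V k : (forall k, nu (Zkneg k) = nu k) ->
  vconj (coefN N (svF N nu V) (Zkneg k)) = coefN N (svF N nu (Vrefl V)) k.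
Proof.
  intros Hnu. unfold coefN. rewrite inbox0_neg. destruct inbox0; [|apply vconj_vzero].
  unfold svF. rewrite vconj_vadd, !vconj_vscal, !Cconj_R, leray_conj_neg, Bil_conj_neg, Hnu.
  reflexivity.
Qed.

Lemma inbox0_false_of_inbox N k : inbox N k = false -> inbox0 N k = false.
Proof. intros H. unfold inbox0. rewrite H. auto. Qed.

Lemma flow_supported T N nu V t : SVflow T N nu V -> supported N (V t).
Proof. intros H k Hk. apply (flow_supp _ _ _ _ H). apply inbox0_false_of_inbox; auto. Qed.

Lemma continuous_vnorm2_sum N (W : R -> Zk -> vecC) t :
  (forall k t, vcont (fun s => W s k) t) ->
  continuous (fun s => rsum (boxlist N) (fun k => vnorm2 (W s k))) t.
Proof.
  intros H.
  apply continuous_ext with (fun s => fst (csum (boxlist N) (fun k => dotv (vconj (W s k)) (W s k)))).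
  - intros s. rewrite Re_csum. apply rsum_ext. intros k _. rewrite dotv_conj_self. reflexivity.
  - apply (Ccont_csum (boxlist N) (fun k s => dotv (vconj (W s k)) (W s k))).
    intros k _. apply Ccont_dotv; auto. apply vcont_conj; auto.
Qed.

Lemma vnorm2_sum_bounded N (W : R -> Zk -> vecC) T : 0 <= T ->
  (forall k t, vcont (fun s => W s k) t) ->
  exists P, forall t, 0 <= t <= T -> rsum (boxlist N) (fun k => vnorm2 (W t k)) <= P.
Proof.
  intros HT H.
  destruct (continuity_ab_maj (fun s => rsum (boxlist N) (fun k => vnorm2 (W s k))) 0 T HT) as (x & Hx & _).
  - intros c _. apply continuity_pt_filterlim. apply continuous_vnorm2_sum; auto.
  - exists (rsum (boxlist N) (fun k => vnorm2 (W x k))). auto.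
Qed.

Lemma coefN_vsub N F G k : vsub (coefN N F k) (coefN N G k) = coefN N (fun k => vsub (F k) (G k)) k.
Proof.
  unfold coefN. destruct inbox0; auto. unfold vsub, vzero; simpl. f_equal; ring.
Qed.

Lemma leray_vsub k a b : vsub (leray k a) (leray k b) = leray k (vsub a b).
Proof.
  unfold leray. rewrite kdotv_vsub. unfold Cdiv, vsub, vscal; simpl. f_equal; ring.
Qed.

Lemma svF_vsub N nu V V' k : vsub (svF N nu V k) (svF N nu V' k) =
  vadd (vscal (RtoC (-1)) (leray k (vsub (Bil N V V k) (Bil N V' V' k))))
       (vscal (RtoC (- nu k)) (vsub (V k) (V' k))).
Proof. rewrite <- leray_vsub. unfold svF, vsub, vadd, vscal; simpl. f_equal; ring. Qed.

(* V and its reflection k |-> conj (V (-k)) solve the same locally Lipschitz system with the same data. *)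
Lemma flow_real T N nu V : 0 <= T -> SVflow T N nu V ->
  forall t k, 0 <= t <= T -> V t (Zkneg k) = vconj (V t k).
Proof.
  intros HT HV.
  set (W := fun t k => vsub (V t k) (Vrefl (V t) k)).
  assert (HVc : forall k t, vcont (fun s => Vrefl (V s) k) t).
  { intros k t. apply vcont_conj. apply (flow_cont _ _ _ _ HV). }
  assert (HWc : forall k t, vcont (fun s => W s k) t).
  { intros k t. apply vcont_sub; auto. apply (flow_cont _ _ _ _ HV). }
  destruct (vnorm2_sum_bounded N V T HT (flow_cont _ _ _ _ HV)) as [P HP].
  (* From vn^2 <= 2 P, avoiding a square root. *)
  set (M := 1 + 2 * P).
  assert (HM : forall t k, 0 <= t <= T -> vn (V t k) <= M).
  { intros t k Ht. specialize (HP t Ht).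
    assert (HP0 : 0 <= rsum (boxlist N) (fun k => vnorm2 (V t k))) by (apply rsum_nonneg; intros; apply vnorm2_ge0).
    destruct (inbox N k) eqn:E.
    - assert (H1 : vnorm2 (V t k) <= rsum (boxlist N) (fun k => vnorm2 (V t k))).
      { apply (rsum_in_le (boxlist N) (fun k => vnorm2 (V t k))).
        intros; apply vnorm2_ge0. apply in_boxlist; auto. }
      assert (H2 := vn_sq (V t k)). assert (H3 := vn_ge0 (V t k)). unfold M. nra.
    - rewrite (flow_supported _ _ _ _ t HV) by auto. rewrite vn_vzero. unfold M. lra. }
  assert (HM' : forall t k, 0 <= t <= T -> vn (Vrefl (V t) k) <= M).
  { intros. unfold Vrefl. rewrite vn_vconj. auto. }
  assert (Hsupp : forall t, supported N (Vrefl (V t))).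
  { intros t k Hk. unfold Vrefl. rewrite (flow_supported _ _ _ _ t HV). apply vconj_vzero. rewrite inbox_neg; auto. }
  set (nub := rsum (boxlist N) nu). set (n := INR (length (boxlist N))).
  set (D := fun t => rsum (boxlist N) (fun k => vnorm2 (W t k))).
  set (W' := fun t k => vsub (coefN N (svF N nu (V t)) k) (coefN N (svF N nu (Vrefl (V t))) k)).
  set (d := fun t => rsum (boxlist N) (fun k => fst (Cplus (dotv (vconj (W' t k)) (W t k)) (dotv (vconj (W t k)) (W' t k))))).
  assert (HD : forall t, 0 <= t <= T -> D t = 0).
  (* The vector field has Lipschitz constant 6 N M + nub in the summed norm S, with 6 = 3 (Leray) *
     2 ([Bil_lipschitz]). The derivative of D is at most twice this times S^2, and S^2 <= n * (2 D)
     by Cauchy-Schwarz. *)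
  { apply (gronwall_zero D d T (2 * (6 * INR N * M + nub) * (2 * n))).
    - intros x. apply continuous_vnorm2_sum; auto.
    - intros x Hx. split.
      + apply (is_derive_ext (fun s => fst (csum (boxlist N) (fun k => dotv (vconj (W s k)) (W s k))))).
        { intros s. rewrite Re_csum. apply rsum_ext. intros k _. rewrite dotv_conj_self. reflexivity. }
        unfold d. rewrite <- Re_csum.
        apply (Cder_csum (boxlist N) (fun k s => dotv (vconj (W s k)) (W s k))).
        intros k _.
        assert (Hk : vder (fun s => W s k) x (W' x k)).
        { apply vder_sub. apply (flow_der _ _ _ _ HV); auto.
          rewrite <- svF_conj_neg by apply (flow_nu_sym _ _ _ _ HV).
          apply (vder_conj (fun s => V s (Zkneg k))). apply (flow_der _ _ _ _ HV); auto. }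
        apply Cder_dotv; auto. apply vder_conj; auto.
      + set (S := rsum (boxlist N) (fun k => vn (W x k))).
        assert (HS0 : 0 <= S) by (apply rsum_nonneg; intros; apply vn_ge0).
        assert (HM0 : 0 <= M) by (eapply Rle_trans; [apply vn_ge0|apply (HM x (0%Z,0%Z)); lra]).
        assert (HN0 := pos_INR N).
        assert (Hnub : 0 <= nub) by (apply rsum_nonneg; intros; apply (flow_nu_pos _ _ _ _ HV)).
        assert (HW' : forall k, In k (boxlist N) -> vn (W' x k) <= (6 * INR N * M + nub) * S).
        { intros k Hk. unfold W'. rewrite coefN_vsub. unfold coefN.
          destruct (inbox0 N k) eqn:E.
          - rewrite svF_vsub. eapply Rle_trans. apply vn_vadd. rewrite !vn_vscal, !Cmod_R.
            assert (Hnu : nu k <= nub) by (apply rsum_in_le; auto; intros; apply (flow_nu_pos _ _ _ _ HV)).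
            assert (Hnu0 := flow_nu_pos _ _ _ _ HV k).
            rewrite Rabs_Ropp, (Rabs_right (nu k)), (Rabs_left (-1)) by lra.
            apply inbox0_spec in E as [_ E].
            assert (H1 := vn_leray k (vsub (Bil N (V x) (V x) k) (Bil N (Vrefl (V x)) (Vrefl (V x)) k)) E).
            assert (H2 := Bil_lipschitz N (V x) (Vrefl (V x)) M k (flow_supported _ _ _ _ x HV) (Hsupp x)
               (fun l => HM x l ltac:(lra)) (fun l => HM' x l ltac:(lra))).
            change (rsum (boxlist N) (fun l => vn (vsub (V x l) (Vrefl (V x) l)))) with S in H2.
            assert (H3 : vn (vsub (V x k) (Vrefl (V x) k)) <= S).
            { apply (rsum_in_le (boxlist N) (fun k => vn (W x k))); auto. intros; apply vn_ge0. }
            assert (H4 := vn_ge0 (vsub (V x k) (Vrefl (V x) k))).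
            assert (nu k * vn (vsub (V x k) (Vrefl (V x) k)) <= nub * S) by (apply Rmult_le_compat; auto).
            nra.
          - rewrite vn_vzero. apply Rmult_le_pos; auto. nra. }
        unfold d. apply Rle_trans with (rsum (boxlist N) (fun k => 2 * ((6 * INR N * M + nub) * S) * vn (W x k))).
        * apply rsum_le. intros k Hk. specialize (HW' k Hk).
          eapply Rle_trans. apply Rle_abs. eapply Rle_trans. apply Rabs_fst_Cmod.
          eapply Rle_trans. apply Cmod_triangle.
          assert (H1 := vn_dotv (vconj (W' x k)) (W x k)). assert (H2 := vn_dotv (vconj (W x k)) (W' x k)).
          rewrite vn_vconj in H1, H2. assert (H3 := vn_ge0 (W x k)).
          assert (vn (W' x k) * vn (W x k) <= (6 * INR N * M + nub) * S * vn (W x k)) by (apply Rmult_le_compat_r; auto).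
          lra.
        * rewrite rsum_scal. fold S.
          assert (H1 : S ^ 2 <= n * rsum (boxlist N) (fun k => vn (W x k) ^ 2)) by apply rsum_CS.
          assert (H2 : rsum (boxlist N) (fun k => vn (W x k) ^ 2) <= 2 * D x).
          { unfold D. rewrite <- rsum_scal. apply rsum_le. intros. apply vn_sq. }
          assert (Hn : 0 <= n) by apply pos_INR.
          assert (H3 : S ^ 2 <= n * (2 * D x)).
          { eapply Rle_trans. apply H1. apply Rmult_le_compat_l; auto. }
          replace (2 * ((6 * INR N * M + nub) * S) * S) with (2 * (6 * INR N * M + nub) * S ^ 2) by ring.
          rewrite (Rmult_assoc _ (2 * n)).
          apply Rmult_le_compat_l. nra. nra.
    - intros x. apply rsum_nonneg. intros; apply vnorm2_ge0.
    - transitivity (rsum (boxlist N) (fun k => 0 * 0)); [|rewrite rsum_scal; ring].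
      apply rsum_ext. intros k _. unfold W, Vrefl. rewrite (flow_real0 _ _ _ _ HV), vconj_conj.
      unfold vnorm2, vsub; simpl. replace (Cminus (fst (V 0 k)) (fst (V 0 k))) with (RtoC 0) by ring.
      replace (Cminus (snd (V 0 k)) (snd (V 0 k))) with (RtoC 0) by ring. rewrite Cmod_0; ring. }
  assert (HW : forall t k, 0 <= t <= T -> V t k = Vrefl (V t) k).
  { intros t k Ht. destruct (inbox N k) eqn:E.
    - assert (H1 : vnorm2 (W t k) <= D t).
      { apply (rsum_in_le (boxlist N) (fun k => vnorm2 (W t k))). intros; apply vnorm2_ge0. apply in_boxlist; auto. }
      rewrite HD in H1 by auto. unfold vnorm2 in H1.
      assert (Z1 := Cmod_ge_0 (fst (W t k))). assert (Z2 := Cmod_ge_0 (snd (W t k))).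
      assert (Cmod (fst (W t k)) = 0) by nra. assert (Cmod (snd (W t k)) = 0) by nra.
      apply Cmod_eq_0 in H, H0. unfold W, vsub in H, H0. simpl in H, H0.
      apply injective_projections; apply Ceq_minus; auto.
    - rewrite (flow_supported _ _ _ _ t HV) by auto. symmetry. apply Hsupp; auto. }
  intros t k Ht. rewrite (HW t k Ht). unfold Vrefl. rewrite vconj_conj. auto.
Qed.

(** * Energy bound and regularity in time *)

Lemma flow_energy T N nu V : 0 <= T -> SVflow T N nu V ->
  forall t, 0 <= t <= T ->
  rsum (boxlist N) (fun k => vnorm2 (V t k)) <= rsum (boxlist N) (fun k => vnorm2 (V 0 k)).
Proof.
  intros HT HV t Ht.
  assert (Hr := flow_real T N nu V HT HV).
  (* Written with V_{-k} instead of conj V_k to match [Bil_energy]; on [0,T] reality identifies it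
     with the energy. *)
  set (E := fun s => rsum (boxlist N) (fun k => fst (dotv (V s (Zkneg k)) (V s k)))).
  assert (HE : forall s, 0 <= s <= T -> E s = rsum (boxlist N) (fun k => vnorm2 (V s k))).
  { intros s Hs. apply rsum_ext. intros k _. rewrite Hr, dotv_conj_self by auto. reflexivity. }
  rewrite <- !HE by lra.
  set (F := fun s k => coefN N (svF N nu (V s)) k).
  assert (H : E t - E 0 <= 0 * (t - 0)).
  { apply (increment_le E (fun s => rsum (boxlist N)
       (fun k => fst (Cplus (dotv (F s (Zkneg k)) (V s k)) (dotv (V s (Zkneg k)) (F s k)))))). lra.
    - intros s. apply continuous_ext with (fun s => fst (csum (boxlist N) (fun k => dotv (V s (Zkneg k)) (V s k)))).
      intros; apply Re_csum.
      apply (Ccont_csum (boxlist N) (fun k s => dotv (V s (Zkneg k)) (V s k))).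
      intros k _. apply Ccont_dotv; apply (flow_cont _ _ _ _ HV).
    - intros s Hs. split.
      + apply (is_derive_ext (fun s => fst (csum (boxlist N) (fun k => dotv (V s (Zkneg k)) (V s k))))).
        intros; apply Re_csum. rewrite <- Re_csum.
        apply (Cder_csum (boxlist N) (fun k s => dotv (V s (Zkneg k)) (V s k))).
        intros k _. apply Cder_dotv; apply (flow_der _ _ _ _ HV); lra.
      + rewrite <- Re_csum, csum_plus.
        assert (E1 : csum (boxlist N) (fun k => dotv (F s (Zkneg k)) (V s k)) =
                     csum (boxlist N) (fun k => dotv (V s (Zkneg k)) (F s k))).
        { rewrite csum_box_neg. apply csum_ext. intros k _. rewrite Zkneg_neg. apply dotv_comm. }
        rewrite E1.
        assert (E2 : csum (boxlist N) (fun k => dotv (V s (Zkneg k)) (F s k)) =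
           RtoC (- rsum (boxlist N) (fun k => nu k * vnorm2 (V s k)))).
        { transitivity (csum (boxlist N) (fun k => Cminus (Cmult (RtoC (-1)) (dotv (V s (Zkneg k)) (Bil N (V s) (V s) k)))
              (RtoC (nu k * vnorm2 (V s k))))).
          - apply csum_ext. intros k _. unfold F, coefN. destruct (inbox0 N k) eqn:Ek.
            + unfold svF. rewrite dotv_vadd, !dotv_vscal, dotv_leray.
              rewrite (Hr s k), dotv_conj_self, RtoC_opp, RtoC_mult by lra. ring.
              (* Side condition of [dotv_leray]: V_{-k} is orthogonal to -k, hence to k, so the
                 projection drops out. *)
              rewrite <- (Zkneg_neg k) at 1. rewrite kdotv_neg, (flow_div _ _ _ _ HV). ring.
            + assert (Z1 : V s k = vzero) by (apply (flow_supp _ _ _ _ HV); auto).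
              assert (Z2 : V s (Zkneg k) = vzero) by (apply (flow_supp _ _ _ _ HV); rewrite inbox0_neg; auto).
              rewrite Z1, Z2. unfold dotv, vnorm2, vzero; simpl. rewrite Cmod_0.
              replace (nu k * (0 * (0 * 1) + 0 * (0 * 1))) with 0 by ring. ring.
          - rewrite csum_minus, csum_scal, Bil_energy by apply (flow_div _ _ _ _ HV).
            rewrite RtoC_opp, RtoC_rsum. ring. }
        rewrite E2. simpl.
        assert (0 <= rsum (boxlist N) (fun k => nu k * vnorm2 (V s k))).
        { apply rsum_nonneg. intros. apply Rmult_le_pos. apply (flow_nu_pos _ _ _ _ HV). apply vnorm2_ge0. }
        lra. }
  lra.
Qed.

(** 6 B is 3 (Leray) times 2 B ([Bil_bound]), with kn <= kn^2 for nonzero k; the damping gives c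
    |k|^2 <= 2 c kn^2 times the bound 1 + B on a single coefficient. *)
Lemma svF_bound N nu V k B c : supported N V -> divfree V -> k <> (0%Z, 0%Z) ->
  rsum (boxlist N) (fun l => vnorm2 (V l)) <= B -> 0 <= nu k <= c * knorm2 k -> inbox N k = true ->
  vn (svF N nu V k) <= (6 * B + 2 * c * (1 + B)) * kn k ^ 2.
Proof.
  intros Hs Hd Hk HB Hnu Hin. unfold svF. eapply Rle_trans. apply vn_vadd.
  rewrite !vn_vscal, !Cmod_R, Rabs_Ropp, (Rabs_right (nu k)), (Rabs_left (-1)) by lra.
  assert (H1 := vn_leray k (Bil N V V k) Hk). assert (H2 := Bil_bound N V k Hs Hd).
  assert (H3 := kn_ge1 k Hk). destruct (knorm2_kn k) as [H4 H5].
  assert (Hp : 0 <= rsum (boxlist N) (fun l => vnorm2 (V l))) by (apply rsum_nonneg; intros; apply vnorm2_ge0).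
  set (S := rsum _ _) in *.
  assert (H6 : vn (V k) <= 1 + B).
  { assert (H7 : vnorm2 (V k) <= S).
    { apply (rsum_in_le (boxlist N) (fun l => vnorm2 (V l))). intros; apply vnorm2_ge0. apply in_boxlist; auto. }
    assert (H8 := vn_sq (V k)). assert (H9 := vn_ge0 (V k)).
    assert (0 <= (vn (V k) - 1)^2) by apply pow2_ge_0. nra. }
  assert (H7 : nu k * vn (V k) <= 2 * c * kn k ^ 2 * (1 + B)).
  { apply Rmult_le_compat; auto. lra. apply vn_ge0.
    assert (0 <= c). { apply Rmult_le_reg_r with (knorm2 k). nra. rewrite Rmult_0_l. lra. } nra. }
  assert (H8 : kn k * (2 * S) <= 2 * B * kn k ^ 2).
  { assert (HB0 : 0 <= B) by lra.
    apply Rle_trans with (kn k * (2 * B)). apply Rmult_le_compat_l; lra.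
    assert (0 <= B * (kn k * (kn k - 1))) by (apply Rmult_le_pos; auto; apply Rmult_le_pos; lra). lra. }
  lra.
Qed.

Lemma flow_lipschitz T N nu V B c : 0 <= T -> SVflow T N nu V ->
  rsum (boxlist N) (fun k => vnorm2 (V 0 k)) <= B -> (forall k, nu k <= c * knorm2 k) ->
  forall t1 t2 k, 0 < t1 < T -> 0 < t2 < T -> inbox0 N k = true ->
  vn (vsub (V t2 k) (V t1 k)) <= 4 * ((6 * B + 2 * c * (1 + B)) * kn k ^ 2) * Rabs (t2 - t1).
Proof.
  intros HT HV HB Hnu.
  assert (Hmain : forall t1 t2 k, 0 < t1 < T -> 0 < t2 < T -> t1 <= t2 -> inbox0 N k = true ->
    vn (vsub (V t2 k) (V t1 k)) <= 4 * ((6 * B + 2 * c * (1 + B)) * kn k ^ 2) * (t2 - t1)).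
  { intros t1 t2 k H1 H2 H12 Hk.
    set (K := (6 * B + 2 * c * (1 + B)) * kn k ^ 2).
    assert (Hd : forall s, t1 < s < t2 -> vder (fun s => V s k) s (svF N nu (V s) k) /\ vn (svF N nu (V s) k) <= K).
    { intros s Hs. split.
      - assert (H := flow_der _ _ _ _ HV k s ltac:(lra)). unfold coefN in H. rewrite Hk in H. exact H.
      - apply inbox0_spec in Hk as [Hk1 Hk2]. apply svF_bound; auto.
        + apply (flow_supported _ _ _ _ s HV).
        + apply (flow_div _ _ _ _ HV).
        + eapply Rle_trans; [|apply HB]. apply (flow_energy T N nu V); auto; lra.
        + split; auto. apply (flow_nu_pos _ _ _ _ HV). }
    (* Each of the two complex components contributes 2 K, hence the 4. *)
    assert (L1 : Cmod (Cminus (fst (V t2 k)) (fst (V t1 k))) <= 2 * K * (t2 - t1)).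
    { apply (Cincrement_le (fun s => fst (V s k)) (fun s => fst (svF N nu (V s) k))); auto.
      intros; apply (flow_cont _ _ _ _ HV). intros s Hs. destruct (Hd s Hs) as [[D1 D2] D3]. split; auto.
      unfold vn in D3. assert (P := Cmod_ge_0 (snd (svF N nu (V s) k))). lra. }
    assert (L2 : Cmod (Cminus (snd (V t2 k)) (snd (V t1 k))) <= 2 * K * (t2 - t1)).
    { apply (Cincrement_le (fun s => snd (V s k)) (fun s => snd (svF N nu (V s) k))); auto.
      intros; apply (flow_cont _ _ _ _ HV). intros s Hs. destruct (Hd s Hs) as [[D1 D2] D3]. split; auto.
      unfold vn in D3. assert (P := Cmod_ge_0 (fst (svF N nu (V s) k))). lra. }
    unfold vn, vsub; simpl. fold K. lra. }
  intros t1 t2 k H1 H2 Hk. destruct (Rle_dec t1 t2) as [H|H].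
  - rewrite Rabs_right by lra. auto.
  - rewrite Rabs_left by lra. replace (- (t2 - t1)) with (t1 - t2) by ring.
    replace (vn (vsub (V t2 k) (V t1 k))) with (vn (vsub (V t1 k) (V t2 k))).
    apply Hmain; auto; lra.
    unfold vn, vsub; simpl. f_equal; rewrite <- Cmod_opp; f_equal; ring.
Qed.

(** * The weak formulation *)

Definition vtrig (N : nat) (V : Zk -> vecC) (x y : R) : vecC :=
  (trig N (fun k => fst (V k)) x y, trig N (fun k => snd (V k)) x y).

Lemma uphys_vtrig N c x y : uphys N c x y = vtrig N (coefN N c) x y.
Proof.
  unfold uphys, vtrig, trig. rewrite boxsumV_csum.
  f_equal; apply csum_ext; intros k _; unfold coefN; destruct inbox0; simpl; ring.
Qed.

Definition hcv (f g : R -> R -> R) (k : Zk) : vecC := (hc f k, hc g k).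

Definition weak_integrand (Phi1 Phi2 : fn3) (u : R -> R -> R -> vecC) (t x1 x2 : R) : C :=
  let a := fst (u t x1 x2) in let b := snd (u t x1 x2) in
  Cplus (Cplus (Cmult (RtoC (pd 0 Phi1 t x1 x2)) a) (Cmult (RtoC (pd 0 Phi2 t x1 x2)) b))
   (Cplus (Cplus (Cmult (RtoC (pd 1 Phi1 t x1 x2)) (Cmult a a))
                 (Cmult (RtoC (pd 1 Phi2 t x1 x2)) (Cmult a b)))
          (Cplus (Cmult (RtoC (pd 2 Phi1 t x1 x2)) (Cmult b a))
                 (Cmult (RtoC (pd 2 Phi2 t x1 x2)) (Cmult b b)))).

(** The space integral of [weak_integrand] on the Fourier side, the gradient on Phi having become
    the factor -i(m+l). *)
Definition weakW (N : nat) (Phi1 Phi2 : fn3) (V : Zk -> vecC) (t : R) : C :=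
  Cplus (csum (boxlist N) (fun k => dotv (hcv (pd 0 Phi1 t) (pd 0 Phi2 t) k) (V k)))
    (csum (boxlist N) (fun m => csum (boxlist N) (fun l =>
       Cmult (Cmult (Copp Ci) (kdotv (Zkadd m l) (V m)))
             (dotv (hcv (Phi1 t) (Phi2 t) (Zkadd m l)) (V l))))).

Lemma weak_integrand_int N Phi1 Phi2 V t : smoothper Phi1 -> smoothper Phi2 ->
  has_int2 (weak_integrand Phi1 Phi2 (fun t => vtrig N (V t)) t) (weakW N Phi1 Phi2 (V t) t).
Proof.
  intros H1 H2.
  assert (C : forall i f, smoothper f -> cont2 (pd i f t)) by (intros; apply smoothper_cont2, smoothper_pd; auto).
  set (v1 := fun k => fst (V t k)). set (v2 := fun k => snd (V t k)).
  assert (H := has_int2_plus _ _ _ _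
    (has_int2_plus _ _ _ _ (has_int2_trig N (pd 0 Phi1 t) v1 (C 0%nat _ H1)) (has_int2_trig N (pd 0 Phi2 t) v2 (C 0%nat _ H2)))
    (has_int2_plus _ _ _ _
      (has_int2_plus _ _ _ _ (has_int2_trig2 N (pd 1 Phi1 t) v1 v1 (C 1%nat _ H1)) (has_int2_trig2 N (pd 1 Phi2 t) v1 v2 (C 1%nat _ H2)))
      (has_int2_plus _ _ _ _ (has_int2_trig2 N (pd 2 Phi1 t) v2 v1 (C 2%nat _ H1)) (has_int2_trig2 N (pd 2 Phi2 t) v2 v2 (C 2%nat _ H2))))).
  match type of H with has_int2 _ ?v => replace (weakW N Phi1 Phi2 (V t) t) with v end.
  exact H.
  unfold weakW. rewrite <- !csum_plus.
  apply csum_ext. intros m _. rewrite <- !csum_plus. f_equal. apply csum_ext. intros l _.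
  rewrite !hc_pd1, !hc_pd2 by auto. unfold dotv, hcv, kdotv, v1, v2; cbn [fst snd]. ring.
Qed.

Lemma hc_divfree Phi1 Phi2 t k : smoothper Phi1 -> smoothper Phi2 ->
  (forall x y, pd 1 Phi1 t x y + pd 2 Phi2 t x y = 0) ->
  kdotv k (hcv (Phi1 t) (Phi2 t) k) = RtoC 0.
Proof.
  intros H1 H2 Hd.
  assert (E : hc (fun x y => pd 1 Phi1 t x y + pd 2 Phi2 t x y) k = RtoC 0).
  { rewrite (hc_ext _ (fun _ _ => 0)). apply hc_zero. auto. }
  rewrite hc_plus, hc_pd1, hc_pd2 in E by (auto; apply smoothper_cont2, smoothper_pd; auto).
  unfold kdotv, hcv; cbn [fst snd].
  replace (Cplus _ _) with (Cmult Ci (Cplus (Cmult (Cmult (Copp Ci) (RtoC (IZR (fst k)))) (hc (Phi1 t) k))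
     (Cmult (Cmult (Copp Ci) (RtoC (IZR (snd k)))) (hc (Phi2 t) k)))).
  rewrite E. ring.
  transitivity (Cmult (Copp (Cmult Ci Ci)) (Cplus (Cmult (RtoC (IZR (fst k))) (hc (Phi1 t) k))
     (Cmult (RtoC (IZR (snd k))) (hc (Phi2 t) k)))). ring.
  replace (Cmult Ci Ci) with (Copp (RtoC 1)). ring.
  unfold Ci, Cmult, Copp, RtoC; simpl. f_equal; ring.
Qed.

Lemma Cder_hc f k t : smoothper f -> Cder (fun s => hc (f s) k) t (hc (pd 0 f t) k).
Proof. intros H. exact (hc_pd0 f t k H). Qed.

Lemma vder_hcv f g k t : smoothper f -> smoothper g ->
  vder (fun s => hcv (f s) (g s) k) t (hcv (pd 0 f t) (pd 0 g t) k).
Proof. intros Hf Hg. exact (conj (Cder_hc f k t Hf) (Cder_hc g k t Hg)). Qed.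

Lemma vcont_hcv f g k t : smoothper f -> smoothper g -> vcont (fun s => hcv (f s) (g s) k) t.
Proof.
  intros Hf Hg.
  exact (conj (Cder_cont _ _ _ (Cder_hc f k t Hf)) (Cder_cont _ _ _ (Cder_hc g k t Hg))).
Qed.

Lemma Cder_CRint (W : R -> C) t : (forall x, Ccont W x) -> Cder (fun s => CRint W 0 s) t (W t).
Proof.
  intros HW.
  assert (E1 : forall s, ex_RInt (fun x => fst (W x)) 0 s).
  { intros s. apply (ex_RInt_continuous (V:=R_CompleteNormedModule)). intros; apply HW. }
  assert (E2 : forall s, ex_RInt (fun x => snd (W x)) 0 s).
  { intros s. apply (ex_RInt_continuous (V:=R_CompleteNormedModule)). intros; apply HW. }
  assert (E : forall s, CRint W 0 s = (RInt (fun x => fst (W x)) 0 s, RInt (fun x => snd (W x)) 0 s)).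
  { intros s. apply (is_RInt_unique (V:=CR)). apply is_RInt_pair; simpl; apply (RInt_correct (V:=R_CompleteNormedModule)); auto. }
  split.
  - apply (is_derive_ext (fun s => RInt (fun x => fst (W x)) 0 s)). intros s. rewrite E. reflexivity.
    apply (is_derive_RInt (fun x => fst (W x)) (fun s => RInt (fun x => fst (W x)) 0 s) 0).
    + apply filter_forall. intros s. apply (RInt_correct (V:=R_CompleteNormedModule)); auto.
    + apply HW.
  - apply (is_derive_ext (fun s => RInt (fun x => snd (W x)) 0 s)). intros s. rewrite E. reflexivity.
    apply (is_derive_RInt (fun x => snd (W x)) (fun s => RInt (fun x => snd (W x)) 0 s) 0).
    + apply filter_forall. intros s. apply (RInt_correct (V:=R_CompleteNormedModule)); auto.
    + apply HW.
Qed.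

Lemma kdotv_sym_zero V l k : divfree V -> Zksub k l = Zkneg l -> kdotv l (V (Zksub k l)) = RtoC 0.
Proof.
  intros Hd E. rewrite E. rewrite <- (Zkneg_neg l) at 1. rewrite kdotv_neg, Hd. ring.
Qed.

(** At k = 0 every term carries l.V_{-l} = 0. This reconciles the equation, imposed for nonzero k
    only, with [Bil_weak], which sums over the full box. *)
Lemma Bil_at_zero N V : divfree V -> Bil N V V (0%Z, 0%Z) = vzero.
Proof.
  intros Hd. unfold Bil. rewrite boxsumV_csum. unfold vzero.
  f_equal; apply csum_zero; intros l _; rewrite kdotv_sym_zero by (auto; unfold Zksub, Zkneg; simpl; f_equal; lia);
  unfold vscal; simpl; ring.
Qed.

Lemma dotv_svF N nu V g k : divfree V -> V (0%Z, 0%Z) = vzero -> inbox N k = true ->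
  kdotv k (g k) = RtoC 0 ->
  dotv (g k) (coefN N (svF N nu V) k) =
    Copp (Cplus (dotv (g k) (Bil N V V k)) (Cmult (RtoC (nu k)) (dotv (g k) (V k)))).
Proof.
  intros Hd H0 Hk Hg. unfold coefN. destruct (inbox0 N k) eqn:E.
  - unfold svF. rewrite dotv_vadd, !dotv_vscal, dotv_leray, RtoC_opp by auto.
    replace (RtoC (-1)) with (Copp (RtoC 1)) by (rewrite <- RtoC_opp; reflexivity). ring.
  - assert (k = (0%Z, 0%Z)).
    { destruct k as [k1 k2]. destruct (Z.eq_dec k1 0); destruct (Z.eq_dec k2 0); subst; auto;
      exfalso; assert (inbox0 N (_, _) = true) as E' by (apply inbox0_spec; split; [apply Hk|congruence]); congruence. }
    subst. rewrite H0, Bil_at_zero by auto. unfold dotv, vzero; simpl. ring.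
Qed.

(** For kn >= 1 each factor satisfies 1 + k_j^2 <= 2 kn^2; hence 4. *)
Lemma kn_kweight k : k <> (0%Z, 0%Z) -> / kn k ^ 4 <= 4 * kweight k.
Proof.
  intros Hk. assert (H := kn_ge1 k Hk). destruct (kn_abs k) as [H1 H2]. unfold kweight.
  assert (P1 := Rabs_pos (IZR (fst k))). assert (P2 := Rabs_pos (IZR (snd k))).
  rewrite <- (pow2_abs (IZR (fst k))), <- (pow2_abs (IZR (snd k))).
  set (a := Rabs _) in *. set (b := Rabs (IZR (snd k))) in *. set (n := kn k) in *.
  rewrite <- Rinv_mult.
  assert (A : 0 < 1 + a ^ 2 <= 2 * n ^ 2) by nra. assert (B : 0 < 1 + b ^ 2 <= 2 * n ^ 2) by nra.
  assert (Q : 0 < (1 + a^2) * (1 + b^2)) by (apply Rmult_lt_0_compat; lra).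
  assert (Q2 : (1 + a^2) * (1 + b^2) <= 2 * n ^ 2 * (2 * n ^ 2)) by (apply Rmult_le_compat; lra).
  apply Rmult_le_reg_r with (n ^ 4 * ((1 + a^2) * (1 + b^2))).
  apply Rmult_lt_0_compat; auto. apply pow_lt; lra.
  replace (/ n ^ 4 * (n ^ 4 * ((1 + a ^ 2) * (1 + b ^ 2)))) with ((1 + a ^ 2) * (1 + b ^ 2)) by (field; lra).
  replace (4 * / ((1 + a ^ 2) * (1 + b ^ 2)) * (n ^ 4 * ((1 + a ^ 2) * (1 + b ^ 2)))) with (2 * n ^ 2 * (2 * n ^ 2)) by (field; split; nra).
  auto.
Qed.

(** 2 vn <= 1 + vn^2 <= 1 + 2 B, by energy decay. *)
Lemma flow_vn_bound T N nu V B : 0 <= T -> SVflow T N nu V ->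
  rsum (boxlist N) (fun k => vnorm2 (V 0 k)) <= B ->
  forall t k, 0 <= t <= T -> vn (V t k) <= 1 + B.
Proof.
  intros HT HV HB t k Ht.
  assert (HE := flow_energy T N nu V HT HV t Ht).
  assert (HP0 : 0 <= rsum (boxlist N) (fun k => vnorm2 (V t k))) by (apply rsum_nonneg; intros; apply vnorm2_ge0).
  destruct (inbox N k) eqn:E.
  - assert (H1 : vnorm2 (V t k) <= rsum (boxlist N) (fun k => vnorm2 (V t k))).
    { apply (rsum_in_le (boxlist N) (fun k => vnorm2 (V t k))).
      intros; apply vnorm2_ge0. apply in_boxlist; auto. }
    assert (H2 := vn_sq (V t k)). assert (H3 := pow2_ge_0 (vn (V t k) - 1)). nra.
  - rewrite (flow_supported _ _ _ _ t HV) by auto. rewrite vn_vzero. lra.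
Qed.

(** Off the box kn >= N. One of the seven powers pays for the gradient and six give N^{-6}, against
    (2N+1)^4 <= 81 N^4 pairs. *)
Lemma high_modes_bound N V (g : Zk -> vecC) M G : (1 <= N)%nat -> 0 <= G ->
  (forall k, vn (V k) <= M) -> (forall k, kn k ^ 7 * vn (g k) <= G) ->
  Cmod (csum (boxlist N) (fun l => csum (boxlist N) (fun m =>
      if inbox N (Zkadd m l) then RtoC 0 else
      Cmult (Cmult (Copp Ci) (kdotv (Zkadd m l) (V m))) (dotv (g (Zkadd m l)) (V l)))))
  <= 81 * G * M ^ 2 / INR N ^ 2.
Proof.
  intros HN HG HM Hg. assert (Hn : 1 <= INR N) by (apply (le_INR 1); auto).
  assert (HM0 : 0 <= M) by (eapply Rle_trans; [apply vn_ge0|apply (HM (0%Z,0%Z))]).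
  set (c := G * M ^ 2 / INR N ^ 6).
  assert (Hc : 0 <= c).
  { apply Rdiv_le_0_compat. apply Rmult_le_pos; auto. apply pow2_ge_0. apply pow_lt; lra. }
  apply Rle_trans with (INR (length (boxlist N)) * (INR (length (boxlist N)) * c)).
  - rewrite <- (rsum_const (boxlist N) c), <- (rsum_const (boxlist N) (rsum _ _)).
    eapply Rle_trans. apply Cmod_csum.
    apply rsum_le. intros l _. eapply Rle_trans. apply Cmod_csum.
    apply rsum_le. intros m _.
    destruct (inbox N (Zkadd m l)) eqn:E. rewrite Cmod_0; auto.
    assert (Hk : INR N <= kn (Zkadd m l)).
    { destruct (Rle_dec (kn (Zkadd m l)) (INR N)) as [H|H]; [|lra].
      apply kn_inbox in H. congruence. }
    set (k := Zkadd m l) in *.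
    rewrite !Cmod_mult, Cmod_opp.
    replace (Cmod Ci) with 1.
    2:{ unfold Cmod, Ci; simpl. replace (0 * (0 * 1) + 1 * (1 * 1)) with 1 by ring. symmetry. apply sqrt_1. }
    rewrite Rmult_1_l.
    assert (H1 := kdotv_bound k (V m)). assert (H2 := vn_dotv (g k) (V l)).
    assert (H3 := HM m). assert (H4 := HM l). assert (H5 := Hg k).
    assert (P1 := vn_ge0 (V m)). assert (P2 := vn_ge0 (V l)). assert (P3 := vn_ge0 (g k)).
    assert (H6 : kn k * vn (g k) <= G / INR N ^ 6).
    { apply (proj1 (Rle_div_r _ _ _ (pow_lt (INR N) 6 ltac:(lra)))).
      apply Rle_trans with (kn k * vn (g k) * kn k ^ 6).
      apply Rmult_le_compat_l. apply Rmult_le_pos; lra. apply pow_incr. lra.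
      replace (kn k * vn (g k) * kn k ^ 6) with (kn k ^ 7 * vn (g k)) by ring. auto. }
    apply Rle_trans with ((kn k * vn (V m)) * (vn (g k) * vn (V l))).
    apply Rmult_le_compat; auto; apply Cmod_ge_0.
    replace (kn k * vn (V m) * (vn (g k) * vn (V l))) with (kn k * vn (g k) * (vn (V m) * vn (V l))) by ring.
    replace c with (G / INR N ^ 6 * (M * M)) by (unfold c; field; lra).
    apply Rmult_le_compat; auto. apply Rmult_le_pos; auto; lra. apply Rmult_le_pos; auto.
    apply Rmult_le_compat; auto.
  - rewrite length_boxlist, mult_INR, plus_INR, mult_INR. change (INR 2) with 2. change (INR 1) with 1.
    set (n := INR N) in *. set (q := 2 * n + 1). assert (Hq : 0 <= q <= 3 * n) by (unfold q; lra).
    replace (q * q * (q * q * c)) with (q ^ 4 * c) by ring.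
    replace (81 * G * M ^ 2 / n ^ 2) with ((3 * n) ^ 4 * c) by (unfold c; field; lra).
    apply Rmult_le_compat_r; auto. apply pow_incr. auto.
Qed.

(** 1152 = 2 * 4 * 144, from |k|^2 <= 2 kn^2, [kn_kweight] and [rsum_kweight]: the second-order
    symbol still leaves decay kn^{-4}, summable uniformly in N. *)
Lemma dissipation_bound N V (g : Zk -> vecC) nu M G c : 0 <= G -> 0 <= c ->
  (forall k, vn (V k) <= M) -> (forall k, kn k ^ 7 * vn (g k) <= G) ->
  (forall k, 0 <= nu k <= c * knorm2 k) -> V (0%Z,0%Z) = vzero ->
  Cmod (csum (boxlist N) (fun k => Cmult (RtoC (nu k)) (dotv (g k) (V k)))) <= 1152 * c * G * M.
Proof.
  intros HG Hc HM Hg Hnu H0.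
  assert (HM0 : 0 <= M) by (eapply Rle_trans; [apply vn_ge0|apply (HM (0%Z,0%Z))]).
  assert (HcGM : 0 <= 8 * c * G * M) by (repeat apply Rmult_le_pos; auto; lra).
  apply Rle_trans with (rsum (boxlist N) (fun k => (8 * c * G * M) * kweight k)).
  - eapply Rle_trans. apply Cmod_csum. apply rsum_le. intros k _.
    rewrite Cmod_mult, Cmod_R. destruct (Hnu k) as [N1 N2]. rewrite Rabs_right by lra.
    assert (Hd : k = (0%Z,0%Z) \/ k <> (0%Z,0%Z)) by tauto. destruct Hd as [Hd|Hd].
    + rewrite Hd at 2 3. rewrite H0. replace (dotv _ vzero) with (RtoC 0). rewrite Cmod_0, Rmult_0_r.
      apply Rmult_le_pos; auto. unfold kweight. left. apply Rmult_lt_0_compat; apply Rinv_0_lt_compat; nra.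
      unfold dotv, vzero; simpl; ring.
    + assert (H1 := kn_ge1 k Hd). destruct (knorm2_kn k) as [_ H2].
      assert (H3 := vn_dotv (g k) (V k)). assert (P1 := vn_ge0 (V k)). assert (P2 := vn_ge0 (g k)).
      assert (H4 : kn k ^ 2 * vn (g k) <= G * (4 * kweight k)).
      { apply Rle_trans with (G * / kn k ^ 4). 2: apply Rmult_le_compat_l; auto; apply kn_kweight; auto.
        assert (Hp : 0 < kn k ^ 4) by (apply pow_lt; lra).
        apply Rmult_le_reg_r with (kn k ^ 4); auto.
        replace (G * / kn k ^ 4 * kn k ^ 4) with G by (field; lra).
        replace (kn k ^ 2 * vn (g k) * kn k ^ 4) with (kn k ^ 6 * vn (g k)) by ring.
        eapply Rle_trans; [|apply (Hg k)]. apply Rmult_le_compat_r; auto.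
        replace (kn k ^ 7) with (kn k * kn k ^ 6) by ring.
        assert (0 < kn k ^ 6) by (apply pow_lt; lra). nra. }
      assert (H5 : nu k <= 2 * c * kn k ^ 2).
      { eapply Rle_trans. apply N2. replace (2 * c * kn k ^ 2) with (c * (2 * kn k ^ 2)) by ring.
        apply Rmult_le_compat_l; auto. }
      apply Rle_trans with (2 * c * kn k ^ 2 * (vn (g k) * M)).
      * apply Rmult_le_compat; auto. apply Cmod_ge_0. eapply Rle_trans. apply H3. apply Rmult_le_compat_l; auto.
      * replace (2 * c * kn k ^ 2 * (vn (g k) * M)) with (2 * c * M * (kn k ^ 2 * vn (g k))) by ring.
        replace (8 * c * G * M * kweight k) with (2 * c * M * (G * (4 * kweight k))) by ring.
        apply Rmult_le_compat_l; auto. repeat apply Rmult_le_pos; auto; lra.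
  - rewrite rsum_scal. assert (H := rsum_kweight N). nra.
Qed.

Lemma weak_euler_unfold T Phi1 Phi2 u : weak_euler T Phi1 Phi2 u =
  Cplus (CRint (fun t => int2C (weak_integrand Phi1 Phi2 u t)) 0 T)
    (int2C (fun x1 x2 =>
       Cplus (Cmult (RtoC (Phi1 0 x1 x2)) (fst (u 0 x1 x2)))
             (Cmult (RtoC (Phi2 0 x1 x2)) (snd (u 0 x1 x2))))).
Proof. reflexivity. Qed.

(* Z(t) = int_0^t W + A(0) - A(t), with A(t) = int Phi.u_N, interpolates between 0 and the weak
   residual; its derivative is only the truncation error plus the dissipation. *)
Lemma flow_weak_euler T N nu V B c G Phi1 Phi2 : 0 < T -> (1 <= N)%nat ->
  SVflow T N nu V -> rsum (boxlist N) (fun k => vnorm2 (V 0 k)) <= B ->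
  0 <= c -> (forall k, nu k <= c * knorm2 k) ->
  smoothper Phi1 -> smoothper Phi2 ->
  (forall t x y, 0 <= t < T -> pd 1 Phi1 t x y + pd 2 Phi2 t x y = 0) ->
  (forall x y, Phi1 T x y = 0 /\ Phi2 T x y = 0) ->
  0 <= G -> (forall t k, 0 <= t <= T -> kn k ^ 7 * vn (hcv (Phi1 t) (Phi2 t) k) <= G) ->
  Cmod (weak_euler T Phi1 Phi2 (fun t => vtrig N (V t))) <=
    2 * (81 * G * (1 + B) ^ 2 / INR N ^ 2 + 1152 * c * G * (1 + B)) * T.
Proof.
  intros HT HN HV HB Hc Hnu S1 S2 Hdiv HPT HG Hg.
  set (g := fun t k => hcv (Phi1 t) (Phi2 t) k).
  set (A := fun t => csum (boxlist N) (fun k => dotv (g t k) (V t k))).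
  set (W := fun t => weakW N Phi1 Phi2 (V t) t).
  assert (HgC : forall k t, vcont (fun s => g s k) t) by (intros k t; exact (vcont_hcv Phi1 Phi2 k t S1 S2)).
  assert (HVC := flow_cont _ _ _ _ HV).
  assert (HWC : forall t, Ccont W t).
  { intros t. apply Ccont_plus.
    - apply (Ccont_csum (boxlist N) (fun k s => dotv (hcv (pd 0 Phi1 s) (pd 0 Phi2 s) k) (V s k))).
      intros k _. apply Ccont_dotv; [|apply HVC].
      exact (vcont_hcv (pd 0 Phi1) (pd 0 Phi2) k t (smoothper_pd _ _ S1) (smoothper_pd _ _ S2)).
    - apply (Ccont_csum (boxlist N) (fun m s => csum (boxlist N) (fun l =>
       Cmult (Cmult (Copp Ci) (kdotv (Zkadd m l) (V s m))) (dotv (g s (Zkadd m l)) (V s l))))).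
      intros m _.
      apply (Ccont_csum (boxlist N) (fun l s =>
       Cmult (Cmult (Copp Ci) (kdotv (Zkadd m l) (V s m))) (dotv (g s (Zkadd m l)) (V s l)))).
      intros l _. apply Ccont_mult. 2: apply Ccont_dotv; auto.
      apply Ccont_mult. apply Ccont_const. unfold kdotv.
      apply Ccont_plus; apply Ccont_mult; try apply Ccont_const; apply HVC. }
  assert (HAC : forall t, Ccont A t).
  { intros t. apply (Ccont_csum (boxlist N) (fun k s => dotv (g s k) (V s k))).
    intros k _. apply Ccont_dotv; auto. }
  (* The constant A(0) is omitted, since only the increment [Z T - Z 0] is used. *)
  set (Z := fun t => Cplus (CRint W 0 t) (Cmult (RtoC (-1)) (A t))).
  assert (HAT : A T = RtoC 0).
  { apply csum_zero. intros k _. unfold g, hcv.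
    rewrite (hc_ext (Phi1 T) (fun _ _ => 0)), (hc_ext (Phi2 T) (fun _ _ => 0)), hc_zero by (intros; apply HPT).
    unfold dotv; simpl. ring. }
  assert (HA0 : int2C (fun x1 x2 =>
       Cplus (Cmult (RtoC (Phi1 0 x1 x2)) (fst (vtrig N (V 0) x1 x2)))
             (Cmult (RtoC (Phi2 0 x1 x2)) (snd (vtrig N (V 0) x1 x2)))) = A 0).
  { apply has_int2_unique.
    assert (H := has_int2_plus _ _ _ _
      (has_int2_trig N (Phi1 0) (fun k => fst (V 0 k)) (smoothper_cont2 _ 0 S1))
      (has_int2_trig N (Phi2 0) (fun k => snd (V 0 k)) (smoothper_cont2 _ 0 S2))).
    rewrite <- csum_plus in H. exact H. }
  assert (HZ : weak_euler T Phi1 Phi2 (fun t => vtrig N (V t)) = Cminus (Z T) (Z 0)).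
  { rewrite weak_euler_unfold, HA0.
    rewrite (RInt_ext (V:=CR) _ W).
    2:{ intros t _. apply has_int2_unique. apply weak_integrand_int; auto. }
    unfold Z. rewrite HAT. rewrite (RInt_point (V:=CR) 0 W). change (zero : CR) with (RtoC 0).
    replace (RtoC (-1)) with (Copp (RtoC 1)) by (rewrite <- RtoC_opp; reflexivity). ring. }
  rewrite HZ.
  assert (HM := flow_vn_bound T N nu V B (Rlt_le _ _ HT) HV HB).
  replace (2 * (81 * G * (1 + B) ^ 2 / INR N ^ 2 + 1152 * c * G * (1 + B)) * T) with
    (2 * (81 * G * (1 + B) ^ 2 / INR N ^ 2 + 1152 * c * G * (1 + B)) * (T - 0)) by ring.
  set (F := fun t k => coefN N (svF N nu (V t)) k).
  set (A' := fun t => csum (boxlist N) (fun k => Cplus (dotv (hcv (pd 0 Phi1 t) (pd 0 Phi2 t) k) (V t k)) (dotv (g t k) (F t k)))).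
  apply (Cincrement_le Z (fun t => Cplus (W t) (Cplus (Cmult (RtoC 0) (A t)) (Cmult (RtoC (-1)) (A' t))))). lra.
  - intros t. apply Ccont_plus. eapply Cder_cont, Cder_CRint; auto.
    apply Ccont_mult. apply Ccont_const. auto.
  - intros t Ht. split.
    + apply Cder_plus. apply Cder_CRint; auto.
      apply (Cder_mult (fun _ => RtoC (-1))). apply Cder_const.
      apply (Cder_csum (boxlist N) (fun k s => dotv (g s k) (V s k))).
      intros k _. apply Cder_dotv. exact (vder_hcv Phi1 Phi2 k t S1 S2). apply (flow_der _ _ _ _ HV); auto.
    + assert (V0 : V t (0%Z,0%Z) = vzero) by (apply (flow_supp _ _ _ _ HV); unfold inbox0; apply Bool.andb_false_r).
      assert (E1 : csum (boxlist N) (fun k => dotv (g t k) (F t k)) =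
        Copp (Cplus (csum (boxlist N) (fun k => dotv (g t k) (Bil N (V t) (V t) k)))
                    (csum (boxlist N) (fun k => Cmult (RtoC (nu k)) (dotv (g t k) (V t k)))))).
      { rewrite <- csum_plus. set (h := fun k => Cplus (dotv (g t k) (Bil N (V t) (V t) k)) (Cmult (RtoC (nu k)) (dotv (g t k) (V t k)))).
        transitivity (csum (boxlist N) (fun k => Cmult (Copp (RtoC 1)) (h k))).
        - apply csum_ext. intros k Hk. assert (Hgk : kdotv k (g t k) = RtoC 0).
          { exact (hc_divfree Phi1 Phi2 t k S1 S2 (fun x y => Hdiv t x y (conj (Rlt_le _ _ (proj1 Ht)) (proj2 Ht)))). }
          etransitivity.
          exact (dotv_svF N nu (V t) (g t) k (flow_div _ _ _ _ HV t) V0 (proj1 (in_boxlist N k) Hk) Hgk).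
          unfold h. ring.
        - rewrite csum_scal. ring. }
      assert (E2 := Bil_weak N (V t) (g t) (flow_supported _ _ _ _ t HV) (flow_div _ _ _ _ HV t)).
      (* The time derivatives of Phi in W and A' cancel, and [Bil_weak] cancels the resolved
         interactions. *)
      match goal with |- Cmod ?e <= _ => replace e with
        (Cplus (csum (boxlist N) (fun l => csum (boxlist N) (fun m =>
          if inbox N (Zkadd m l) then RtoC 0 else
          Cmult (Cmult (Copp Ci) (kdotv (Zkadd m l) (V t m))) (dotv (g t (Zkadd m l)) (V t l)))))
          (csum (boxlist N) (fun k => Cmult (RtoC (nu k)) (dotv (g t k) (V t k))))) end.
      * eapply Rle_trans. apply Cmod_triangle. apply Rplus_le_compat.
        apply high_modes_bound; auto. intros; apply HM; lra. exact (fun k => Hg t k (conj (Rlt_le _ _ (proj1 Ht)) (Rlt_le _ _ (proj2 Ht)))).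
        apply dissipation_bound; auto. intros; apply HM; lra. exact (fun k => Hg t k (conj (Rlt_le _ _ (proj1 Ht)) (Rlt_le _ _ (proj2 Ht)))).
        intros; split; auto. apply (flow_nu_pos _ _ _ _ HV).
      * rewrite <- E2. unfold A'. rewrite csum_plus, E1. unfold W, weakW. fold (g t).
        replace (RtoC (-1)) with (Copp (RtoC 1)) by (rewrite <- RtoC_opp; reflexivity).
        change (fun k => dotv (hcv (Phi1 t) (Phi2 t) k)) with (fun k => dotv (g t k)).
        unfold g. ring.
Qed.

(** * From SV solutions to flows *)

(* Solutions are constrained on [0,T] only; clamping time makes them continuous on R. *)
Definition clamp (T t : R) : R := Rmax 0 (Rmin T t).

Lemma clamp_range T t : 0 <= T -> 0 <= clamp T t <= T.
Proof. intros H. unfold clamp. split. apply Rmax_l. apply Rmax_lub; auto. apply Rmin_l. Qed.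

Lemma clamp_id T t : 0 <= t <= T -> clamp T t = t.
Proof. intros H. unfold clamp. rewrite Rmin_right, Rmax_right; lra. Qed.

Lemma continuous_clamp T t : continuous (clamp T) t.
Proof.
  intros P [eps HP]. exists eps. intros s Hs. apply HP.
  change (Rabs (s - t) < eps) in Hs. change (Rabs (clamp T s - clamp T t) < eps).
  eapply Rle_lt_trans; [|apply Hs]. unfold clamp.
  unfold Rmax, Rmin; repeat destruct Rle_dec; unfold Rabs; repeat destruct Rcase_abs; lra.
Qed.

Lemma vcont_of_continuous (f : R -> vecC) t :
  filterlim f (locally t) (locally (T := prod_UniformSpace C_UniformSpace C_UniformSpace) (f t)) ->
  vcont f t.
Proof.
  intros H. split; split; intros P [eps HP].
  - exact (H (fun v => P (fst (fst v))) (ex_intro _ eps (fun v Hv => HP _ (proj1 (proj1 Hv))))).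
  - exact (H (fun v => P (snd (fst v))) (ex_intro _ eps (fun v Hv => HP _ (proj2 (proj1 Hv))))).
  - exact (H (fun v => P (fst (snd v))) (ex_intro _ eps (fun v Hv => HP _ (proj1 (proj2 Hv))))).
  - exact (H (fun v => P (snd (snd v))) (ex_intro _ eps (fun v Hv => HP _ (proj2 (proj2 Hv))))).
Qed.

Lemma is_derive_fst {U V : NormedModule R_AbsRing} (f : R -> U * V) t (l : U * V) :
  is_derive f t l -> is_derive (fun s => fst (f s)) t (fst l).
Proof.
  intros H. apply (filterdiff_comp' f fst t (fun y => scal y l) fst H).
  apply filterdiff_linear. apply is_linear_fst.
Qed.
Lemma is_derive_snd {U V : NormedModule R_AbsRing} (f : R -> U * V) t (l : U * V) :
  is_derive f t l -> is_derive (fun s => snd (f s)) t (snd l).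
Proof.
  intros H. apply (filterdiff_comp' f snd t (fun y => scal y l) snd H).
  apply filterdiff_linear. apply is_linear_snd.
Qed.

Lemma vder_of_is_derive (f : R -> vecC) t (l : vecC) : is_derive f t l -> vder f t l.
Proof.
  intros H. assert (H1 := is_derive_fst _ _ _ H). assert (H2 := is_derive_snd _ _ _ H).
  split; split.
  - exact (is_derive_fst _ _ _ H1).
  - exact (is_derive_snd _ _ _ H1).
  - exact (is_derive_fst _ _ _ H2).
  - exact (is_derive_snd _ _ _ H2).
Qed.

Lemma Cder_ext_loc (f g : R -> C) t d : locally t (fun s => f s = g s) -> Cder f t d -> Cder g t d.
Proof.
  intros H [H1 H2]. split.
  - apply (is_derive_ext_loc (fun s => fst (f s))); auto.
    apply (filter_imp (fun s => f s = g s)); auto. intros s ->; auto.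
  - apply (is_derive_ext_loc (fun s => snd (f s))); auto.
    apply (filter_imp (fun s => f s = g s)); auto. intros s ->; auto.
Qed.

Lemma vder_ext_loc (f g : R -> vecC) t d : locally t (fun s => f s = g s) -> vder f t d -> vder g t d.
Proof.
  intros H [H1 H2]. split.
  - apply (Cder_ext_loc (fun s => fst (f s))); auto.
    apply (filter_imp (fun s => f s = g s)); auto. intros s ->; auto.
  - apply (Cder_ext_loc (fun s => snd (f s))); auto.
    apply (filter_imp (fun s => f s = g s)); auto. intros s ->; auto.
Qed.

Lemma locally_interior T t : 0 < t < T -> locally t (fun s => 0 < s < T).
Proof. intros H. apply (open_and _ _ (open_gt 0) (open_lt T)). auto. Qed.

Definition clampV (T : R) (N : nat) (uh : R -> Zk -> vecC) (t : R) (k : Zk) : vecC :=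
  coefN N (uh (clamp T t)) k.

Lemma SV_solution_flow T eps N Rh Kh u0 uh : 0 < T -> 0 < eps ->
  (forall k, 0 <= Rh k <= 1) -> (forall k, Rh (Zkneg k) = Rh k) ->
  (forall k, Kh (Zkneg k) = Cconj (Kh k)) -> (forall k, u0 (Zkneg k) = vconj (u0 k)) ->
  is_SV_solution T eps N Rh Kh u0 uh ->
  SVflow T N (fun k => eps * knorm2 k * (1 - Rh k)) (clampV T N uh).
Proof.
  intros HT He HR HRs HK Hu H.
  assert (Hc := fun t => clamp_range T t (Rlt_le _ _ HT)).
  constructor.
  - intros t k Hk. unfold clampV, coefN. rewrite Hk. auto.
  - intros t k. unfold clampV, coefN. destruct (inbox0 N k) eqn:E; [|apply kdotv_zero].
    apply (H k E). auto.
  - intros k t. unfold clampV, coefN. destruct (inbox0 N k) eqn:E.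
    + apply vcont_of_continuous.
      (* Continuity is only given relative to [0,T], but the clamp never leaves [0,T]. *)
      apply (filterlim_comp _ _ _ (clamp T) (fun s => uh s k) _ (within (fun s => 0 <= s <= T) (locally (clamp T t)))).
      * intros P HP. generalize (continuous_clamp T t _ HP). unfold filtermap.
        apply filter_imp. intros s Hs. apply Hs. auto.
      * apply (H k E). auto.
    + split; apply Ccont_const.
  - intros k t Ht. unfold clampV at 1. unfold coefN at 1 2.
    destruct (inbox0 N k) eqn:E; [|split; apply Cder_const].
    (* Near an interior time the clamp is the identity. *)
    apply (vder_ext_loc (fun s => uh s k)).
    + apply (filter_imp (fun s => 0 < s < T)); [|apply locally_interior; auto].
      intros s Hs. rewrite clamp_id; auto; lra.
    + apply vder_of_is_derive. destruct (H k E) as (_ & _ & _ & Hd). specialize (Hd t Ht).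
      replace (svF N (fun k => eps * knorm2 k * (1 - Rh k)) (clampV T N uh t) k)
        with (sv_rhs N eps (fun j => 1 - Rh j) (uh t) k). exact Hd.
      unfold sv_rhs, svF. rewrite nonlin_Bil. unfold clampV. rewrite clamp_id by lra.
      f_equal. f_equal. unfold coefN. rewrite E. auto.
  - intros k. unfold clampV, coefN. rewrite inbox0_neg, clamp_id by lra.
    destruct (inbox0 N k) eqn:E; [|rewrite vconj_vzero; auto].
    destruct (H k E) as (_ & -> & _). assert (E' := E). rewrite <- inbox0_neg in E'.
    destruct (H _ E') as (_ & -> & _). rewrite HK, Hu, vconj_vscal. auto.
  - intros k. rewrite knorm2_neg, HRs. auto.
  - intros k. destruct (knorm2_kn k) as [Hk _]. assert (P := pow2_ge_0 (kn k)). specialize (HR k).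
    apply Rmult_le_pos; [apply Rmult_le_pos|]; lra.
Qed.

Lemma clampV_init T eps N Rh Kh u0 uh B : 0 < T ->
  (forall k, Cmod (Kh k) <= 1) -> boxsumR N (fun k => vnorm2 (u0 k)) <= B ->
  is_SV_solution T eps N Rh Kh u0 uh ->
  rsum (boxlist N) (fun k => vnorm2 (clampV T N uh 0 k)) <= B.
Proof.
  intros HT HK HB H. eapply Rle_trans; [|apply HB].
  change (rsum (boxlist N) (fun k => vnorm2 (clampV T N uh 0 k)) <= rsum (boxlist N) (fun k => vnorm2 (u0 k))).
  apply rsum_le. intros k _. unfold clampV, coefN. rewrite clamp_id by lra.
  destruct (inbox0 N k) eqn:E.
  - destruct (H k E) as (_ & -> & _). specialize (HK k).
    unfold vnorm2, vscal; simpl. rewrite !Cmod_mult.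
    assert (P := Cmod_ge_0 (Kh k)). set (c := Cmod (Kh k)) in *.
    set (x := Cmod (fst (u0 k))). set (y := Cmod (snd (u0 k))).
    assert (c * c <= 1) by nra.
    assert (0 <= x * x) by nra. assert (0 <= y * y) by nra. nra.
  - replace (vnorm2 vzero) with 0. apply vnorm2_ge0. unfold vnorm2, vzero; simpl. rewrite Cmod_0; ring.
Qed.

Lemma uphys_clamp T N uh t x y : 0 <= t <= T -> uphys N (uh t) x y = vtrig N (clampV T N uh t) x y.
Proof.
  intros Ht. rewrite uphys_vtrig. unfold vtrig, trig, clampV. rewrite clamp_id by auto. reflexivity.
Qed.

(** * Norms and weak forms of the approximations *)

Lemma L2norm_vtrig N V B : rsum (boxlist N) (fun k => vnorm2 (V k)) <= B ->
  L2norm (vtrig N V) <= sqrt (4 * PI ^ 2 * B).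
Proof.
  intros HB. apply sqrt_le_1_alt.
  assert (H := has_int2_plus _ _ _ _ (has_int2_parseval N (fun k => fst (V k))) (has_int2_parseval N (fun k => snd (V k)))).
  rewrite <- RtoC_plus, <- Rmult_plus_distr_l, <- rsum_plus in H.
  assert (E : int2R (fun x y => vnorm2 (vtrig N V x y)) =
    fst (RtoC (4 * PI ^ 2 * rsum (boxlist N) (fun k => Cmod (fst (V k)) ^ 2 + Cmod (snd (V k)) ^ 2)))).
  { apply has_int2_re. eapply has_int2_ext; [|apply H]. intros x y.
    unfold vnorm2. rewrite RtoC_plus. reflexivity. }
  rewrite E. cbn [fst RtoC].
  apply Rmult_le_compat_l; auto. assert (P := pow2_ge_0 PI). lra.
Qed.

Lemma L2norm_ext f g : (forall x y, f x y = g x y) -> L2norm f = L2norm g.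
Proof. intros H. unfold L2norm. f_equal. apply int2R_ext. intros. rewrite H. auto. Qed.

(** The weight (1+|k|^2)^{-4} absorbs the squared growth kn^4 and leaves (1+|k|^2)^{-2} <=
    [kweight k]; 12 is the square root of 144. *)
Lemma Hneg4_bound N (w : Zk -> vecC) D : 0 <= D ->
  (forall k, inbox0 N k = true -> vn (w k) <= D * kn k ^ 2) -> HnegNorm 4 N w <= 12 * D.
Proof.
  intros HD H. unfold HnegNorm.
  rewrite <- (sqrt_pow2 (12 * D)) by lra. apply sqrt_le_1_alt.
  apply Rle_trans with (rsum (boxlist N) (fun k => D ^ 2 * kweight k)).
  - apply rsum_le. intros k _.
    assert (Hw : 0 < kweight k) by (unfold kweight; apply Rmult_lt_0_compat; apply Rinv_0_lt_compat; nra).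
    destruct (inbox0 N k) eqn:E; [|assert (0 <= D^2) by apply pow2_ge_0; nra].
    specialize (H k E). destruct (knorm2_kn k) as [Hk _].
    assert (P := pow2_ge_0 (kn k)). assert (P2 := vn_ge0 (w k)).
    set (q := 1 + knorm2 k). assert (Hq : 1 <= q) by (unfold q; lra).
    replace (Rpower q (Ropp 4)) with (/ q ^ 4).
    2:{ rewrite Rpower_Ropp. f_equal. rewrite <- (Rpower_pow 4 q) by lra. f_equal. simpl; ring. }
    assert (H1 : vnorm2 (w k) <= D ^ 2 * q ^ 2).
    { eapply Rle_trans. apply vnorm2_vn. rewrite <- Rpow_mult_distr. apply pow_incr. split; auto.
      eapply Rle_trans. apply H. apply Rmult_le_compat_l; auto. unfold q; lra. }
    assert (Hq4 : 0 < q ^ 4) by (apply pow_lt; lra).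
    apply Rle_trans with (/ q ^ 4 * (D ^ 2 * q ^ 2)).
    { apply Rmult_le_compat_l; auto. left. apply Rinv_0_lt_compat; auto. }
    replace (/ q ^ 4 * (D ^ 2 * q ^ 2)) with (D ^ 2 * / q ^ 2) by (field; lra).
    apply Rmult_le_compat_l. apply pow2_ge_0.
    unfold kweight. rewrite <- Rinv_mult.
    assert (A1 := pow2_ge_0 (IZR (fst k))). assert (A2 := pow2_ge_0 (IZR (snd k))).
    apply Rinv_le_contravar. apply Rmult_lt_0_compat; lra.
    assert (Ek : knorm2 k = IZR (fst k) ^ 2 + IZR (snd k) ^ 2).
    { unfold knorm2. rewrite plus_IZR, !mult_IZR. ring. }
    unfold q. rewrite Ek. nra.
  - rewrite rsum_scal. assert (Hk := rsum_kweight N). assert (0 <= D^2) by apply pow2_ge_0. nra.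
Qed.

(** Lets the clamped flow replace [uh], with which it agrees on [0,T] only. *)
Lemma weak_euler_ext T Phi1 Phi2 u u' : 0 <= T ->
  (forall t x y, 0 <= t <= T -> u t x y = u' t x y) ->
  weak_euler T Phi1 Phi2 u = weak_euler T Phi1 Phi2 u'.
Proof.
  intros HT H. rewrite !weak_euler_unfold. apply (f_equal2 Cplus).
  - apply (RInt_ext (V:=CR)). rewrite Rmin_left, Rmax_right by auto. intros t Ht.
    apply (RInt_ext (V:=CR)). intros x _. apply (RInt_ext (V:=CR)). intros y _.
    unfold weak_integrand. rewrite H by lra. auto.
  - apply (RInt_ext (V:=CR)). intros x _. apply (RInt_ext (V:=CR)). intros y _.
    rewrite H by lra. auto.
Qed.

Lemma weak_div_ext T psi u u' : 0 <= T ->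
  (forall t x y, 0 <= t <= T -> u t x y = u' t x y) ->
  weak_div T psi u = weak_div T psi u'.
Proof.
  intros HT H. unfold weak_div.
  apply (RInt_ext (V:=CR)). rewrite Rmin_left, Rmax_right by auto. intros t Ht.
  apply (RInt_ext (V:=CR)). intros x _. apply (RInt_ext (V:=CR)). intros y _.
  rewrite H by lra. auto.
Qed.

(** After integration by parts mode k contributes a multiple of k.V_k. *)
Lemma weak_div_vtrig T N V psi : (forall t, divfree (V t)) -> smoothper psi ->
  weak_div T psi (fun t => vtrig N (V t)) = RtoC 0.
Proof.
  intros Hd Hp.
  assert (E : forall t, int2C (fun x y => Cplus (Cmult (RtoC (pd 1 psi t x y)) (fst (vtrig N (V t) x y)))
     (Cmult (RtoC (pd 2 psi t x y)) (snd (vtrig N (V t) x y)))) = RtoC 0).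
  { intros t. apply has_int2_unique.
    assert (H := has_int2_plus _ _ _ _
      (has_int2_trig N (pd 1 psi t) (fun k => fst (V t k)) (smoothper_cont2 _ t (smoothper_pd psi 1 Hp)))
      (has_int2_trig N (pd 2 psi t) (fun k => snd (V t k)) (smoothper_cont2 _ t (smoothper_pd psi 2 Hp)))).
    rewrite <- csum_plus, csum_zero in H. exact H.
    intros k _. rewrite hc_pd1, hc_pd2 by auto.
    transitivity (Cmult (Cmult (Copp Ci) (hc (psi t) k)) (kdotv k (V t k))).
    unfold kdotv; ring. rewrite Hd. ring. }
  unfold weak_div. rewrite (RInt_ext (V:=CR) _ (fun _ => RtoC 0)) by (intros t _; apply E).
  rewrite (RInt_const (V:=CR)). unfold scal; simpl. unfold prod_scal, scal; simpl. unfold mult, RtoC; simpl.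
  f_equal; ring.
Qed.

Lemma is_lim_seq_bounded_above (u : nat -> R) (l : R) : is_lim_seq u l ->
  exists c, 0 <= c /\ forall n, u n <= c.
Proof.
  intros H. apply is_lim_seq_Reals in H.
  destruct (maj_by_pos u) as (c & Hc & Hu). exists l; auto.
  exists c. split. lra. intros n. eapply Rle_trans. apply Rle_abs. apply Hu.
Qed.

Theorem mainTheorem2
  (T : R) (HT : 0 < T)
  (* initial datum u0 in L^2(T^2;R^2), div u0 = 0, mean zero, given by its Fourier coefficients *)
  (u0hat : Zk -> vecC)
  (Hu0_L2 : exists B, forall M : nat, boxsumR M (fun k => vnorm2 (u0hat k)) <= B)
  (Hu0_real : forall k, u0hat (Zkneg k) = vconj (u0hat k))
  (Hu0_mean : u0hat (0%Z, 0%Z) = vzero)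
  (Hu0_div : forall k, kdotv k (u0hat k) = RtoC 0)
  (* parameters of the scheme *)
  (eps : nat -> R) (Heps_pos : forall N, (2 <= N)%nat -> 0 < eps N)
  (Heps_lim : is_lim_seq eps 0)
  (m : nat -> R) (Hm : forall N, (2 <= N)%nat -> 0 <= m N)
  (a : nat -> nat) (Ha : forall N, (2 <= N)%nat -> (1 <= a N <= N)%nat)
  (Rhat : nat -> Zk -> R)
  (HR01 : forall N k, (2 <= N)%nat -> 0 <= Rhat N k <= 1)
  (HR1 : forall N k, (2 <= N)%nat -> knorm k <= m N -> Rhat N k = 1)
  (HR0 : forall N k, (2 <= N)%nat -> 2 * m N < knorm k -> Rhat N k = 0)
  (HRsym : forall N k, (2 <= N)%nat -> Rhat N (Zkneg k) = Rhat N k)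
  (Khat : nat -> Zk -> C)
  (HKsupp : forall N k, (2 <= N)%nat -> inbox (a N) k = false -> Khat N k = RtoC 0)
  (HKbd : forall N k, (2 <= N)%nat -> Cmod (Khat N k) <= 1)
  (HKreal : forall N k, (2 <= N)%nat -> Khat N (Zkneg k) = Cconj (Khat N k))
  (HL1 : exists C0, forall N, (2 <= N)%nat ->
      L1normC (trigpoly (Z.to_nat (up (2 * m N))) (fun k => RtoC (Rhat N k)))
        <= C0 * ln (INR N) ^ 2 /\
      L1normC (trigpoly (a N) (Khat N)) <= C0 * ln (INR N) ^ 2)
  (* the SV approximations *)
  (uh : nat -> R -> Zk -> vecC)
  (Huh : forall N, (2 <= N)%nat -> is_SV_solution T (eps N) N (Rhat N) (Khat N) u0hat (uh N)) :
  let u := fun (N : nat) (t x1 x2 : R) => uphys N (uh N t) x1 x2 in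
  (* (1) uniform bound in L^infty(0,T; L^2) *)
  (exists C1, forall N t, (2 <= N)%nat -> 0 <= t <= T -> L2norm (u N t) <= C1) /\
  (* (1') uniform bound in Lip((0,T); H^{-L}) for some L > 1 *)
  (exists L, 1 < L /\ exists C2, forall N t1 t2, (2 <= N)%nat ->
      0 < t1 < T -> 0 < t2 < T ->
      HnegNorm L N (fun k => vsub (uh N t2 k) (uh N t1 k)) <= C2 * Rabs (t2 - t1)) /\
  (* (2) consistency with the weak form of Euler *)
  (forall Phi1 Phi2 : fn3, is_test_field T Phi1 Phi2 ->
      is_lim_seq (fun N => Cmod (weak_euler T Phi1 Phi2 (u N))) 0) /\
  (* (3) div u_N = 0 in distributions on [0,T] x T^2 *)
  (forall N, (2 <= N)%nat -> forall psi : fn3, smooth3 psi -> periodic_x psi ->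
      weak_div T psi (u N) = RtoC 0).
Proof.
  intros u.
  destruct Hu0_L2 as [B HB].
  destruct (is_lim_seq_bounded_above eps 0 Heps_lim) as (c & Hc0 & Hc).
  assert (HB0 : 0 <= B).
  { eapply Rle_trans; [|apply (HB O)]. apply (rsum_nonneg (boxlist 0)). intros; apply vnorm2_ge0. }
  set (nu := fun N k => eps N * knorm2 k * (1 - Rhat N k)).
  set (V := fun N => clampV T N (uh N)).
  assert (HT0 : 0 <= T) by lra.
  assert (HF : forall N, (2 <= N)%nat -> SVflow T N (nu N) (V N)).
  { intros N HN. apply (SV_solution_flow T (eps N) N (Rhat N) (Khat N) u0hat); auto. }
  assert (HV0 : forall N, (2 <= N)%nat -> rsum (boxlist N) (fun k => vnorm2 (V N 0 k)) <= B).
  { intros N HN. apply (clampV_init T (eps N) N (Rhat N) (Khat N) u0hat); auto. }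
  assert (Hnu : forall N k, (2 <= N)%nat -> nu N k <= eps N * knorm2 k).
  { intros N k HN. unfold nu. destruct (HR01 N k HN). destruct (knorm2_kn k).
    assert (0 <= kn k ^ 2) by apply pow2_ge_0. specialize (Heps_pos N HN).
    assert (0 <= eps N * knorm2 k) by (apply Rmult_le_pos; lra). nra. }
  assert (Hu : forall N t x y, 0 <= t <= T -> u N t x y = vtrig N (V N t) x y).
  { intros. apply uphys_clamp; auto. }
  split; [|split; [|split]].
  - exists (sqrt (4 * PI ^ 2 * B)). intros N t HN Ht.
    rewrite (L2norm_ext (u N t) (vtrig N (V N t))) by (intros; apply Hu; auto).
    apply L2norm_vtrig. eapply Rle_trans; [|apply (HV0 N HN)].
    apply (flow_energy T N (nu N)); auto.
  - exists 4. split. lra. set (K := 6 * B + 2 * c * (1 + B)).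
    assert (HK : 0 <= K) by (unfold K; nra).
    (* 12 from [Hneg4_bound] times 4 from [flow_lipschitz], the latter used with the common bound c
       of all [eps N], so that K is free of N. *)
    exists (48 * K). intros N t1 t2 HN H1 H2.
    replace (48 * K * Rabs (t2 - t1)) with (12 * (4 * K * Rabs (t2 - t1))) by ring.
    assert (Hr := Rabs_pos (t2 - t1)).
    apply Hneg4_bound. apply Rmult_le_pos; lra.
    intros k Hk.
    assert (HL := flow_lipschitz T N (nu N) (V N) B c HT0 (HF N HN) (HV0 N HN)).
    assert (Hnc : forall k, nu N k <= c * knorm2 k).
    { intros j. eapply Rle_trans. apply Hnu; auto. apply Rmult_le_compat_r; auto.
      destruct (knorm2_kn j). assert (P := pow2_ge_0 (kn j)). lra. }
    specialize (HL Hnc t1 t2 k H1 H2 Hk). fold K in HL.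
    unfold V, clampV, coefN in HL. rewrite Hk, !clamp_id in HL by lra. lra.
  - intros Phi1 Phi2 (S1 & S2 & Q1 & Q2 & Hdiv & T' & HT' & Hz).
    assert (P1 : smoothper Phi1) by (split; auto).
    assert (P2 : smoothper Phi2) by (split; auto).
    destruct (hc_decay Phi1 7 0 T HT0 P1) as (G1 & HG1 & HD1).
    destruct (hc_decay Phi2 7 0 T HT0 P2) as (G2 & HG2 & HD2).
    set (G := G1 + G2).
    (* Twice the 81 and the 1152 of [flow_weak_euler]. *)
    set (K1 := 162 * G * (1 + B) ^ 2 * T). set (K2 := 2304 * G * (1 + B) * T).
    apply (is_lim_seq_le_le_loc (fun _ => 0) _ (fun N => K1 * (/ INR N * / INR N) + K2 * eps N)).
    + exists 2%nat. intros N HN. split. apply Cmod_ge_0.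
      rewrite (weak_euler_ext T Phi1 Phi2 (u N) (fun t => vtrig N (V N t))) by auto.
      assert (HN0 : 2 <= INR N) by (apply (le_INR 2); auto).
      eapply Rle_trans.
      (* The damping constant is now [eps N] itself and not its bound c: this makes the dissipation
         vanish in the limit. *)
      * apply (flow_weak_euler T N (nu N) (V N) B (eps N) G Phi1 Phi2); auto.
        { lia. } { left; auto. } { intros x y. apply Hz. lra. } { unfold G; lra. }
        intros t k Ht. unfold vn, hcv; cbn [fst snd]. rewrite Rmult_plus_distr_l.
        apply Rplus_le_compat; auto.
      * right. unfold K1, K2. field. lra.
    + apply is_lim_seq_const.
    + assert (Hi : is_lim_seq (fun N => / INR N) 0).
      { apply (is_lim_seq_inv INR p_infty). apply is_lim_seq_INR. discriminate. }
      replace (Finite 0) with (Finite (K1 * (0 * 0) + K2 * 0)) by (f_equal; ring).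
      apply is_lim_seq_plus'; apply is_lim_seq_mult'; try apply is_lim_seq_const; auto.
      apply is_lim_seq_mult'; auto.
  - intros N HN psi S1 Q1.
    rewrite (weak_div_ext T psi (u N) (fun t => vtrig N (V N t))) by auto.
    apply weak_div_vtrig. apply (flow_div _ _ _ _ (HF N HN)). split; auto.
Qed.
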